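(* Let $B^\star=2-\frac{2e}{3}$. For any $B\in[B^\star,1)$ and $\alpha>0$, there exists $\overline\alpha_f(\alpha,B)>0$ such that for all $\alpha_f>\overline\alpha_f(\alpha,B)$, $$\eta_{\mathrm{TS}}(B,\alpha,\alpha_f)>\eta_{\mathrm{OS}}(B,\alpha,\alpha_f).$$
   Context: For $b^{\mathrm L},b^{\mathrm R}\in[0,1]$ and a $2\times2$ matrix $\mathbf C=[c_{xy}]$ with non-negative entries, $G_n$ is the random bipartite graph with $n$ supply and $n$ demand nodes in which, independently over nodes, each supply node is of type 2 (flexible) with probability $b^{\mathrm L}$ and of type 1 (regular) otherwise, each demand node is of type 2 with probability $b^{\mathrm R}$ and of type 1 otherwise, and, conditional on types, a supply node of type $x$ and a demand node of type $y$ are connected independently with probability $c_{xy}/n$ ($n$ large). $M_\star(G_n)$ is the maximum matching size and $\eta(b^{\mathrm L},b^{\mathrm R};\mathbf C)=\lim_{n\to\infty}\mathbb E[M_\star(G_n)]/n$ (the limit exists). For $\alpha,\alpha_f\ge0$ and a flexibility budget $B\in(0,1]$, set $\mathbf C=\begin{bmatrix}2\alpha&\alpha+\alpha_f\\ \alpha+\alpha_f&2\alpha_f\end{bmatrix}$, $\eta_{\mathrm{OS}}(B,\alpha,\alpha_f)=\eta(B,0;\mathbf C)$ (one-sided allocation) and $\eta_{\mathrm{TS}}(B,\alpha,\alpha_f)=\eta(B/2,B/2;\mathbf C)$ (two-sided allocation). Here $e$ is the base of the natural logarithm. *)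

(* Defs.v *)
From mathcomp Require Import all_boot all_order all_algebra.
From mathcomp Require Import all_classical all_reals all_analysis.
Set Implicit Arguments.
Unset Strict Implicit.
Unset Printing Implicit Defensive.
Import Order.TTheory GRing.Theory Num.Theory.
Import numFieldNormedType.Exports.
Local Open Scope ring_scope.

(* A bipartite graph with n supply and n demand nodes is given by its edge set
   E : {set 'I_n * 'I_n}; an edge is a pair (supply node, demand node). *)

Definition is_matching (n : nat) (S : {set 'I_n * 'I_n}) : bool :=
  [forall e in S, forall f in S,
     ((e.1 == f.1) || (e.2 == f.2)) ==> (e == f)].

Definition max_matching (n : nat) (E : {set 'I_n * 'I_n}) : nat :=
  \max_(S : {set 'I_n * 'I_n} | (S \subset E) && is_matching S) #|S|.

(* Node types are 'I_2, so that they index the matrix C directly: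
   0 is type 1 (regular), 1 is type 2 (flexible). *)
Definition regular : 'I_2 := ord0.
Definition flexible : 'I_2 := ord_max.

Section RandomGraph.
Variable R : realType.

Definition type_prob (b : R) (x : 'I_2) : R :=
  if x == flexible then b else 1 - b.

(* The minimum with 1 only matters for the finitely many n < c. *)
Definition edge_prob (n : nat) (c : R) : R := Num.min 1 (c / n%:R).

Definition types_prob (b : R) (n : nat) (t : {ffun 'I_n -> 'I_2}) : R :=
  \prod_(i < n) type_prob b (t i).

(* Conditional probability of the edge set E given the node types tL, tR. *)
Definition edges_prob (C : 'M[R]_2) (n : nat) (tL tR : {ffun 'I_n -> 'I_2})
    (E : {set 'I_n * 'I_n}) : R :=
  \prod_(e : 'I_n * 'I_n)
    (if e \in E then edge_prob n (C (tL e.1) (tR e.2))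
     else 1 - edge_prob n (C (tL e.1) (tR e.2))).

(* Expectation of M_*(G_n), as a sum over all outcomes (tL, tR, E). *)
Definition expected_matching (bL bR : R) (C : 'M[R]_2) (n : nat) : R :=
  \sum_(tL : {ffun 'I_n -> 'I_2}) \sum_(tR : {ffun 'I_n -> 'I_2})
    \sum_(E : {set 'I_n * 'I_n})
      types_prob bL tL * types_prob bR tR * edges_prob C tL tR E
        * (max_matching E)%:R.

Definition eta (bL bR : R) (C : 'M[R]_2) : R :=
  limn (fun n : nat => expected_matching bL bR C n / n%:R).

Definition flexC (alpha alphaf : R) : 'M[R]_2 :=
  \matrix_(x, y)
    if (x == regular) && (y == regular) then 2 * alpha
    else if (x == flexible) && (y == flexible) then 2 * alphaf
    else alpha + alphaf.

Definition eta_OS (B alpha alphaf : R) : R := eta B 0 (flexC alpha alphaf).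

Definition eta_TS (B alpha alphaf : R) : R :=
  eta (B / 2) (B / 2) (flexC alpha alphaf).

End RandomGraph.

(* Main.v *)
(* When alphaf is large, a flexible node is matched as long as nodes of the other side are free.  Up
   to small errors the two-sided matching number is therefore min(n, k + M), with k the number of
   flexible nodes and M the matching number of the regular part, whereas the one-sided one is at most
   k + M' and at most n minus the linear number of isolated regular supply nodes.  So it suffices that
   the balanced regular graph beats the unbalanced one linearly: E M(l+1,r) - E M(l,r+1) equals
   E (1-p)^A - E (1-p)^D, where A and D count the left and right vertices missed by some maximum
   matching of the common part G(l,r).  For l = r both have the same law; right vertices added beyond
   l can only decrease A, and they increase D by at least the number of those that are isolated.

   As [limn] is a junk value without convergence, the limit must be shown to exist.  Spread-out random
   edge weights make ties rare.  The gain of a vertex (the decrease of the maximum weight when it is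
   deleted) satisfies a recursion over its neighbours, whose truncations at depth k are local and
   bound the gain alternately from below and above.  Local quantities concentrate and converge, and
   counting the edges used from either endpoint shows that consecutive truncations have almost the
   same fraction of vertices with positive gain. *)
Require Import Defs.
From mathcomp Require Import all_boot all_order all_algebra.
From mathcomp Require Import all_classical all_reals all_analysis.
From mathcomp Require Import ssrbool eqtype ssrnat fintype finfun finset bigop zify ring lra.
Set Implicit Arguments.
Unset Strict Implicit.
Unset Printing Implicit Defensive.
Import Order.TTheory GRing.Theory Num.Theory.
Import numFieldNormedType.Exports.
Local Open Scope ring_scope.

(** * Maximum weight matchings and message passing *)

(** The recursion for 0/1 weights is ambiguous: its lower and upper iterates can have different
    limits, so truncation alone does not determine the matching number. The auxiliary weights take
    [K] values just above [Q = K ^ 2]. The relative spread [K / Q] keeps a heaviest matching almost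
    maximum in size, while each value has probability [1 / K], so that ties are rare. Weights are
    integers in order that a monotone sequence of messages changes boundedly often; averaging over
    many depths then makes the change at one depth small. The parameters are fixed in the order [K],
    depth, [n]. The limit is never identified: being eventually within [eps] of some number, for
    every [eps], is enough.

    In the comparison, even a flexible node sees each opposite node with probability of order
    [1 / n] only. It finds a free one reliably only while linearly many are free, which explains the
    caps lowered by [e0] and the need for a large [alphaf]. All losses are measured against one
    margin [g] that depends on [alpha] and [B] alone, so the threshold may be stated in terms of
    [g]. *)

Section WeightedMatchings.
Variables (V : finType) (w : {set V} -> nat).
Implicit Types (S : {set V}) (u v : V) (P : {set {set V}}).
Local Open Scope nat_scope.

(* Edges are two-element sets, weight 0 means that the edge is absent, and [S] is the set of deleted
   vertices. *)
Definition matching S P : bool :=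
  trivIset P && [forall e in P, [&& #|e| == 2, [disjoint e & S] & 0 < w e]].

Definition max_weight S : nat := \max_(P | matching S P) \sum_(e in P) w e.

Definition gain S v : nat := max_weight S - max_weight (v |: S).

(** Deleting [v] before its neighbours are consulted makes the underlying recursion exact on every
    graph, cycles included; only the start value 0 is an approximation. *)
Fixpoint msg (k : nat) S v : nat :=
  if k is k'.+1 then
    \max_(u | u \notin v |: S) (w [set v; u] - msg k' (v |: S) u)
  else 0.

Lemma matchingP S P : reflect
  ((forall e f, e \in P -> f \in P -> e != f -> [disjoint e & f]) /\
   (forall e, e \in P -> [/\ #|e| = 2, [disjoint e & S] & 0 < w e]))
  (matching S P).
Proof.
apply: (iffP andP) => [[/trivIsetP tP /'forall_implyP aP]|[tP aP]]; split => //.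
- by move=> e /aP /and3P [/eqP].
- exact/trivIsetP.
- by apply/'forall_implyP => e /aP [-> -> ->].
Qed.

Lemma matching0 S : matching S set0.
Proof. by apply/matchingP; split => [e f|e]; rewrite inE. Qed.

Lemma max_weight_attained S :
  exists2 P, matching S P & max_weight S = \sum_(e in P) w e.
Proof.
have [P mP eP] := eq_bigmax_cond (fun P => \sum_(e in P) w e)
  (A := matching S) ltac:(by apply/card_gt0P; exists set0; apply: matching0).
by exists P.
Qed.

Lemma le_max_weight S P : matching S P -> \sum_(e in P) w e <= max_weight S.
Proof. by move=> mP; apply: (@leq_bigmax_cond _ (matching S) (fun P => \sum_(e in P) w e)). Qed.

Lemma matchingW S S' P : S \subset S' -> matching S' P -> matching S P.
Proof.
move=> sS /matchingP [h1 h2]; apply/matchingP; split => // e /h2 [-> d ->].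
by split => //; apply: disjointWr d.
Qed.

Lemma max_weight_anti S S' : S \subset S' -> max_weight S' <= max_weight S.
Proof.
move=> sS; have [P mP ->] := max_weight_attained S'.
exact/le_max_weight/(matchingW sS).
Qed.

Lemma max_weight_edge S u v : u != v -> u \notin S -> v \notin S ->
  w [set v; u] + max_weight (u |: (v |: S)) <= max_weight S.
Proof.
move=> uv uS vS; have [w0|w0] := posnP (w [set v; u]).
  by rewrite w0 max_weight_anti // setUA subsetUr.
have [P mP ->] := max_weight_attained (u |: (v |: S)).
have [h1 h2] := matchingP _ _ mP.
have nP : [set v; u] \notin P.
  apply/negP => /h2 [_ /pred0P /(_ u)]; rewrite !inE eqxx orbT //=.
have mP' : matching S ([set v; u] |: P).
  have dP e : e \in P -> [disjoint [set v; u] & e].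
    move=> /h2 [_ d _]; rewrite disjoint_sym; apply: disjointWr d.
    by apply/subsetP => x; rewrite !inE => /orP [] ->; rewrite ?orbT.
  apply/matchingP; split => [e f|e].
    rewrite !inE => /orP [/eqP ->|eP] /orP [/eqP ->|fP]; rewrite ?eqxx //.
    - by move=> _; apply: dP.
    - by move=> _; rewrite disjoint_sym; apply: dP.
    - exact: h1.
  rewrite !inE => /orP [/eqP ->|/h2 [-> d ->]]; split => //.
  - by rewrite cards2 eq_sym uv.
  - rewrite disjoint_sym; apply/pred0P => x /=; rewrite !inE.
    by apply/negP => /andP [xS /orP [] /eqP xe]; move: xS; rewrite xe ?(negbTE uS) ?(negbTE vS).
  - by apply: disjointWr d; rewrite setUA subsetUr.
by rewrite -big_setU1 //= le_max_weight.
Qed.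

Lemma max_weight_split S v : v \notin S -> max_weight S <= max_weight (v |: S) \/
  exists u, [/\ u \notin v |: S, 0 < w [set v; u] &
    max_weight S <= w [set v; u] + max_weight (u |: (v |: S))].
Proof.
move=> vS; have [P mP eP] := max_weight_attained S.
have [h1 h2] := matchingP _ _ mP.
have [/existsP [e /andP [eIP ve]]|nv] := boolP [exists e, (e \in P) && (v \in e)].
  right; have [c2 dS we] := h2 _ eIP.
  have /cards2P [x [y [xy ee]]] : #|e| == 2 by rewrite c2.
  have [u [uv eu]] : exists z, z != v /\ e = [set v; z].
    move: ve; rewrite ee !inE => /orP [] /eqP ->.
      by exists y; rewrite eq_sym.
    by exists x; rewrite setUC.
  have uS : u \notin S.
    by move/pred0P: dS => /(_ u); rewrite eu !inE eqxx orbT /= => ->.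
  exists u; rewrite -eu we !inE negb_or uv uS; split => //.
  rewrite eP (big_setD1 e) //= leq_add2l le_max_weight //.
  apply/matchingP; split => [f g|f]; rewrite !inE.
    by move=> /andP [_ fP] /andP [_ gP]; apply: h1.
  move=> /andP [fe fP]; have [-> d ->] := h2 _ fP; split => //.
  have d' := h1 _ _ fP eIP fe.
  apply/pred0P => t /=; rewrite !inE; apply/negP => /andP [tf].
  rewrite orbA => /orP [te|tS].
    by move/pred0P: d' => /(_ t); rewrite /= tf eu !inE orbC te.
  by move/pred0P: d => /(_ t); rewrite /= tf tS.
left; rewrite eP le_max_weight //; apply/matchingP; split => // e eIP.
have [-> d ->] := h2 _ eIP; split => //.
apply/pred0P => x /=; rewrite !inE; apply/negP => /andP [xe /orP [/eqP xv|xS]].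
  by move/negP: nv; apply; apply/existsP; exists e; rewrite eIP -xv.
by move/pred0P: d => /(_ x); rewrite /= xe xS.
Qed.

(** Either some optimum leaves [v] uncovered and the gain is 0, or an optimum uses an edge [vu] and
    pays for it with the gain of [u]. The truncated subtraction absorbs the first case. *)
Lemma gainE S v : v \notin S ->
  gain S v = \max_(u | u \notin v |: S) (w [set v; u] - gain (v |: S) u).
Proof.
move=> vS; apply/eqP; rewrite eqn_leq; apply/andP; split; last first.
  apply/bigmax_leqP => u; rewrite !inE negb_or => /andP [uv uS].
  have := max_weight_edge uv uS vS.
  have : max_weight (u |: (v |: S)) <= max_weight (v |: S) by apply/max_weight_anti/subsetUr.
  rewrite /gain; lia.
rewrite /gain; have [h|[u [uvS wu h]]] := max_weight_split vS.
  by move: h; rewrite -subn_eq0 => /eqP ->.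
apply: (bigop.bigmax_sup u) => //; rewrite /gain.
have : max_weight (u |: (v |: S)) <= max_weight (v |: S) by apply/max_weight_anti/subsetUr.
lia.
Qed.

Lemma leq_max_sub (D : pred V) (a b : V -> nat) (z : V -> nat) :
  (forall u, D u -> b u <= a u) ->
  \max_(u | D u) (z u - a u) <= \max_(u | D u) (z u - b u).
Proof.
move=> h; apply/bigmax_leqP => u Du; apply: (bigop.bigmax_sup u) => //.
exact/leq_sub2l/h.
Qed.

(** The recursion is antitone in the messages and its start value 0 is a lower bound, hence the
    alternation with the parity of the depth. *)
Lemma msg_gain k S v : v \notin S ->
  if odd k then gain S v <= msg k S v else msg k S v <= gain S v.
Proof.
elim: k S v => [|k IH] S v vS //=.
have {}IH u : u \notin v |: S -> _ := IH (v |: S) u.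
rewrite gainE //; case: (odd k) IH => /= IH; exact: leq_max_sub.
Qed.

(** Two steps of an antitone recursion are monotone, and the first comparison is with 0: even
    truncations increase, odd ones decrease. *)
Lemma msg_step k S v :
  if odd k then msg k.+2 S v <= msg k S v else msg k S v <= msg k.+2 S v.
Proof.
elim: k S v => [|k IH] S v //; move: IH; rewrite [in odd k.+1]/=.
case: (odd k) => /= IH; apply: leq_max_sub => u _; exact: IH.
Qed.

Lemma msg_bound k S v b : (forall e, w e <= b) -> msg k S v <= b.
Proof.
move=> wb; case: k => [|k] //=; apply/bigmax_leqP => u _.
exact: leq_trans (leq_subr _ _) (wb _).
Qed.

Lemma max_weight_cover S P : matching S P -> 2 * #|P| = #|cover P|.
Proof.
case/matchingP => h1 h2; have /eqP <- : trivIset P by apply/trivIsetP.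
rewrite (eq_bigr (fun=> 2)) ?sum_nat_const ?[2 * _]mulnC // => e /h2 [] //.
Qed.

Lemma gain_cover S P v : matching S P -> max_weight S = \sum_(e in P) w e ->
  v \notin S -> 0 < gain S v -> v \in cover P.
Proof.
move=> mP eP vS; apply: contraTT => vP; rewrite -leqNgt leqn0 subn_eq0 eP.
apply: le_max_weight; have [h1 h2] := matchingP _ _ mP.
apply/matchingP; split => // e eIP; have [-> d ->] := h2 _ eIP; split => //.
apply/pred0P => x /=; rewrite !inE; apply/negP => /andP [xe /orP [/eqP xv|xS]].
  by move/negP: vP; apply; apply/bigcupP; exists e; rewrite // -xv.
by move/pred0P: d => /(_ x); rewrite /= xe xS.
Qed.

Lemma cover_gain P v : matching set0 P -> max_weight set0 = \sum_(e in P) w e ->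
  v \in cover P -> 0 < gain set0 v \/
  exists u, [/\ u != v, 0 < w [set v; u] & w [set v; u] = gain [set v] u].
Proof.
move=> mP eP /bigcupP [e eIP ve]; have [h1 h2] := matchingP _ _ mP.
have [g0|g0] := posnP (gain set0 v); last by left.
right; have [c2 dS we] := h2 _ eIP.
have /cards2P [x [y [xy ee]]] : #|e| == 2 by rewrite c2.
have [u [uv eu]] : exists z, z != v /\ e = [set v; z].
  move: ve; rewrite ee !inE => /orP [] /eqP ->.
    by exists y; rewrite eq_sym.
  by exists x; rewrite setUC.
exists u; rewrite -eu; split => //.
have le1 : max_weight set0 <= w e + max_weight (u |: [set v]).
  rewrite eP (big_setD1 e) //= leq_add2l le_max_weight //.
  apply/matchingP; split => [f g|f]; rewrite !inE.
    by move=> /andP [_ fP] /andP [_ gP]; apply: h1.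
  move=> /andP [fe fP]; have [-> _ ->] := h2 _ fP; split => //.
  by have := h1 _ _ fP eIP fe; rewrite eu setUC.
have uv' : u \notin [set v] by rewrite inE.
have := max_weight_edge (S := set0) uv; rewrite !inE setU0 => /(_ isT isT).
have : max_weight (u |: [set v]) <= max_weight [set v] by apply/max_weight_anti/subsetUr.
rewrite -eu; move: we le1.
have -> : max_weight set0 = max_weight [set v].
  apply/eqP; rewrite eqn_leq (max_weight_anti (sub0set _)) andbT.
  by move/eqP: g0; rewrite /gain setU0 subn_eq0.
rewrite /gain; lia.
Qed.

End WeightedMatchings.

(** * Gains under changes of the weights and of the deleted set *)

Section MatchingComparisons.
Variables (V : finType).
Implicit Types (w : {set V} -> nat) (S : {set V}) (u v : V) (P : {set {set V}}).
Local Open Scope nat_scope.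

Lemma disjoint_pairU v u S : u \notin v |: S -> v \notin S -> [disjoint [set v; u] & S].
Proof.
rewrite !inE negb_or => /andP [_ uS] vS; apply/pred0P => x /=; rewrite !inE.
by apply/negP => /andP [/orP [] /eqP ->]; apply/negP.
Qed.

(** The source of independence below: a message computed without [S] does not see the edges that
    meet [S]. *)
Lemma msg_ext w w' k S v : v \notin S ->
  (forall e : {set V}, [disjoint e & S] -> w e = w' e) -> msg w k S v = msg w' k S v.
Proof.
elim: k S v => [|k IH] S v vS ww //=.
apply: eq_bigr => u uS; rewrite ww ?disjoint_pairU // IH // => e d.
by apply: ww; apply: disjointWr d; apply: subsetUr.
Qed.

Lemma max_weight_ext w w' S :
  (forall e : {set V}, [disjoint e & S] -> w e = w' e) -> max_weight w S = max_weight w' S.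
Proof.
move=> ww; have mm P : matching w S P = matching w' S P.
  apply/matchingP/matchingP => -[h1 h2]; split => // e /h2 [-> d];
    by rewrite ?d ?ww // -ww.
rewrite /max_weight (eq_bigl (matching w' S)) //; apply: eq_bigr => P.
by move=> /matchingP [_ h2]; apply: eq_bigr => e /h2 [_ d _]; apply: ww.
Qed.

Lemma gain_ext w w' S v :
  (forall e : {set V}, [disjoint e & S] -> w e = w' e) -> gain w S v = gain w' S v.
Proof.
move=> ww; rewrite /gain (max_weight_ext ww) (@max_weight_ext w w') // => e d.
by apply: ww; apply: disjointWr d; apply: subsetUr.
Qed.

Lemma gainU w S v : max_weight w S = gain w S v + max_weight w (v |: S).
Proof. by rewrite subnK // max_weight_anti // subsetUr. Qed.

Lemma gain_le w S v b : (forall e, w e <= b) -> gain w S v <= b.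
Proof.
move=> wb; have [vS|vS] := boolP (v \in S).
  by rewrite /gain (setUidPr _) ?sub1set // subnn.
rewrite gainE //; apply/bigmax_leqP => u _.
exact: leq_trans (leq_subr _ _) (wb _).
Qed.

Lemma matching_imset w (f : V -> V) S P : injective f ->
  matching (fun e => w (f @: e)) S P ->
  matching w (f @: S) ((fun e : {set V} => f @: e) @: P).
Proof.
move=> fI /matchingP [h1 h2]; apply/matchingP; split.
  move=> _ _ /imsetP [e eP ->] /imsetP [g gP ->] ne.
  have eg : e != g by apply: contraNneq ne => ->.
  have := h1 _ _ eP gP eg; rewrite -!setI_eq0 -imsetI => [/eqP ->|]; last by move=> ? ? _ _ /fI.
  by rewrite imset0.
move=> _ /imsetP [e /h2 [c d we] ->]; rewrite card_imset //; split => //.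
move: d; rewrite -!setI_eq0 -imsetI => [/eqP ->|]; last by move=> ? ? _ _ /fI.
by rewrite imset0.
Qed.

Lemma max_weight_imset_le w (f : V -> V) S : injective f ->
  max_weight (fun e => w (f @: e)) S <= max_weight w (f @: S).
Proof.
move=> fI; have [P mP ->] := max_weight_attained (fun e => w (f @: e)) S.
have := le_max_weight (matching_imset fI mP).
by rewrite big_imset //= => e g _ _; apply: imset_inj.
Qed.

Lemma max_weight_imset w (f : V -> V) S : injective f ->
  max_weight (fun e => w (f @: e)) S = max_weight w (f @: S).
Proof.
move=> fI; apply/eqP; rewrite eqn_leq max_weight_imset_le //=.
have [g fK gK] := injF_bij fI.
have gI := can_inj gK.
have := max_weight_imset_le (fun e => w (f @: e)) (f @: S) gI.
have imK (f1 f2 : V -> V) (D : {set V}) : cancel f1 f2 -> f2 @: (f1 @: D) = D.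
  by move=> K; rewrite -imset_comp (@eq_imset _ _ _ id) ?imset_id.
rewrite imK // (@max_weight_ext _ w) // => e _.
by rewrite imK.
Qed.

Lemma gain_imset w (f : V -> V) S v : injective f ->
  gain (fun e => w (f @: e)) S v = gain w (f @: S) (f v).
Proof. by move=> fI; rewrite /gain !max_weight_imset // imsetU1. Qed.

Section Bipartite.
Variables (w : {set V} -> nat) (side : V -> bool).
Hypothesis bip : forall u v, u != v -> 0 < w [set u; v] -> side u != side v.

(** A vertex on the side of [v] is a competitor, one on the other side a potential partner. Each use
    of [gainE] changes the side and reverses the inequality. *)
Lemma gain_side1 S v y : v \notin S -> y \notin S -> y != v ->
  if side y == side v then gain w S v <= gain w (y |: S) v
  else gain w (y |: S) v <= gain w S v.
Proof.
have [k kS] := ubnP #|~: S|; elim: k S v y kS => // k IH S v y kS vS yS yv.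
have cS x : x \notin S -> #|~: (x |: S)| < k.
  move=> xS; rewrite -ltnS; apply: leq_trans kS; rewrite ltnS.
  by apply: proper_card; rewrite properC properE subsetUr subUset sub1set negb_and xS.
have vyS : v \notin y |: S by rewrite !inE negb_or eq_sym yv.
have IHu u (uv : u != v) (uS : u \notin S) (uy : u != y) := IH (v |: S) u y (cS _ vS)
  ltac:(by rewrite !inE negb_or uv) ltac:(by rewrite !inE negb_or yv) ltac:(by rewrite eq_sym).
rewrite !gainE // (setUCA [set v]).
case: ifPn => sy; apply/bigmax_leqP => u; rewrite !inE !negb_or.
  move=> /andP [uv uS]; have vu : v != u by rewrite eq_sym.
  have [w0|w0] := posnP (w [set v; u]); first by rewrite w0.
  have svu := bip vu w0.
  have uy : u != y by apply: contraNneq svu => ->; rewrite eq_sym.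
  apply: (bigop.bigmax_sup u); first by rewrite !inE !negb_or; apply/and3P.
  have := IHu _ uv uS uy.
  by rewrite (eqP sy) (negbTE svu) => h; apply: leq_sub2l.
move=> /and3P [uy uv uS]; have vu : v != u by rewrite eq_sym.
have [w0|w0] := posnP (w [set v; u]); first by rewrite w0.
have svu := bip vu w0.
apply: (bigop.bigmax_sup u); first by rewrite !inE !negb_or uv.
have := IHu _ uv uS uy; have -> : side y == side u by move: sy svu; case: (side y); case: (side u); case: (side v).
by move=> h; apply: leq_sub2l.
Qed.

Lemma gain_side b S S' v : S \subset S' -> v \notin S' ->
  (forall y, y \in S' -> y \notin S -> side y = b) ->
  if b == side v then gain w S v <= gain w S' v else gain w S' v <= gain w S v.
Proof.
have [k kS] := ubnP #|S' :\: S|; elim: k S kS => // k IH S kS sS vS' hy.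
have [S0|[y]] := set_0Vmem (S' :\: S).
  have -> : S = S' by apply/eqP; rewrite eqEsubset sS -setD_eq0 S0 eqxx.
  by rewrite leqnn if_same.
rewrite inE => /andP [yS yS'].
have yv : y != v by apply: contraNneq vS' => <-.
have vS : v \notin S by apply: contraNN vS'; apply: (subsetP sS).
have := gain_side1 vS yS yv; rewrite (hy y) //.
have H1 : #|S' :\: (y |: S)| < k.
  rewrite -ltnS; apply: leq_trans kS; rewrite ltnS; apply: proper_card.
  rewrite properE setDS ?subsetUr //=.
  by apply/subsetPn; exists y; rewrite !inE ?eqxx //= yS.
have H2 : y |: S \subset S' by rewrite subUset sub1set yS'.
have H3 z : z \in S' -> z \notin y |: S -> side z = b.
  by rewrite !inE negb_or => zS' /andP [_]; apply: hy.
have := IH _ H1 H2 vS' H3; case: ifP => _ h1 h2; [exact: leq_trans h2 h1|exact: leq_trans h1 h2].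
Qed.

(** An optimum covers all these vertices, no two of them by the same edge as they lie on one side,
    and each of its edges weighs at least 1. *)
Lemma card_gain_side b S :
  #|[set u | [&& side u == b, u \notin S & 0 < gain w S u]]| <= max_weight w S.
Proof.
have [P mP eP] := max_weight_attained w S; have [h1 h2] := matchingP _ _ _ mP.
rewrite eP; apply: leq_trans (_ : #|P| <= _); last first.
  by rewrite -sum1_card; apply: leq_sum => e /h2 [].
set D := [set u | _]; have DP u : u \in D -> u \in cover P /\ side u = b.
  rewrite !inE => /and3P [/eqP su uS gu]; split => //.
  exact: gain_cover mP eP uS gu.
have tP : trivIset P by case/andP: mP.
rewrite -(@card_in_imset _ _ (pblock P) D); last first.
  move=> x y /DP [xP sx] /DP [yP sy] exy; apply/eqP; apply: contraTT isT => xy.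
  have eP' := pblock_mem xP; have [c2 _ we] := h2 _ eP'.
  have xe : x \in pblock P x by rewrite mem_pblock.
  have ye : y \in pblock P x by rewrite exy mem_pblock.
  have exy' : pblock P x = [set x; y].
    apply/eqP; rewrite eq_sym eqEcard c2 cards2 xy andbT; apply/subsetP => z.
    by rewrite !inE => /orP [] /eqP ->.
  by have := bip xy; rewrite -exy' => /(_ we); rewrite sx sy eqxx.
apply/subset_leq_card/subsetP => _ /imsetP [u /DP [uP _] ->]; exact: pblock_mem.
Qed.

End Bipartite.

(** A maximum weight matching [P] weighs at least [Q * M] and at most [(Q + K) * #|P|]. The vertices
    it covers include all those of positive gain, and the other covered ones are ties, counted by
    [T]. *)
Lemma max_weight_card_bounds w Q K :
  (forall e, 0 < w e -> Q <= w e <= Q + K) ->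
  let M := max_weight (fun e => (0 < w e : nat)) set0 in
  let N := #|[set v | 0 < gain w set0 v]| in
  let T := #|[set v | [exists u, [&& u != v, 0 < w [set v; u] &
                        w [set v; u] == gain w [set v] u]]]| in
  N <= 2 * M /\ Q * (2 * M) <= (Q + K) * (N + T).
Proof.
move=> wQ M N T; have [P mP eP] := max_weight_attained w set0.
have sm P' : matching w set0 P' = matching (fun e => (0 < w e : nat)) set0 P'.
  by apply/matchingP/matchingP => -[h1 h2]; split => // e /h2 [-> ->]; case: (0 < w e).
have cP : \sum_(e in P) (0 < w e) = #|P|.
  by rewrite -sum1_card; apply: eq_bigr => e eP'; case/matchingP: mP => _ /(_ _ eP') [_ _ ->].
have PM : #|P| <= M by rewrite -cP; apply: le_max_weight; rewrite -sm.
have c2 := max_weight_cover mP.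
have NP : N <= 2 * #|P|.
  rewrite c2; apply/subset_leq_card/subsetP => v; rewrite inE => gv.
  by apply: gain_cover mP eP _ gv; rewrite inE.
have PT : 2 * #|P| <= N + T.
  rewrite c2; apply: leq_trans (leq_card_setU _ _); apply/subset_leq_card/subsetP => v vP.
  rewrite !inE; case: (cover_gain mP eP vP) => [->//|[u [uv wu eu]]].
  by apply/orP; right; apply/existsP; exists u; rewrite uv wu eu eqxx.
split; first by apply: leq_trans NP _; rewrite leq_mul2l PM orbT.
have wP : max_weight w set0 <= (Q + K) * #|P|.
  rewrite eP mulnC -sum_nat_const; apply: leq_sum => e eP'.
  by case/matchingP: mP => _ /(_ _ eP') [_ _ /wQ /andP []].
have wM : Q * M <= max_weight w set0.
  have [P' mP' eP'] := max_weight_attained (fun e => (0 < w e : nat)) set0.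
  rewrite /M eP'; rewrite -sm in mP'; apply: leq_trans (le_max_weight mP').
  rewrite big_distrr /=; apply: leq_sum => e eP2.
  by case/matchingP: mP' => _ /(_ _ eP2) [_ _ we]; rewrite we muln1; case/andP: (wQ _ we).
nia.
Qed.

End MatchingComparisons.

(** * Bipartite edges as two-element sets of tagged vertices *)

Section BipartiteEncoding.
Variable n : nat.
Local Open Scope nat_scope.

(** Supply nodes carry the tag [false], demand nodes the tag [true]. *)
Definition ends (p : 'I_n * 'I_n) : {set bool * 'I_n} := [set (false, p.1); (true, p.2)].

Lemma in_ends s i p : ((s, i) \in ends p) = (i == if s then p.2 else p.1).
Proof. by rewrite !inE !xpair_eqE; case: s; rewrite /= ?orbF. Qed.

Lemma ends_inj : injective ends.
Proof.
move=> [a b] [c d] /setP h; have := h (false, a); have := h (true, b).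
by rewrite !in_ends /= !eqxx => /esym /eqP -> /esym /eqP ->.
Qed.

Lemma endsI p q : [disjoint ends p & ends q] = (p.1 != q.1) && (p.2 != q.2).
Proof.
rewrite -setI_eq0; apply/eqP/andP => [/setP h|[n1 n2]].
  have := h (false, p.1); have := h (true, p.2).
  by rewrite !finset.in_setI !finset.in_set0 !in_ends /= !eqxx /= => -> ->.
apply/setP => -[s i]; rewrite finset.in_setI finset.in_set0 !in_ends; apply/negP => /andP [/eqP ->].
by apply/negP; case: s.
Qed.

Lemma card_ends p : #|ends p| = 2.
Proof. by rewrite cards2. Qed.

Lemma max_matchingE (E : {set 'I_n * 'I_n}) (w : {set bool * 'I_n} -> nat) :
  (forall e, w e <= 1) -> (forall p, (0 < w (ends p)) = (p \in E)) ->
  (forall e, 0 < w e -> exists p, e = ends p) ->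
  max_matching E = max_weight w set0.
Proof.
move=> w1 wE wends; apply/eqP; rewrite eqn_leq; apply/andP; split.
  apply/bigmax_leqP => S /andP [/subsetP SE /'forall_implyP mS].
  rewrite -(card_imset _ ends_inj) -sum1_card.
  apply: leq_trans (_ : \sum_(e in ends @: S) w e <= _).
    by apply: leq_sum => _ /imsetP [p pS ->]; rewrite wE SE.
  apply: le_max_weight; apply/matchingP; split.
    move=> _ _ /imsetP [p pS ->] /imsetP [q qS ->]; rewrite (inj_eq ends_inj) endsI => pq.
    have /'forall_implyP /(_ q qS) := mS p pS.
    by rewrite (negbTE pq) implybF negb_or.
  move=> _ /imsetP [p pS ->]; rewrite card_ends wE SE //; split => //.
  by rewrite -setI_eq0 setI0.
have [P mP ->] := max_weight_attained w set0; have [h1 h2] := matchingP _ _ _ mP.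
have eP : P = ends @: [set p | ends p \in P].
  apply/setP => e; apply/idP/imsetP => [eP|[p]]; last by rewrite inE => ? ->.
  by have [_ _ /wends [p ep]] := h2 _ eP; exists p; rewrite // inE -ep.
apply: leq_trans (_ : #|P| <= _).
  by rewrite -sum1_card; apply: leq_sum.
rewrite eP card_imset; last exact: ends_inj.
apply: (bigop.bigmax_sup [set p | ends p \in P]) => //; apply/andP; split.
  by apply/subsetP => p; rewrite inE => /h2 []; rewrite wE.
apply/'forall_implyP => p; rewrite inE => pP; apply/'forall_implyP => q; rewrite inE => qP.
apply/implyP; apply: contraLR => pq; rewrite negb_or -endsI; apply: h1 => //.
by rewrite (inj_eq ends_inj).
Qed.

End BipartiteEncoding.

(** * Product measures on finite sets *)

Section ProductExpectation.
Variables (R : realFieldType) (I A : finType).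
Implicit Types (rho : I -> A -> R) (w : {ffun I -> A}) (J : {set I}).

Definition is_law rho := (forall i a, 0 <= rho i a) /\ (forall i, \sum_a rho i a = 1).

Definition Ex rho (f : {ffun I -> A} -> R) : R :=
  \sum_(w : {ffun I -> A}) (\prod_i rho i (w i)) * f w.

Definition merge J w w' : {ffun I -> A} := [ffun i => if i \in J then w i else w' i].

Definition depends (T : Type) J (f : {ffun I -> A} -> T) :=
  forall w w', {in J, w =1 w'} -> f w = f w'.

Lemma eq_Ex rho f g : f =1 g -> Ex rho f = Ex rho g.
Proof. by move=> fg; apply: eq_bigr => w _; rewrite fg. Qed.

Lemma ExD rho f g : Ex rho (fun w => f w + g w) = Ex rho f + Ex rho g.
Proof. by rewrite -big_split /=; apply: eq_bigr => w _; rewrite mulrDr. Qed.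

Lemma ExZ rho c f : Ex rho (fun w => c * f w) = c * Ex rho f.
Proof. by rewrite mulr_sumr; apply: eq_bigr => w _; rewrite mulrCA. Qed.

Lemma ExZr rho c f : Ex rho (fun w => f w * c) = Ex rho f * c.
Proof. by rewrite mulrC -ExZ; apply: eq_Ex => w; rewrite mulrC. Qed.

Lemma ExB rho f g : Ex rho (fun w => f w - g w) = Ex rho f - Ex rho g.
Proof. by rewrite -sumrB; apply: eq_bigr => w _; rewrite mulrBr. Qed.

Lemma Ex_sum rho (K : Type) (r : seq K) (P : pred K) f :
  Ex rho (fun w => \sum_(k <- r | P k) f k w) = \sum_(k <- r | P k) Ex rho (f k).
Proof.
by rewrite exchange_big; apply: eq_bigr => w _; rewrite mulr_sumr.
Qed.

(** Distinct keys read independent coordinates, and a coordinate without a key contributes its total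
    mass 1. *)
Lemma Ex_prod rho (U : finType) (D : pred U) (key : U -> I) (phi : U -> A -> R) :
  is_law rho -> {in D &, injective key} ->
  Ex rho (fun w => \prod_(u | D u) phi u (w (key u))) =
  \prod_(u | D u) \sum_a rho (key u) a * phi u a.
Proof.
move=> [_ s1] kI.
rewrite (partition_big key predT) //= /Ex.
transitivity (\sum_(w : {ffun I -> A}) \prod_i (rho i (w i) * \prod_(u | D u && (key u == i)) phi u (w i))).
  apply: eq_bigr => w _; rewrite big_split /=; congr (_ * _).
  rewrite (partition_big key predT) //=; apply: eq_bigr => i _.
  by apply: eq_bigr => u /andP [_ /eqP ->].
rewrite -(bigA_distr_bigA (fun i a => rho i a * \prod_(u | D u && (key u == i)) phi u a)).
apply: eq_bigr => i _; have [/existsP [u /andP [Du /eqP ku]]|/existsPn nu] :=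
  boolP [exists u, D u && (key u == i)].
  have e1 : (fun u' => D u' && (key u' == i)) =1 pred1 u.
    move=> u'; apply/andP/eqP => [[Du' /eqP ku']|->]; last by rewrite ku eqxx.
    by apply: kI => //; rewrite ku'.
  have bE (G : U -> R) : \prod_(u' | D u' && (key u' == i)) G u' = G u.
    by rewrite (eq_bigl (pred1 u)) ?big_pred1_eq.
  by rewrite bE -ku; apply: eq_bigr => a _; rewrite ku bE.
rewrite [RHS]big_pred0 => [|u]; last exact/negbTE/nu.
rewrite -[RHS](s1 i); apply: eq_bigr => a _.
by rewrite big_pred0 ?mulr1 // => u; exact/negbTE/nu.
Qed.

Lemma Ex_coord1 rho i (phi : A -> R) : is_law rho ->
  Ex rho (fun w => phi (w i)) = \sum_a rho i a * phi a.
Proof.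
move=> lr; have := @Ex_prod rho unit predT (fun=> i) (fun=> phi) lr.
rewrite /= (big_pred1 tt) /=; last by case.
move=> <-; first by apply: eq_Ex => w; rewrite (big_pred1 tt) //; case.
by move=> [] [].
Qed.

Section Law.
Variable rho : I -> A -> R.
Hypothesis lrho : is_law rho.

Lemma prod_law_ge0 w : 0 <= \prod_i rho i (w i).
Proof. by apply: prodr_ge0 => i _; apply: lrho.1. Qed.

Lemma Ex_le f g : (forall w, f w <= g w) -> Ex rho f <= Ex rho g.
Proof. by move=> fg; apply: ler_sum => w _; apply: ler_wpM2l (prod_law_ge0 w) _ _ _. Qed.

Lemma Ex_cst c : Ex rho (fun=> c) = c.
Proof.
rewrite /Ex -mulr_suml -(bigA_distr_bigA (fun i a => rho i a)).
by rewrite big1 ?mul1r // => i _; apply: lrho.2.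
Qed.

Lemma Ex_ge0 f : (forall w, 0 <= f w) -> 0 <= Ex rho f.
Proof. by move=> f0; rewrite -(Ex_cst 0) Ex_le. Qed.

Lemma Ex_abs f : `|Ex rho f| <= Ex rho (fun w => `|f w|).
Proof.
apply: le_trans (ler_norm_sum _ _ _) _; apply: ler_sum => w _.
by rewrite normrM ger0_norm // prod_law_ge0.
Qed.

(** Pointwise this is the inequality of the arithmetic and geometric means. With [s] of the order of
    the standard deviation it does the work of Cauchy-Schwarz. *)
Lemma Ex_abs_le s f : 0 < s -> Ex rho (fun w => `|f w|) <= (s + Ex rho (fun w => f w ^+ 2) / s) / 2.
Proof.
move=> s0; rewrite -[s in s + _]Ex_cst -ExZr -ExD -ExZr; apply: Ex_le => w.
rewrite -[f w ^+ 2]real_normK ?num_real //.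
have : 0 <= (`|f w| - s) ^+ 2 / s by rewrite divr_ge0 ?sqr_ge0 ?ltW.
have -> : (`|f w| - s) ^+ 2 / s = `|f w| ^+ 2 / s + s - 2 * `|f w| by field; rewrite gt_eqF.
by lra.
Qed.

Lemma eq_Ex_supp f g :
  (forall w, (forall i, rho i (w i) != 0) -> f w = g w) -> Ex rho f = Ex rho g.
Proof.
move=> fg; apply: eq_bigr => w _; have [/existsP [i /eqP ri]|/existsPn nr] :=
  boolP [exists i, rho i (w i) == 0].
  by rewrite (bigD1 i) //= ri !mul0r.
by rewrite fg.
Qed.

End Law.

(** Exchanging the coordinates in [J] between two independent samples preserves their joint law,
    because the marginals agree on [J]. *)
Lemma Ex_swap rho rho' J (F : {ffun I -> A} -> {ffun I -> A} -> R) :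
  {in J, rho =1 rho'} ->
  Ex rho (fun w => Ex rho' (fun w' => F w w')) =
  Ex rho (fun w => Ex rho' (fun w' => F (merge J w' w) (merge J w w'))).
Proof.
move=> rr; rewrite /Ex.
under eq_bigr do rewrite mulr_sumr; rewrite pair_big /=.
under [in RHS]eq_bigr do rewrite mulr_sumr; rewrite [in RHS]pair_big /=.
pose h (p : {ffun I -> A} * {ffun I -> A}) := (merge J p.2 p.1, merge J p.1 p.2).
have hK : involutive h.
  by case=> a b; congr (_, _); apply/ffunP => i; rewrite !ffunE /=; case: (i \in J).
rewrite (reindex_inj (inv_inj hK)) /=; apply: eq_bigr => -[a b] _ /=.
rewrite !mulrA; congr (_ * _); rewrite -!big_split /=; apply: eq_bigr => i _.
by rewrite !ffunE; case: ifP => // /rr ->; rewrite mulrC.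
Qed.

(** Resampling the coordinates in [J]: the inner expectation is the conditional expectation given
    the coordinates outside [J]. *)
Lemma Ex_merge rho J f : is_law rho ->
  Ex rho f = Ex rho (fun w => Ex rho (fun w' => f (merge J w' w))).
Proof.
move=> lr; rewrite -(@Ex_swap rho rho J (fun w _ => f w)) //.
by apply: eq_Ex => w; rewrite Ex_cst.
Qed.

Lemma Ex_agree rho rho' J f : is_law rho -> is_law rho' -> {in J, rho =1 rho'} ->
  depends J f -> Ex rho f = Ex rho' f.
Proof.
move=> lr lr' rr df.
transitivity (Ex rho (fun w => Ex rho' (fun w' => f w))).
  by apply: eq_Ex => w; rewrite Ex_cst.
rewrite (Ex_swap _ rr) -[RHS](Ex_cst lr); apply: eq_Ex => w; apply: eq_Ex => w'.
by apply: df => i iJ; rewrite ffunE iJ.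
Qed.

Definition upd w i a : {ffun I -> A} := [ffun j => if j == i then a else w j].

Lemma Ex_coord rho i f : is_law rho ->
  Ex rho f = Ex rho (fun w => \sum_a rho i a * f (upd w i a)).
Proof.
move=> lr; rewrite (@Ex_merge _ [set i]) //; apply: eq_Ex => w.
rewrite -(Ex_coord1 i (fun a => f (upd w i a))) //; apply: eq_Ex => w'.
congr f; apply/ffunP => j; rewrite !ffunE !inE; by case: eqP => [->|].
Qed.

Lemma Ex_coord_le rho i (b : R) (f g : {ffun I -> A} -> R) : is_law rho ->
  (forall w, 0 <= g w) -> depends (~: [set i]) g ->
  (forall w, \sum_(a : A) rho i a * f (upd w i a) <= b) ->
  Ex rho (fun w => f w * g w) <= b * Ex rho g.
Proof.
move=> lr g0 dg fb; rewrite (@Ex_coord _ i) // -ExZ; apply: Ex_le => // w.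
have gu a : g (upd w i a) = g w.
  by apply: dg => j; rewrite !inE ffunE => /negbTE ->.
under eq_bigr do rewrite gu mulrA.
by rewrite -mulr_suml ler_wpM2r.
Qed.

(* Efron-Stein: exchange the coordinates of two independent copies one at a time. *)
Lemma Ex_variance rho (zero : A) (f : {ffun I -> A} -> R) : is_law rho ->
  (forall w i a, `|f (upd w i a) - f w| <= 1) ->
  Ex rho (fun w => (f w - Ex rho f) ^+ 2) <= \sum_i (1 - rho i zero).
Proof.
move=> lr f1.
pose hyb k w w' : {ffun I -> A} := merge [set i | (enum_rank i < k)%N] w' w.
have hyb0 w w' : hyb 0%N w w' = w by apply/ffunP => i; rewrite !ffunE inE.
have hybN w w' : hyb #|I| w w' = w'.
  by apply/ffunP => i; rewrite !ffunE inE ltn_ord.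
have -> : Ex rho (fun w => (f w - Ex rho f) ^+ 2) =
    Ex rho (fun w => Ex rho (fun w' => f w * (f w - f w'))).
  transitivity (Ex rho (fun w => f w * (f w - Ex rho f))).
    set m := Ex rho f; apply/eqP; rewrite -subr_eq0 -ExB.
    rewrite (@eq_Ex _ _ (fun w => m * m - m * f w)); last by move=> w /=; ring.
    by rewrite ExB Ex_cst // ExZ -/m subrr.
  by apply: eq_Ex => w; rewrite ExZ ExB Ex_cst.
have tele w w' : f w - f w' = \sum_(k < #|I|) (f (hyb k w w') - f (hyb k.+1 w w')).
  rewrite -{1}(hyb0 w w') -{2}(hybN w w') -[LHS]opprB.
  rewrite -(big_mkord predT (fun k => f (hyb k w w') - f (hyb k.+1 w w'))).
  rewrite -(telescope_sumr (fun k => f (hyb k w w')) (leq0n #|I|)) -sumrN.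
  by apply: eq_bigr => k _; rewrite opprB.
rewrite (@eq_Ex _ _ (fun w => \sum_(k < #|I|) Ex rho (fun w' =>
    f w * (f (hyb k w w') - f (hyb k.+1 w w'))))); last first.
  by move=> w; rewrite -Ex_sum; apply: eq_Ex => w'; rewrite tele mulr_sumr.
rewrite Ex_sum (reindex_onto (@enum_rank I) enum_val) => [|k _]; last by rewrite enum_valK.
rewrite (eq_bigl predT) => [|i]; last by rewrite enum_rankK eqxx.
apply: ler_sum => i _.
have ltS j : j != i -> (enum_rank j < (enum_rank i).+1)%N = (enum_rank j < enum_rank i)%N.
  move=> ji; rewrite ltnS leq_eqVlt (inj_eq val_inj) (inj_eq enum_rank_inj).
  by rewrite (negbTE ji).
set G := fun w w' => f w * (f (hyb (enum_rank i) w w') - f (hyb (enum_rank i).+1 w w')).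
have mE w w' : merge [set i] w' w = upd w i (w' i).
  by apply/ffunP => j; rewrite !ffunE !inE; case: eqP => [->|].
have swp w w' : G (merge [set i] w' w) (merge [set i] w w') =
    - f (upd w i (w' i)) * (f (hyb (enum_rank i) w w') - f (hyb (enum_rank i).+1 w w')).
  rewrite /G mE mulNr -mulrN opprB; congr (_ * (f _ - f _)); apply/ffunP => j;
  rewrite !ffunE !inE; case: (eqVneq j i) => [->|ji]; rewrite ?ltnn ?leqnn ?ltS //=;
  by case: ifP.
(* Averaging with the pair whose [i]-th coordinates are exchanged turns the factor [f w] into
   [f w - f (upd w i (w' i))]. Both factors are then at most 1 in absolute value, and the product
   vanishes if [w i = w' i]. *)
have -> : Ex rho (fun w => Ex rho (fun w' => G w w')) = 2^-1 *
    Ex rho (fun w => Ex rho (fun w' => G w w' + G (merge [set i] w' w) (merge [set i] w w'))).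
  have := @Ex_swap rho rho [set i] G (fun _ _ => erefl).
  set x := LHS; move=> e.
  rewrite [in RHS](@eq_Ex _ _ (fun w => Ex rho (fun w' => G w w') +
     Ex rho (fun w' => G (merge [set i] w' w) (merge [set i] w w')))); last by move=> w /=; rewrite ExD.
  by rewrite ExD -e /x; lra.
have bnd w w' : G w w' + G (merge [set i] w' w) (merge [set i] w w') <= (w i != w' i)%:R.
  rewrite swp /G -mulrDl.
  have hu : hyb (enum_rank i).+1 w w' = upd (hyb (enum_rank i) w w') i (w' i).
    by apply/ffunP => j; rewrite !ffunE !inE; case: (eqVneq j i) => [->|ji]; rewrite ?leqnn ?ltS.
  have [wi|wi] := eqVneq (w i) (w' i).
    have -> : upd w i (w' i) = w by apply/ffunP => j; rewrite ffunE; case: eqP => [->|].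
    by rewrite subrr mul0r.
  apply: le_trans (ler_norm _) _; rewrite normrM -[X in _ <= X]mulr1 ler_pM //.
    by rewrite distrC f1.
  by rewrite hu distrC f1.
have pz : Ex rho (fun w => (w i != zero)%:R) = 1 - rho i zero.
  rewrite (Ex_coord1 i (fun a => (a != zero)%:R)) //.
  have := lr.2 i; rewrite (bigD1 zero) //= => s1; rewrite -[X in X - _]s1.
  rewrite (bigD1 zero) //= eqxx mulr0 add0r addrAC subrr add0r.
  by apply: eq_bigr => a ->; rewrite /= mulr1.
(* Coordinates that differ are not both [zero]; the two copies contribute equally, which cancels the
   factor 2^-1. *)
apply: le_trans (_ : 2^-1 * Ex rho (fun w => Ex rho (fun w' => (w i != zero)%:R + (w' i != zero)%:R)) <= _).
  rewrite ler_wpM2l ?invr_ge0 //; apply: Ex_le => // w; apply: Ex_le => // w'.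
  apply: le_trans (bnd w w') _; case: (eqVneq (w i) (w' i)) => [|ne] /=.
    by rewrite addr_ge0.
  have [e|_] := eqVneq (w i) zero; last by rewrite /= lerDl.
  by rewrite -e eq_sym ne add0r.
rewrite (@eq_Ex _ _ (fun w => (w i != zero)%:R + (1 - rho i zero))).
  by rewrite ExD Ex_cst // pz; lra.
by move=> w; rewrite ExD Ex_cst // pz.
Qed.

End ProductExpectation.

(** * Images of product measures *)

Section Pushforward.
Variables (R : realFieldType) (I A : finType).

Lemma Ex_le_supp (rho : I -> A -> R) f g : is_law rho ->
  (forall w : {ffun I -> A}, (forall i, rho i (w i) != 0) -> f w <= g w) ->
  Ex rho f <= Ex rho g.
Proof.
move=> lr fg; apply: ler_sum => w _; have [/existsP [i /eqP ri]|/existsPn nr] :=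
  boolP [exists i, rho i (w i) == 0].
  by rewrite (bigD1 i) //= ri !mul0r.
by apply: ler_wpM2l; [exact: prod_law_ge0|exact: fg].
Qed.

(** Distinct coordinates read through [phi] stay independent, so the image of a product law is the
    product of the image distributions. *)
Lemma Ex_push (U B : finType) (rho : I -> A -> R) (key : U -> I) (phi : A -> B)
    (rho' : U -> B -> R) (F : {ffun U -> B} -> R) :
  is_law rho -> injective key ->
  (forall u b, rho' u b = \sum_(a | phi a == b) rho (key u) a) ->
  Ex rho (fun w => F [ffun u => phi (w (key u))]) = Ex rho' F.
Proof.
move=> lr kI rE.
rewrite (@eq_Ex _ _ _ _ _ (fun w => \sum_(x : {ffun U -> B})
   F x * \prod_u (phi (w (key u)) == x u)%:R)); last first.
  move=> w; rewrite (bigD1 [ffun u => phi (w (key u))]) //= [X in _ * X]big1 => [|u _]; last by rewrite ffunE eqxx.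
  rewrite mulr1 big1 ?addr0 // => x nx.
  have [/existsP [u /negbTE nu]|/existsPn no] := boolP [exists u, phi (w (key u)) != x u].
    by rewrite (bigD1 u) //= nu mul0r mulr0.
  case/eqP: nx; apply/ffunP => u; rewrite ffunE; apply/esym/eqP.
  by have := no u; rewrite negbK.
rewrite Ex_sum; apply: eq_bigr => x _; rewrite ExZ mulrC; congr (_ * _).
rewrite (@Ex_prod _ _ _ rho U predT key (fun u a => (phi a == x u)%:R)) //; last by move=> ? ? _ _ /kI.
apply: eq_bigr => u _; rewrite rE [RHS]big_mkcond; apply: eq_bigr => a _.
by case: eqP; rewrite ?mulr1 ?mulr0.
Qed.

Lemma Ex_inj_variable (rho : I -> A -> R) (f : I -> I) (F : {ffun I -> A} -> R) :
  is_law rho -> injective f -> (forall i, rho (f i) =1 rho i) ->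
  Ex rho (fun w => F [ffun i => w (f i)]) = Ex rho F.
Proof.
move=> lr fI rf; apply: (@Ex_push I A rho f id rho F) => // i a.
by rewrite (big_pred1 a) ?rf.
Qed.

End Pushforward.

(** * Sparse random graphs with random edge weights *)

Lemma neq_triangle (a b a' b' : nat) :
  ((a' != b') <= (a != b) + ((a != a') + (b != b')))%N.
Proof.
have [<-|] := eqVneq a b; last by move=> _; case: (a' != b').
have [<-|] := eqVneq a a'; last by move=> _; case: (a' != b').
by [].
Qed.

Lemma nat_tie (a b p q : nat) :
  (p < a -> a + q = b + p -> (b == a + q - p) && (0 < b))%N.
Proof. by move=> pa e; apply/andP; split; lia. Qed.

Section RandomWeights.
Variables (R : realType) (V T : finType) (tau : V -> T) (c : T -> T -> R).
Variables (cm wm h : R) (m : nat) (om : 'I_m.+1 -> R) (rho : {set V} -> 'I_m.+1 -> R).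
Hypotheses (lrho : is_law rho) (c_ge0 : forall s t, 0 <= c s t) (c_le : forall s t, c s t <= cm).
Hypotheses (cm_ge0 : 0 <= cm) (h_gt0 : 0 < h) (hV : h * #|V|%:R <= 2) (hcm : h * cm <= 1).
Hypotheses (om_ge0 : forall i, 0 <= om i) (om_le : forall i, om i <= wm).
Hypotheses (om0 : om ord0 = 0) (om1 : \sum_i om i = 1).
Hypothesis rhoE : forall u v i, u != v -> i != ord0 ->
  rho [set u; v] i = h * c (tau u) (tau v) * om i.

Local Notation wts := {ffun {set V} -> 'I_m.+1}.
Implicit Types (w : wts) (S : {set V}) (u v y : V).

(** The index itself is the weight, with 0 for an absent edge. A present edge has a weight with law
    [om], whose atoms are at most [wm]. *)
Definition wt w (e : {set V}) : nat := w e.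
Definition wmsg w k S v : nat := msg (wt w) k S v.

Local Arguments wmsg : simpl never.

Lemma wm_ge0 : 0 <= wm. Proof. exact: le_trans (om_ge0 ord0) (om_le ord0). Qed.

Lemma wmsg_ext w w' (J : {set {set V}}) k S u : {in J, w =1 w'} -> u \notin S ->
  (forall e : {set V}, [disjoint e & S] -> e \in J) -> wmsg w k S u = wmsg w' k S u.
Proof. by move=> ww uS SJ; apply: msg_ext => // e /SJ /ww; rewrite /wt => ->. Qed.

Lemma wmsg_ext1 w w' k S v u x : {in ~: [set [set v; u]], w =1 w'} -> v \in S ->
  x \notin S -> wmsg w k S x = wmsg w' k S x.
Proof.
move=> ww vS xS; apply: wmsg_ext ww xS _ => e d; rewrite !inE.
by apply: contraTneq d => ->; apply/pred0Pn; exists v; rewrite !inE eqxx.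
Qed.

Lemma edge_ext1 w w' v u u' : {in ~: [set [set v; u]], w =1 w'} -> u' != u -> u' != v ->
  w [set v; u'] = w' [set v; u'].
Proof.
move=> ww uu uv; apply: ww; rewrite !inE; apply: contraNneq uu => /setP /(_ u').
by rewrite !inE eqxx orbT (negbTE uv) => /esym /= ->.
Qed.

Lemma edge_prob_le u v : u != v ->
  \sum_a rho [set u; v] a * (0 < a)%N%:R <= h * cm.
Proof.
move=> uv; apply: le_trans (_ : \sum_a h * c (tau u) (tau v) * om a <= _).
  apply: ler_sum => a _; have [->|a0] := eqVneq a ord0; first by rewrite mulr0 om0 mulr0.
  by rewrite rhoE // lt0n [_ != _](a0) mulr1.
by rewrite -mulr_sumr om1 mulr1 ler_wpM2l // ltW.
Qed.

Lemma Ex_edge_le u v (g : wts -> R) : u != v -> (forall w, 0 <= g w) ->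
  depends (~: [set [set v; u]]) g ->
  Ex rho (fun w => (0 < w [set v; u])%N%:R * g w) <= h * cm * Ex rho g.
Proof.
move=> uv g0 dg; apply: Ex_coord_le (dg) _ => // w.
under eq_bigr do rewrite ffunE eqxx.
by apply: edge_prob_le; rewrite eq_sym.
Qed.

Lemma exists_le_sum (U : finType) (D P : pred U) :
  ([exists u, D u && P u] <= \sum_(u | D u) P u)%N.
Proof.
case: existsP => // -[u /andP [Du Pu]].
by rewrite (bigD1 u) //= Pu.
Qed.

(** In units of [h], a bound on the probability that deleting one vertex alters a message: that
    vertex is a neighbour, or one of the at most [2 / h] vertices is a neighbour and passes a change
    on. *)
Fixpoint Cl k : R := if k is k'.+1 then cm * (1 + 2 * Cl k') else 0.

Lemma Cl_ge0 k : 0 <= Cl k.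
Proof.
elim: k => //= k IH; apply: mulr_ge0 => //.
by rewrite addr_ge0 // mulr_ge0.
Qed.

Lemma wmsg_change w k S v y : y != v ->
  ((wmsg w k.+1 S v != wmsg w k.+1 (y |: S) v) <= (0 < w [set v; y]) +
  \sum_(u | (u \notin y |: (v |: S))) ((0 < w [set v; u]) *
     (wmsg w k (v |: S) u != wmsg w k (y |: (v |: S)) u)))%N.
Proof.
move=> yv; have [//|w0] := posnP (w [set v; y]).
  move=> w0; rewrite add0n.
  under eq_bigr do rewrite mulnb.
  apply: leq_trans (exists_le_sum _ _).
  case: eqP => //= ne; rewrite lt0b; apply: contraT => /existsPn no; case: ne.
  have eqF u : u \notin y |: (v |: S) ->
      (wt w [set v; u] - msg (wt w) k (v |: S) u =
       wt w [set v; u] - msg (wt w) k (v |: (y |: S)) u)%N.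
    move=> uS; have := no u; rewrite uS /= negb_and -leqNgt leqn0 negbK (setUCA _ [set y]).
    by move=> /orP [/eqP e|/eqP]; [rewrite /wt e|rewrite /wmsg => ->].
  apply/eqP; rewrite eqn_leq; apply/andP; split; apply/bigmax_leqP => u uS.
    have [->|uy] := eqVneq u y; first by rewrite /wt w0.
    apply: (bigop.bigmax_sup u).
      by rewrite (setUCA _ [set y]) inE negb_or uS andbT inE.
    by rewrite -eqF // inE negb_or uS andbT inE.
  rewrite -eqF ?(setUCA [set y]) //; apply: (bigop.bigmax_sup u) => //.
  by move: uS; rewrite (setUCA _ [set y]) inE negb_or => /andP [].
by rewrite (leq_trans (leq_b1 _)) // leq_addr.
Qed.

(** Induction along [wmsg_change]: the edge [vu] is independent of messages computed without [v], so
    each [u] contributes a product of two probabilities of order [h]. *)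
Lemma locality k S v y : v \notin S -> y != v ->
  Ex rho (fun w => (wmsg w k S v != wmsg w k (y |: S) v)%:R) <= Cl k * h.
Proof.
elim: k S v y => [|k IH] S v y vS yv.
  by rewrite /wmsg /= mul0r (@eq_Ex _ _ _ _ _ (fun=> 0)) ?Ex_cst // => w; rewrite eqxx.
apply: le_trans (Ex_le lrho (g := fun w => (0 < w [set v; y])%N%:R +
  \sum_(u | (u \notin y |: (v |: S))) ((0 < w [set v; u])%N%:R *
     (wmsg w k (v |: S) u != wmsg w k (y |: (v |: S)) u)%:R)) _) _.
  move=> w; have := wmsg_change w k S yv.
  rewrite -(ler_nat R) natrD natr_sum; congr (_ <= _ + _).
  by apply: eq_bigr => u _; rewrite natrM.
rewrite ExD Ex_sum /=.
apply: le_trans (_ : h * cm + \sum_(u | u \notin y |: (v |: S)) (h * cm) * (Cl k * h) <= _).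
  apply: lerD.
    have := @Ex_edge_le y v (fun=> 1) yv (fun=> ler01) (fun _ _ _ => erefl).
    by rewrite Ex_cst // mulr1; apply: le_trans; apply: Ex_le => // w; rewrite mulr1.
  apply: ler_sum => u; rewrite !inE !negb_or => /and3P [uy uv uS].
  apply: le_trans (Ex_edge_le uv _ _) _ => // [w w' ww|].
    by congr (_ != _)%:R; apply: wmsg_ext1 ww _ _; rewrite !inE ?eqxx ?orbT // !negb_or uv ?uy.
  apply: ler_wpM2l; first by rewrite mulr_ge0 ?cm_ge0 ?ltW.
  by apply: IH; rewrite ?inE ?negb_or ?uv // eq_sym.
rewrite sumr_const -[_ *+ _]mulr_natr /=.
have h0 := cm_ge0; have C0 := Cl_ge0 k.
have hn : h * #|[pred u | u \notin y |: (v |: S)]|%:R <= 2.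
  by apply: le_trans hV; apply: ler_wpM2l; [exact: ltW|rewrite ler_nat max_card].
have -> : h * cm + h * cm * (Cl k * h) * #|[pred u | u \notin y |: (v |: S)]|%:R =
  cm * h * (1 + Cl k * (h * #|[pred u | u \notin y |: (v |: S)]|%:R)) by ring.
rewrite [X in _ <= X]mulrAC; apply: ler_wpM2l; first by rewrite mulr_ge0 // ltW.
by rewrite lerD2l mulrC; apply: ler_wpM2r.
Qed.


(** Up to ties, an edge is used by the optimum iff its weight exceeds the sum of the gains of its
    endpoints, each computed without the other. Here these gains are truncated at the depths [k] and
    [k.+1]. *)
Definition linkN w k v := (\sum_(u | u != v)
  (wmsg w k [set v] u + wmsg w k.+1 [set u] v < wt w [set v; u]))%N.
(** Two neighbours of [v] of which one influences the other even without [v], as on a short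
    cycle. *)
Definition badN w k v u u' := [&& (0 < w [set v; u])%N, (0 < w [set v; u'])%N &
  wmsg w k [set v] u' != wmsg w k (u |: [set v]) u'].
(** [u] and [u'] make equal offers to [v]; the additive form avoids truncated subtraction. *)
Definition tieN w k v u u' := (wmsg w k [set v] u < wt w [set v; u])%N &&
  (wt w [set v; u] + wmsg w k [set v] u' == wt w [set v; u'] + wmsg w k [set v] u)%N.
Definition pairsum (f : V -> V -> bool) v : nat :=
  (\sum_(u | u != v) \sum_(u' | (u' != u) && (u' != v)) f u u')%N.

Lemma wmsgS0 w k v : wmsg w k.+1 set0 v =
  (\max_(u | u != v) (wt w [set v; u] - wmsg w k [set v] u))%N.
Proof. by rewrite /wmsg /= setU0; apply: eq_bigl => u; rewrite !inE. Qed.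

Lemma wmsgS1 w k u v : wmsg w k.+1 [set u] v =
  (\max_(x | (x != u) && (x != v)) (wt w [set v; x] - wmsg w k (u |: [set v]) x))%N.
Proof.
by rewrite /wmsg /= setUC; apply: eq_bigl => x; rewrite !inE negb_or.
Qed.

(** Without bad pairs a linked vertex makes a strictly better offer than any other linked vertex, so
    there is at most one link, and its offer makes the message at [v] positive. *)
Lemma linkN_le w k v : (linkN w k v <= (0 < wmsg w k.+1 set0 v) + pairsum (badN w k v) v)%N.
Proof.
pose bad u := [exists u', ((u' != u) && (u' != v)) && badN w k v u u'].
pose lnk u := (wmsg w k [set v] u + wmsg w k.+1 [set u] v < wt w [set v; u])%N.
apply: leq_trans (_ : \sum_(u | u != v) ((lnk u && ~~ bad u) + bad u) <= _)%N.
  by apply: leq_sum => u _; rewrite -/(lnk u); case: (lnk u); case: (bad u).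
rewrite big_split /=; apply: leq_add; last by apply: leq_sum => u _; apply: exists_le_sum.
rewrite -big_mkcondr sum1_card /=.
have lt1 : (#|[pred u | (u != v) && (lnk u && ~~ bad u)]| <= 1)%N.
  apply/card_le1_eqP => x y; rewrite !inE => /and3P [xv lx bx] /and3P [yv ly bY].
  apply/eqP; apply: contraT => yx.
  have aux a b : a != b -> b != v -> lnk a -> lnk b -> ~~ bad a ->
      (wt w [set v; b] - wmsg w k [set v] b < wt w [set v; a] - wmsg w k [set v] a)%N.
    move=> ab bv la lb /existsPn /(_ b); rewrite eq_sym ab bv /= /badN.
    have wa : (0 < wt w [set v; a])%N by apply: leq_ltn_trans la.
    have wb : (0 < wt w [set v; b])%N by apply: leq_ltn_trans lb.
    rewrite [(0 < w [set v; a])%N]wa [(0 < w [set v; b])%N]wb /= negbK => /eqP e.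
    rewrite ltn_subRL; apply: leq_ltn_trans la; rewrite leq_add2l wmsgS1.
    by apply: (bigop.bigmax_sup b); rewrite ?bv ?andbT ?e // eq_sym.
  have xy : x != y by rewrite eq_sym.
  by have := ltn_trans (aux x y xy yv lx ly bx) (aux y x yx xv ly lx bY); rewrite ltnn.
have [->//|c0] := posnP #|[pred u | (u != v) && (lnk u && ~~ bad u)]|.
apply: leq_trans lt1 _; rewrite lt0b; case/card_gt0P: c0 => u; rewrite inE => /and3P [uv lu bu].
rewrite wmsgS0; apply: leq_trans (_ : wt w [set v; u] - wmsg w k [set v] u <= _)%N.
  by rewrite subn_gt0; apply: leq_ltn_trans lu; rewrite leq_addr.
exact: (bigop.bigmax_sup u).
Qed.

(** If the best offer, made by [u], is not tied, it strictly exceeds all others. Without bad pairs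
    these are the offers that [v] receives once [u] is deleted, so [u] is linked. *)
Lemma linkN_ge w k v : ((0 < wmsg w k.+1 set0 v) <=
  linkN w k v + pairsum (tieN w k v) v + pairsum (badN w k v) v)%N.
Proof.
pose some (f : V -> V -> bool) u := [exists u', ((u' != u) && (u' != v)) && f u u'].
have [//|X0] := posnP (wmsg w k.+1 set0 v).
have /card_gt0P [x xv] : (0 < #|[pred u | u != v]|)%N.
  rewrite lt0n; apply: contraTneq X0 => /card0_eq p0.
  by rewrite wmsgS0 big_pred0 // => u; have := p0 u; rewrite inE.
have [u uv eX] := eq_bigmax_cond (fun u => (wt w [set v; u] - wmsg w k [set v] u)%N)
   ltac:(by apply/card_gt0P; exists x; exact: xv).
have {}uv : u != v by [].
have {}eX : wmsg w k.+1 set0 v = (wt w [set v; u] - wmsg w k [set v] u)%N by rewrite wmsgS0.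
have some_le f : (some f u <= pairsum f v)%N.
  rewrite /pairsum (bigD1 u) //=; apply: leq_trans (leq_addr _ _).
  exact: exists_le_sum.
have [t|nt] := boolP (some (tieN w k v) u).
  by have := some_le (tieN w k v); rewrite t; lia.
have [t|nb] := boolP (some (badN w k v) u).
  by have := some_le (badN w k v); rewrite t; lia.
suff : (wmsg w k [set v] u + wmsg w k.+1 [set u] v < wt w [set v; u])%N.
  by move=> lu; rewrite /linkN (bigD1 u) //= lu; lia.
have au : (wmsg w k [set v] u < wt w [set v; u])%N by rewrite -subn_gt0 -eX.
suff : (wmsg w k.+1 [set u] v <= (wt w [set v; u] - wmsg w k [set v] u).-1)%N by lia.
rewrite wmsgS1; apply/bigmax_leqP => y yuv.
have [->|wy] := posnP (wt w [set v; y]); first by [].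
have yX : (wt w [set v; y] - wmsg w k [set v] y <= wmsg w k.+1 set0 v)%N.
  by rewrite wmsgS0; apply: (bigop.bigmax_sup y) => //; case/andP: yuv.
move/existsPn: nt => /(_ y); rewrite yuv /tieN au /= => nt.
move/existsPn: nb => /(_ y); rewrite yuv /badN.
rewrite [(0 < w [set v; u])%N](leq_ltn_trans _ au) // [(0 < w [set v; y])%N]wy /= negbK => /eqP <-.
by move: nt yX; rewrite eX; lia.
Qed.

Lemma sum_le_card (P : pred V) (f : V -> R) b : 0 <= b -> (forall u, P u -> f u <= b) ->
  h * \sum_(u | P u) f u <= 2 * b.
Proof.
move=> b0 fb; apply: le_trans (_ : h * \sum_(u : V) b <= _).
  apply: ler_wpM2l; first exact: ltW.
  rewrite [leRHS](bigID P) /=; apply: ler_wpDr; first by rewrite sumr_ge0.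
  exact: ler_sum.
by rewrite sumr_const -[b *+ _]mulr_natl mulrA; apply: ler_wpM2r.
Qed.

Lemma Ex_pairsum (f : wts -> V -> V -> bool) (b : R) v : 0 <= b ->
  (forall u u', u != v -> u' != u -> u' != v -> Ex rho (fun w => (f w u u')%:R) <= b) ->
  h ^+ 2 * Ex rho (fun w => (pairsum (f w) v)%:R) <= 4 * b.
Proof.
move=> b0 fb; rewrite (@eq_Ex _ _ _ _ _ (fun w => \sum_(u | u != v)
   \sum_(u' | (u' != u) && (u' != v)) (f w u u')%:R)); last first.
  by move=> w; rewrite natr_sum; apply: eq_bigr => u _; rewrite natr_sum.
rewrite Ex_sum exprS expr1 -mulrA mulr_sumr (_ : 4 * b = 2 * (2 * b)); last by ring.
apply: sum_le_card => [|u uv]; first by rewrite mulr_ge0.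
rewrite Ex_sum; apply: sum_le_card => // u' /andP []; exact: fb.
Qed.

(** Two edges at [v] and, independently of them, a change of a message in the graph without [v]:
    three factors of order [h] against [h ^- 2] pairs. *)
Lemma Ex_bad k v : h ^+ 2 * Ex rho (fun w => (pairsum (badN w k v) v)%:R) <=
  4 * ((h * cm) ^+ 2 * (Cl k * h)).
Proof.
have h0 := ltW h_gt0; have c0 := cm_ge0; have C0 := Cl_ge0 k.
apply: Ex_pairsum => [|u u' uv u'u u'v]; first by rewrite !mulr_ge0 // exprn_ge0 // mulr_ge0.
rewrite (@eq_Ex _ _ _ _ _ (fun w => (0 < w [set v; u])%N%:R * ((0 < w [set v; u'])%N%:R *
  (wmsg w k [set v] u' != wmsg w k (u |: [set v]) u')%:R))); last first.
  by move=> w; rewrite -!natrM !mulnb.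
have e1 w w' : {in ~: [set [set v; u]], w =1 w'} ->
   (wmsg w k [set v] u' != wmsg w k (u |: [set v]) u') =
   (wmsg w' k [set v] u' != wmsg w' k (u |: [set v]) u').
  by move=> ww; congr (_ != _); apply: wmsg_ext1 ww _ _; rewrite !inE ?eqxx ?orbT // ?negb_or ?u'u.
have e2 w w' : {in ~: [set [set v; u']], w =1 w'} ->
   (wmsg w k [set v] u' != wmsg w k (u |: [set v]) u') =
   (wmsg w' k [set v] u' != wmsg w' k (u |: [set v]) u').
  by move=> ww; congr (_ != _); apply: wmsg_ext1 ww _ _; rewrite !inE ?eqxx ?orbT // ?negb_or ?u'u.
rewrite exprS expr1 -!mulrA [X in _ <= X]mulrA.
apply: le_trans (Ex_edge_le uv _ _) _ => [w|w w' ww|]; first by rewrite mulr_ge0.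
  by rewrite (e1 w w') // (edge_ext1 ww).
apply: ler_wpM2l; first by rewrite mulr_ge0.
rewrite [X in _ <= X]mulrA.
apply: le_trans (Ex_edge_le u'v _ _) _ => [//|w w' ww|]; first by rewrite (e2 w w').
by apply: ler_wpM2l; rewrite ?mulr_ge0 // locality // ?inE // eq_sym.
Qed.

(** Given all edges except [vu'], a tie prescribes one positive weight for [vu'], which has
    probability at most [h * cm * wm]; the presence of [vu] contributes another factor [h * cm]. *)
Lemma Ex_tie k v : h ^+ 2 * Ex rho (fun w => (pairsum (tieN w k v) v)%:R) <=
  4 * ((h * cm) ^+ 2 * wm).
Proof.
have h0 := ltW h_gt0; have c0 := cm_ge0; have w0 := wm_ge0.
apply: Ex_pairsum => [|u u' uv u'u u'v]; first by rewrite mulr_ge0 // exprn_ge0 // mulr_ge0.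
rewrite (@eq_Ex _ _ _ _ _ (fun w => (tieN w k v u u')%:R * (0 < w [set v; u])%N%:R)); last first.
  move=> w; rewrite -natrM mulnb; congr (_%:R); case t: (tieN w k v u u') => //=.
  by case/andP: t => t _; rewrite [(0 < _)%N](leq_ltn_trans _ t).
have b0 : 0 <= h * cm * wm by rewrite !mulr_ge0.
rewrite (_ : (h * cm) ^+ 2 * wm = (h * cm * wm) * (h * cm)); last by ring.
apply: le_trans (@Ex_coord_le _ _ _ rho [set v; u'] (h * cm * wm) _ _ lrho _ _ _) _ => //.
- by move=> w w' ww; rewrite (edge_ext1 ww) // eq_sym.
- move=> w.
  have ww a : {in ~: [set [set v; u']], upd w [set v; u'] a =1 w}.
    by move=> e; rewrite !inE ffunE => /negbTE ->.
  pose s := (wt w [set v; u] + wmsg w k [set v] u' - wmsg w k [set v] u)%N.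
  have te a : (tieN (upd w [set v; u'] a) k v u u' <= ((a : nat) == s) && (0 < a))%N.
    rewrite /tieN !(wmsg_ext1 _ (ww a)) ?inE ?eqxx // /wt (edge_ext1 (ww a)) //; last by rewrite eq_sym.
    by rewrite ffunE eqxx /s /wt; case: andP => // -[t /eqP e]; rewrite lt0b nat_tie.
  apply: le_trans (_ : \sum_a rho [set v; u'] a * (((a : nat) == s) && (0 < a)%N)%:R <= _).
    by apply: ler_sum => a _; apply: ler_wpM2l; [exact: lrho.1|rewrite ler_nat te].
  have [sm|sm] := ltnP s m.+1; last first.
    rewrite big1 // => a _; have := ltn_ord a; case: eqP => [->|]; last by rewrite mulr0.
    by rewrite ltnNge sm.
  rewrite (bigD1 (Ordinal sm)) //= big1 ?addr0 => [|a]; last first.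
    by rewrite -val_eqE /= => /negbTE ->; rewrite mulr0.
  rewrite eqxx /=; have [s0|s0] := posnP s; first by rewrite mulr0.
  rewrite mulr1 rhoE ?(eq_sym v) //; last by rewrite -val_eqE /= -lt0n.
  rewrite -!mulrA; apply: ler_wpM2l => //; apply: ler_pM => //.
apply: ler_wpM2l => //.
have := @Ex_edge_le u v (fun=> 1) uv (fun=> ler01) (fun _ _ _ => erefl).
by rewrite Ex_cst // mulr1; apply: le_trans; apply: Ex_le => // w; rewrite mulr1.
Qed.

Lemma Ex_bad_le k v :
  Ex rho (fun w => (pairsum (badN w k v) v)%:R) <= 4 * (cm ^+ 2 * Cl k) * h.
Proof.
rewrite -(ler_pM2l (exprn_gt0 2 h_gt0)); apply: le_trans (Ex_bad k v) _.
by rewrite le_eqVlt; apply/orP; left; apply/eqP; ring.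
Qed.

Lemma Ex_tie_le k v : Ex rho (fun w => (pairsum (tieN w k v) v)%:R) <= 4 * (cm ^+ 2 * wm).
Proof.
rewrite -(ler_pM2l (exprn_gt0 2 h_gt0)); apply: le_trans (Ex_tie k v) _.
by rewrite le_eqVlt; apply/orP; left; apply/eqP; ring.
Qed.

Definition posfrac k : R := h * \sum_v Ex rho (fun w => (0 < wmsg w k set0 v)%N%:R).
Definition drift k : R :=
  h * \sum_v Ex rho (fun w => (wmsg w k set0 v != wmsg w k.+2 set0 v)%:R).
Definition linkfrac k : R := h * \sum_v Ex rho (fun w => (linkN w k v)%:R).

Lemma posfrac_le_link k :
  posfrac k.+1 <= linkfrac k + 8 * (cm ^+ 2 * wm) + 8 * (cm ^+ 2 * Cl k) * h.
Proof.
have h0 := ltW h_gt0.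
have step v : Ex rho (fun w => (0 < wmsg w k.+1 set0 v)%N%:R) <=
    Ex rho (fun w => (linkN w k v)%:R) + (4 * (cm ^+ 2 * wm) + 4 * (cm ^+ 2 * Cl k) * h).
  apply: le_trans (Ex_le lrho (g := fun w => (linkN w k v)%:R + ((pairsum (tieN w k v) v)%:R + (pairsum (badN w k v) v)%:R)) _) _.
    by move=> w; rewrite -!natrD ler_nat addnA linkN_ge.
  rewrite !ExD lerD2l; apply: lerD.
    exact: Ex_tie_le.
  exact: Ex_bad_le.
rewrite /posfrac /linkfrac; apply: le_trans (ler_wpM2l h0 (ler_sum _ (fun v _ => step v))) _.
rewrite big_split /= mulrDr -addrA lerD2l.
have C0 := Cl_ge0 k; have w0 := wm_ge0.
apply: le_trans (sum_le_card _ (fun _ _ => lexx _)) _.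
  by rewrite addr_ge0 // !mulr_ge0 // ?exprn_ge0.
by rewrite le_eqVlt; apply/orP; left; apply/eqP; ring.
Qed.

Lemma link_le_posfrac k : linkfrac k <= posfrac k.+1 + 8 * (cm ^+ 2 * Cl k) * h.
Proof.
have h0 := ltW h_gt0; have C0 := Cl_ge0 k.
have step v : Ex rho (fun w => (linkN w k v)%:R) <=
    Ex rho (fun w => (0 < wmsg w k.+1 set0 v)%N%:R) + 4 * (cm ^+ 2 * Cl k) * h.
  apply: le_trans (Ex_le lrho (g := fun w => (0 < wmsg w k.+1 set0 v)%N%:R + (pairsum (badN w k v) v)%:R) _) _.
    by move=> w; rewrite -!natrD ler_nat linkN_le.
  rewrite !ExD lerD2l.
  exact: Ex_bad_le.
rewrite /posfrac /linkfrac; apply: le_trans (ler_wpM2l h0 (ler_sum _ (fun v _ => step v))) _.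
rewrite big_split /= mulrDr lerD2l.
apply: le_trans (sum_le_card _ (fun _ _ => lexx _)) _; first by rewrite !mulr_ge0 // ?exprn_ge0.
by rewrite le_eqVlt; apply/orP; left; apply/eqP; ring.
Qed.

(* An edge is used as seen from one endpoint at time [k] iff it is used as seen from the other at
   time [k.+1], except where the messages have not yet stabilised. *)
Lemma link_shift k : linkfrac k <=
  linkfrac k.+1 + 2 * cm * drift k + 4 * cm * (Cl k + Cl k.+2) * h.
Proof.
have h0 := ltW h_gt0; have C0 := Cl_ge0 k; have C2 := Cl_ge0 k.+2.
pose Q w u v := (wmsg w k [set v] u != wmsg w k.+2 [set v] u).
have pt w : (\sum_v linkN w k v <= \sum_v linkN w k.+1 v +
    \sum_u \sum_(v | v != u) (0 < w [set u; v]) * Q w u v)%N.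
  have -> : (\sum_v linkN w k.+1 v = \sum_v \sum_(u | u != v)
      (wmsg w k.+1 [set u] v + wmsg w k.+2 [set v] u < wt w [set v; u]))%N.
    rewrite /linkN (exchange_big_dep predT) //=; apply: eq_bigr => v _.
    by apply: eq_big => u; rewrite ?[v == u]eq_sym // setUC.
  rewrite [X in (_ <= _ + X)%N](exchange_big_dep predT) //= -big_split /=.
  apply: leq_sum => v _.
  rewrite [X in (_ <= _ + X)%N](eq_bigl (fun u => u != v)) => [|u]; last by rewrite eq_sym.
  rewrite -big_split /=; apply: leq_sum => u uv.
  rewrite /Q (setUC [set u]); case: eqP => [<-|_]; first by rewrite addnC leq_addr.
  case l : (_ + _ < wt w [set v; u])%N => //.
  by rewrite [(0 < _)%N](leq_ltn_trans _ l) // muln1 addn1.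
have EQ u v : v != u -> Ex rho (fun w => (0 < w [set u; v])%N%:R * (Q w u v)%:R) <=
    h * cm * (Ex rho (fun w => (wmsg w k set0 u != wmsg w k.+2 set0 u)%:R) + (Cl k + Cl k.+2) * h).
  move=> vu; apply: le_trans (@Ex_edge_le v u (fun w => (Q w u v)%:R) vu _ _) _ => //.
    move=> w w'; rewrite setUC => ww; congr (_%:R); rewrite /Q.
    by congr (_ != _); apply: wmsg_ext1 ww _ _; rewrite !inE // eq_sym.
  apply: ler_wpM2l; first by rewrite mulr_ge0.
  have ul k' := @locality k' set0 u v; move: ul; rewrite setU0 !inE => ul.
  rewrite mulrDl; apply: le_trans (lerD (lexx _) (lerD (ul k isT vu) (ul k.+2 isT vu))).
  rewrite -!ExD; apply: Ex_le => // w; rewrite -!natrD ler_nat.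
  exact: neq_triangle.
rewrite /linkfrac; apply: le_trans (_ : linkfrac k.+1 + h * \sum_u \sum_(v | v != u)
    Ex rho (fun w => (0 < w [set u; v])%N%:R * (Q w u v)%:R) <= _).
  rewrite /linkfrac -mulrDr; apply: ler_wpM2l => //.
  under [X in _ <= _ + X]eq_bigr do rewrite -Ex_sum; rewrite -!Ex_sum -ExD.
  apply: Ex_le => // w; have := pt w; rewrite -(ler_nat R) natrD !natr_sum.
  move=> /le_trans; apply; rewrite lerD2l; apply: ler_sum => u _.
  by rewrite natr_sum; apply: ler_sum => v _; rewrite natrM.
rewrite -addrA lerD2l.
set P := fun u => Ex rho (fun w => (wmsg w k set0 u != wmsg w k.+2 set0 u)%:R) in EQ *.
have P0 u : 0 <= P u by apply: Ex_ge0 => // w.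
have inner u : \sum_(v | v != u) Ex rho (fun w => (0 < w [set u; v])%N%:R * (Q w u v)%:R) <=
    2 * (cm * (P u + (Cl k + Cl k.+2) * h)).
  rewrite -(ler_pM2l h_gt0) (_ : h * (2 * _) = 2 * (h * cm * (P u + (Cl k + Cl k.+2) * h))); last by ring.
  apply: sum_le_card => [|v]; last exact: EQ.
  by rewrite mulr_ge0 ?addr_ge0 ?mulr_ge0 ?addr_ge0.
apply: le_trans (ler_wpM2l h0 (ler_sum _ (fun u _ => inner u))) _.
under eq_bigr do rewrite mulrDr mulrDr.
rewrite big_split /= mulrDr; apply: lerD.
  rewrite -!mulr_sumr /drift -/P; rewrite le_eqVlt; apply/orP; left; apply/eqP; ring.
apply: le_trans (sum_le_card _ (fun _ _ => lexx _)) _; first by rewrite !mulr_ge0 ?addr_ge0.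
by rewrite le_eqVlt; apply/orP; left; apply/eqP; ring.
Qed.

Definition Cg k : R := 8 * (cm ^+ 2 * Cl k) + 4 * cm * (Cl k + Cl k.+2) + 8 * (cm ^+ 2 * Cl k.+1).

(** Positive messages are exchanged for links, the links are shifted by one time step, and links are
    exchanged back. Only the tie term and the drift do not vanish with [h]. *)
Lemma posfrac_gap k : posfrac k.+1 <=
  posfrac k.+2 + 2 * cm * drift k + 8 * (cm ^+ 2 * wm) + Cg k * h.
Proof.
have h1 := posfrac_le_link k; have h2 := link_shift k; have h3 := link_le_posfrac k.+1.
apply: le_trans h1 _; rewrite -lerBrDr -lerBrDr; apply: le_trans h2 _.
rewrite -lerBrDr -lerBrDr; apply: le_trans h3 _; rewrite /Cg.
by rewrite le_eqVlt; apply/orP; left; apply/eqP; ring.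
Qed.

(** At even depths the integer messages only increase and never exceed [m], so each vertex changes
    at most [m] times in all. *)
Lemma sum_drift M : \sum_(i < M) drift i.*2 <= 2 * m%:R.
Proof.
have h0 := ltW h_gt0.
rewrite /drift -mulr_sumr exchange_big /=; apply: sum_le_card => // v _.
rewrite -Ex_sum -(Ex_cst lrho m%:R); apply: Ex_le => // w.
rewrite -natr_sum ler_nat.
apply: leq_trans (_ : wmsg w M.*2 set0 v <= _)%N; last first.
  by apply: msg_bound => e; rewrite -ltnS ltn_ord.
elim: M => [|M IH]; first by rewrite big_ord0.
rewrite big_ord_recr /=; have := msg_step (wt w) M.*2 set0 v; rewrite odd_double /=.
rewrite -!/(wmsg _ _ _ _) doubleS => le2; apply: leq_trans (leq_add IH (leqnn _)) _.
by case: eqVneq le2 => [<-|ne le2]; rewrite ?addn0 // addn1 ltn_neqAle ne.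
Qed.

Lemma posfrac_step k : if odd k then posfrac k.+2 <= posfrac k else posfrac k <= posfrac k.+2.
Proof.
case: ifP => ok; (apply: ler_wpM2l; first exact: ltW); apply: ler_sum => v _;
  apply: Ex_le => // w; rewrite ler_nat; have := msg_step (wt w) k set0 v; rewrite ok;
  rewrite -!/(wmsg _ _ _ _); lia.
Qed.

Lemma posfrac_even M i : (i <= M)%N -> posfrac i.*2 <= posfrac M.*2.
Proof.
elim: M => [|M IH]; first by rewrite leqn0 => /eqP ->.
rewrite leq_eqVlt => /orP [/eqP -> //|]; rewrite ltnS => /IH /le_trans; apply.
by have := posfrac_step M.*2; rewrite odd_double.
Qed.

Lemma posfrac_odd M i : (i <= M)%N -> posfrac M.*2.+1 <= posfrac i.*2.+1.
Proof.
elim: M => [|M IH]; first by rewrite leqn0 => /eqP ->.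
rewrite leq_eqVlt => /orP [/eqP -> //|]; rewrite ltnS => /IH; apply: le_trans.
by have := posfrac_step M.*2.+1; rewrite /= odd_double.
Qed.

(** By monotonicity in each parity the last gap is at most each of the [M] preceding ones. Their sum
    involves the total drift, which is bounded independently of [M]. *)
Lemma posfrac_sandwich M : M%:R * (posfrac M.*2.+1 - posfrac M.*2) <=
  4 * cm * m%:R + M%:R * (8 * (cm ^+ 2 * wm)) + (\sum_(i < M) Cg i.*2) * h.
Proof.
apply: le_trans (_ : \sum_(i < M) (posfrac i.*2.+1 - posfrac i.*2.+2) <= _).
  rewrite mulr_natl -[X in _ *+ X]card_ord -sumr_const; apply: ler_sum => i _.
  by apply: lerB; [exact/posfrac_odd/ltnW|rewrite -doubleS posfrac_even].
apply: le_trans (_ : \sum_(i < M) (2 * cm * drift i.*2 + 8 * (cm ^+ 2 * wm) + Cg i.*2 * h) <= _).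
  by apply: ler_sum => i _; have := posfrac_gap i.*2; lra.
have -> : \sum_(i < M) (2 * cm * drift i.*2 + 8 * (cm ^+ 2 * wm) + Cg i.*2 * h) =
    2 * cm * (\sum_(i < M) drift i.*2) + M%:R * (8 * (cm ^+ 2 * wm)) + (\sum_(i < M) Cg i.*2) * h.
  by rewrite 2!big_split mulr_sumr mulr_suml sumr_const card_ord [M%:R * _]mulr_natl.
rewrite !lerD2r (_ : 4 * cm * m%:R = 2 * cm * (2 * m%:R)); last by ring.
by apply: ler_wpM2l (sum_drift M); rewrite mulr_ge0.
Qed.

(** The gain of [u] without [v] is independent of the edge [vu], so the equality prescribes one
    value for the weight of that edge. *)
Lemma Ex_tight v :
  h * Ex rho (fun w => [exists u, [&& u != v, 0 < wt w [set v; u] &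
     wt w [set v; u] == gain (wt w) [set v] u]%N]%:R) <= 2 * (h * cm * wm).
Proof.
have h0 := ltW h_gt0; have w0 := wm_ge0.
apply: le_trans (_ : h * \sum_(u | u != v) Ex rho (fun w => ((0 < wt w [set v; u])%N &&
     (wt w [set v; u] == gain (wt w) [set v] u))%:R) <= _).
  apply: ler_wpM2l => //; rewrite -Ex_sum; apply: Ex_le => // w; rewrite -natr_sum ler_nat.
  exact: exists_le_sum.
apply: sum_le_card => [|u uv]; first by rewrite !mulr_ge0.
rewrite (@eq_Ex _ _ _ _ _ (fun w => ((0 < wt w [set v; u])%N &&
     (wt w [set v; u] == gain (wt w) [set v] u))%:R * 1)); last by move=> w; rewrite mulr1.
apply: le_trans (@Ex_coord_le _ _ _ rho [set v; u] (h * cm * wm) _ (fun=> 1) lrho _ _ _) _ => //;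
  last by rewrite Ex_cst // mulr1.
move=> w.
set s := gain (wt w) [set v] u.
have gE a : gain (wt (upd w [set v; u] a)) [set v] u = s.
  apply: gain_ext => e d; rewrite /wt ffunE; case: eqP d => // -> /pred0P /(_ v).
  by rewrite /= !inE eqxx.
under eq_bigr do rewrite gE /wt ffunE eqxx.
have [sm|sm] := ltnP s m.+1; last first.
  rewrite big1 ?mulr_ge0 // => a _; have := ltn_ord a; case: eqP => [->|]; last by rewrite andbF mulr0.
  by rewrite ltnNge sm.
rewrite (bigD1 (Ordinal sm)) //= big1 ?addr0 => [|a]; last first.
  by rewrite -val_eqE /= => /negbTE ->; rewrite andbF mulr0.
rewrite eqxx andbT /=; have [s0|s0] := posnP s; first by rewrite mulr0 !mulr_ge0.
rewrite mulr1 rhoE ?(eq_sym v) //; last by rewrite -val_eqE /= -lt0n.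
by rewrite -!mulrA; apply: ler_wpM2l => //; apply: ler_pM.
Qed.

Definition tail (j : nat) : R := \sum_(i : 'I_m.+1 | (j < i)%N) om i.

Lemma tail_ge0 j : 0 <= tail j. Proof. exact: sumr_ge0. Qed.

Lemma tail_le1 j : tail j <= 1.
Proof. by rewrite -om1 [leRHS](bigID (fun i : 'I_m.+1 => (j < i)%N)) /= lerDl sumr_ge0. Qed.

Lemma edge_tail u v j : u != v ->
  \sum_(a : 'I_m.+1) rho [set u; v] a * (a <= j)%N%:R = 1 - h * c (tau u) (tau v) * tail j.
Proof.
move=> uv; rewrite -[X in _ = X - _](lrho.2 [set u; v]) /tail mulr_sumr.
rewrite [X in _ = X - _](bigID (fun a : 'I_m.+1 => (j < a)%N)) /=.
rewrite [X in _ = X + _ - _](_ : _ = \sum_(i : 'I_m.+1 | (j < i)%N) h * c (tau u) (tau v) * om i).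
  rewrite addrAC subrr add0r [RHS]big_mkcond; apply: eq_bigr => a _.
  by rewrite -leqNgt; case: (a <= j)%N; rewrite ?mulr1 ?mulr0.
by apply: eq_bigr => a ja; rewrite rhoE // -val_eqE /= -lt0n; apply: leq_trans ja.
Qed.

(** * Concentration of message counts *)

Section Concentration.
Variables (k j : nat).

Definition below w S v : R := (wmsg w k.+1 S v <= j)%N%:R.
Definition rate w S v u : R := h * c (tau v) (tau u) * tail (j + wmsg w k (v |: S) u).
(** The conditional probability of [below] given the graph without [v]: no edge at [v] may weigh
    more than [j] plus the message behind it. *)
Definition pbelow w S v : R := \prod_(u | u \notin v |: S) (1 - rate w S v u).

Lemma rate_ge0 w S v u : 0 <= rate w S v u.
Proof. by rewrite !mulr_ge0 ?tail_ge0 // ltW. Qed.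

Lemma rate_le w S v u : rate w S v u <= h * cm.
Proof.
rewrite -[leRHS]mulr1; apply: ler_pM; rewrite ?tail_ge0 ?tail_le1 //.
  by rewrite mulr_ge0 // ltW.
by apply: ler_wpM2l => //; exact: ltW.
Qed.

Lemma pbelow01 w S v : 0 <= pbelow w S v <= 1.
Proof.
rewrite /pbelow; have r01 u : 0 <= 1 - rate w S v u <= 1.
  by rewrite subr_ge0 (le_trans (rate_le _ _ _ _)) //= gerBl rate_ge0.
apply: (big_ind (fun x : R => 0 <= x <= 1)) => //; first by rewrite ler01 lexx.
by move=> x y /andP [x0 x1] /andP [y0 y1]; rewrite mulr_ge0 ?mulr_ile1.
Qed.

Lemma belowE w S v : below w S v =
  \prod_(u | u \notin v |: S) (wt w [set v; u] <= j + wmsg w k (v |: S) u)%N%:R.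
Proof.
rewrite /below; case: leqP => [/bigmax_leqP le|].
  by rewrite big1 // => u /le; rewrite leq_subLR addnC => ->.
rewrite ltnNge => /negP nle; have [/existsP [u /andP [uS lt]]|/existsPn no] :=
  boolP [exists u, (u \notin v |: S) && (j + wmsg w k (v |: S) u < wt w [set v; u])%N].
  by rewrite (bigD1 u) //= leqNgt lt /= mul0r.
case: nle; apply/bigmax_leqP => u uS; have := no u.
by rewrite uS /= -leqNgt leq_subLR addnC.
Qed.

(** Resampling the edges at [v] averages [below] to [pbelow] and leaves [g] unchanged. *)
Lemma below_cond v (g : wts -> R) : depends [set e : {set V} | v \notin e] g ->
  Ex rho (fun w => (below w set0 v - pbelow w set0 v) * g w) = 0.
Proof.
move=> dg; rewrite (@Ex_merge _ _ _ _ [set e : {set V} | v \in e]) //.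
rewrite -[RHS](Ex_cst lrho); apply: eq_Ex => w.
have mm w' : {in [set e : {set V} | v \notin e], merge [set e : {set V} | v \in e] w' w =1 w}.
  by move=> e; rewrite inE ffunE inE => /negbTE ->.
have mE w' u : u != v -> wmsg (merge [set e : {set V} | v \in e] w' w) k (v |: set0) u =
    wmsg w k (v |: set0) u.
  move=> uv; apply: wmsg_ext (mm w') _ _; first by rewrite !inE orbF.
  by move=> e d; rewrite inE; apply: contraTN d => ve; apply/pred0Pn; exists v; rewrite /= ve !inE eqxx.
rewrite (@eq_Ex _ _ _ _ _ (fun w' => g w * \prod_(u | u \notin v |: set0)
   (wt w' [set v; u] <= j + wmsg w k (v |: set0) u)%N%:R - g w * pbelow w set0 v)); last first.
  move=> w'; rewrite mulrC mulrBr (dg _ _ (mm w')) belowE; congr (_ * _ - _ * _).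
    apply: eq_bigr => u; rewrite !inE orbF => uv; rewrite mE // /wt ffunE inE.
    by rewrite !inE eqxx.
  by apply: eq_bigr => u; rewrite !inE orbF => uv; rewrite /rate mE.
rewrite ExB Ex_cst // ExZ; apply/eqP; rewrite subr_eq0; apply/eqP; congr (_ * _).
rewrite (@Ex_prod _ _ _ rho _ (fun u => u \notin v |: set0) (fun u => [set v; u])
  (fun u (a : 'I_m.+1) => (a <= j + wmsg w k (v |: set0) u)%N%:R)) //; last first.
  move=> x y; rewrite -!topredE /= !finset.in_setU !finset.in_set1 !finset.in_set0 !orbF => xv yv /setP /(_ x).
  by rewrite !inE eqxx orbT (negbTE xv) => /esym /eqP.
apply: eq_bigr => u; rewrite !inE orbF => uv; by rewrite edge_tail // eq_sym.
Qed.

Lemma prod_dist (D : pred V) (x y : V -> R) : (forall u, D u -> 0 <= x u <= 1) ->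
  (forall u, D u -> 0 <= y u <= 1) ->
  `|\prod_(u | D u) x u - \prod_(u | D u) y u| <= \sum_(u | D u) `|x u - y u|.
Proof.
move=> x01 y01.
pose K (a b s : R) := [/\ 0 <= a <= 1, 0 <= b <= 1 & `|a - b| <= s].
have : K (\prod_(u | D u) x u) (\prod_(u | D u) y u) (\sum_(u | D u) `|x u - y u|).
  apply: (big_rec3 K); first by split; rewrite ?lexx ?ler01 // subrr normr0.
  move=> u a b s Du [/andP [a0 a1] /andP [b0 b1] ab].
  have /andP [xu0 xu1] := x01 _ Du; have /andP [yu0 yu1] := y01 _ Du.
  split; try by apply/andP; split; [exact: mulr_ge0|exact: mulr_ile1].
  have -> : x u * a - y u * b = (x u - y u) * a + y u * (a - b) by ring.
  apply: le_trans (ler_normD _ _) _; rewrite !normrM (ger0_norm a0) (ger0_norm yu0).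
  apply: lerD; first by rewrite -[leRHS]mulr1 ler_wpM2l.
  by apply: le_trans ab; rewrite -[leRHS]mul1r ler_wpM2r.
by case.
Qed.

Lemma tail_dist a b : `|tail a - tail b| <= 1.
Proof.
by rewrite ler_norml; move: (tail_ge0 a) (tail_le1 a) (tail_ge0 b) (tail_le1 b); lra.
Qed.

Lemma natb_dist (a b : bool) : `|a%:R - b%:R : R| = (a != b)%:R.
Proof. by case: a; case: b; rewrite /= ?subrr ?subr0 ?sub0r ?normrN ?normr0 ?normr1. Qed.

Lemma rate_change w v y : v != y ->
  h * cm + \sum_(u | u \notin v |: (y |: set0)) h * cm *
      (wmsg w k (y |: set0) u != wmsg w k (v |: (y |: set0)) u)%:R >=
  \sum_(u | u \notin y |: set0) `|rate w set0 y u -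
     (if u == v then 0 else rate w [set v] y u)|.
Proof.
move=> vy; rewrite (bigD1 v) /= ?inE ?orbF // eqxx subr0 ger0_norm ?rate_ge0 //.
apply: lerD; first exact: rate_le.
rewrite (eq_bigl (fun u => u \notin v |: (y |: set0))); last first.
  by move=> u; rewrite !inE !orbF negb_or andbC.
apply: ler_sum => u; rewrite !inE !orbF negb_or => /andP [/negbTE -> uy].
rewrite /rate setU0 (setUC [set y] [set v]) -mulrBr normrM ger0_norm; last first.
  by rewrite mulr_ge0 // ltW.
have [->|_] := eqVneq (wmsg w k [set y] u); first by rewrite subrr normr0 !mulr0.
rewrite mulr1 -[leRHS]mulr1; apply: ler_pM => //; first by rewrite mulr_ge0 // ltW.
  by rewrite ler_wpM2l // ltW.
exact: tail_dist.
Qed.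

Definition change w v y : R := h * cm + \sum_(u | u \notin v |: (y |: set0)) h * cm *
  (wmsg w k (y |: set0) u != wmsg w k (v |: (y |: set0)) u)%:R.

Lemma Ex_change v y : v != y -> Ex rho (fun w => change w v y) <= Cl k.+1 * h.
Proof.
move=> vy; have h0 := ltW h_gt0; rewrite ExD Ex_cst // Ex_sum /=.
have -> : cm * (1 + 2 * Cl k) * h = h * cm + cm * (2 * (Cl k * h)) by ring.
rewrite lerD2l.
have -> : \sum_(u | u \notin v |: (y |: set0)) Ex rho (fun w => h * cm *
    (wmsg w k (y |: set0) u != wmsg w k (v |: (y |: set0)) u)%:R) =
    cm * (h * \sum_(u | u \notin v |: (y |: set0)) Ex rho (fun w =>
    (wmsg w k (y |: set0) u != wmsg w k (v |: (y |: set0)) u)%:R)).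
  by rewrite !mulr_sumr; apply: eq_bigr => u _; rewrite ExZ; ring.
apply: ler_wpM2l => //; apply: sum_le_card => [|u]; first by rewrite mulr_ge0 ?Cl_ge0.
rewrite !inE !orbF negb_or => /andP [uv uy]; apply: locality; first by rewrite !inE orbF.
by rewrite eq_sym.
Qed.

Lemma pbelow_change w v y : v != y ->
  `|pbelow w set0 y - pbelow w [set v] y| <= change w v y.
Proof.
move=> vy; apply: le_trans (rate_change w vy).
have -> : pbelow w [set v] y = \prod_(u | u \notin y |: set0)
    (1 - (if u == v then 0 else rate w [set v] y u)).
  rewrite [RHS](bigD1 v) /= ?inE ?orbF // eqxx subr0 mul1r /pbelow.
  apply: eq_big => [u|u]; first by rewrite !inE !orbF negb_or.
  by rewrite !inE negb_or => /andP [_ /negbTE ->].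
have r01 S u : 0 <= 1 - rate w S y u <= 1.
  by rewrite subr_ge0 (le_trans (rate_le _ _ _ _)) //= gerBl rate_ge0.
apply: le_trans (prod_dist _ _) _ => [u _|u _|]; first exact: r01.
  by case: ifP => _; [rewrite subr0 ler01 lexx|exact: r01].
apply: ler_sum => u _; rewrite -normrN le_eqVlt; apply/orP; left; apply/eqP.
by congr (`|_|); ring.
Qed.

Definition dif w S v := below w S v - pbelow w S v.

Lemma dif_le1 w S v : `|dif w S v| <= 1.
Proof.
have /andP [p0 p1] := pbelow01 w S v.
by rewrite /dif /below ler_norml; case: (wmsg w k.+1 S v <= j)%N => /=; lra.
Qed.

(** Recomputed without [v], the deviation at [y] is orthogonal to the one at [v] by [below_cond]; by
    locality the recomputation changes it by order [h] in the mean. *)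
Lemma dif_cross v y : v != y ->
  Ex rho (fun w => dif w set0 v * dif w set0 y) <= 2 * (Cl k.+1 * h).
Proof.
move=> vy; have dg : depends [set e : {set V} | v \notin e] (fun w => dif w [set v] y).
  move=> w w' ww; have aux (e : {set V}) (S : {set V}) : v \in S -> [disjoint e & S] ->
      e \in [set e : {set V} | v \notin e].
    by move=> vS d; rewrite inE; apply: contraTN d => ve; apply/pred0Pn; exists v; rewrite /= ve.
  rewrite /dif /below /pbelow (wmsg_ext _ ww) ?inE ?(eq_sym y) //; last first.
    by move=> e; apply: aux; rewrite inE.
  congr (_ - _); apply: eq_bigr => u uS; rewrite /rate (wmsg_ext _ ww) // => e.
  by apply: aux; rewrite !inE eqxx orbT.
have e0 := below_cond dg.
rewrite -[leLHS]subr0 -e0 -ExB.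
apply: le_trans (Ex_le lrho (g := fun w => (wmsg w k.+1 set0 y != wmsg w k.+1 (v |: set0) y)%:R + change w v y) _) _.
  move=> w; rewrite -/(dif w set0 v) -mulrBr; apply: le_trans (ler_norm _) _; rewrite normrM.
  rewrite -[leRHS]mul1r; apply: ler_pM => //; first exact: dif_le1.
  have -> : dif w set0 y - dif w [set v] y = (below w set0 y - below w [set v] y) -
    (pbelow w set0 y - pbelow w [set v] y) by rewrite /dif; ring.
  apply: le_trans (ler_normB _ _) _; apply: lerD; last exact: pbelow_change.
  rewrite /below natb_dist ler_nat setU0.
  have [->|_] := eqVneq (wmsg w k.+1 set0 y) (wmsg w k.+1 [set v] y); last exact: leq_b1.
  by rewrite eqxx.
rewrite ExD mulr2n mulrDl mul1r; apply: lerD; last exact: Ex_change.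
by apply: locality; rewrite ?inE.
Qed.

(** Under the normalisation [h ^+ 2] there are order [h ^- 1] diagonal terms of size at most 1, and
    order [h ^- 2] cross terms bounded by a multiple of [h]. *)
Lemma dif_var (P : pred V) :
  Ex rho (fun w => (h * \sum_(v | P v) dif w set0 v) ^+ 2) <= (2 + 8 * Cl k.+1) * h.
Proof.
have h0 := ltW h_gt0; have C0 := Cl_ge0 k.+1.
rewrite (@eq_Ex _ _ _ _ _ (fun w => h * (h * \sum_(v | P v) \sum_(y | P y) dif w set0 v * dif w set0 y))); last first.
  by move=> w; rewrite -big_distrlr /=; ring.
rewrite !ExZ Ex_sum.
have -> : (2 + 8 * Cl k.+1) * h = h * (2 * (1 + 2 * (2 * Cl k.+1))) by ring.
apply: ler_wpM2l => //; apply: sum_le_card => [|v Pv]; first by lra.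
rewrite Ex_sum.
rewrite (bigD1 v) //=; apply: lerD.
  apply: le_trans (ler_norm _) (le_trans (Ex_abs _ _) _) => //.
  rewrite -(Ex_cst lrho 1); apply: Ex_le => // w; rewrite normrM.
  by rewrite -(mulr1 1) ler_pM // dif_le1.
apply: le_trans (_ : \sum_(y | P y && (y != v)) 2 * (Cl k.+1 * h) <= _).
  by apply: ler_sum => y /andP [_ yv]; apply: dif_cross; rewrite eq_sym.
have -> : \sum_(y | P y && (y != v)) 2 * (Cl k.+1 * h) =
    h * \sum_(y | P y && (y != v)) 2 * Cl k.+1.
  by rewrite mulr_sumr; apply: eq_bigr => y _; ring.
by apply: sum_le_card => //; rewrite mulr_ge0.
Qed.

Lemma expR_dist (a b : R) : 0 <= a -> 0 <= b -> `|expR (- a) - expR (- b)| <= `|a - b|.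
Proof.
wlog ab : a b / a <= b => [hw a0 b0|a0 b0].
  by have [ab|/ltW ba] := leP a b; [exact: hw|rewrite distrC [leRHS]distrC; exact: hw].
have e1 : expR (- b) <= expR (- a) by rewrite ler_expR lerN2.
rewrite ger0_norm ?subr_ge0 // distrC ger0_norm ?subr_ge0 //.
have -> : expR (- b) = expR (- a) * expR (- (b - a)) by rewrite -expRD; congr expR; ring.
have ea : 0 <= expR (- a) <= 1 by rewrite expR_ge0 /= -[leRHS]expR0 ler_expR oppr_le0.
have eb := expR_ge1Dx (- (b - a)).
rewrite -[X in X - _]mulr1 -mulrBr; case/andP: ea => ea0 ea1.
apply: le_trans (_ : 1 * (b - a) <= _); last by rewrite mul1r.
by apply: ler_pM => //; [rewrite subr_ge0 -[leRHS]expR0 ler_expR oppr_le0 subr_ge0|lra].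
Qed.

Lemma one_sub_expR (x : R) : 0 <= x -> `|1 - x - expR (- x)| <= x ^+ 2.
Proof.
move=> x0; have e1 := expR_ge1Dx (- x).
rewrite ler0_norm; last by lra.
have : expR (- x) <= (1 + x)^-1.
  by rewrite expRN lef_pV2 ?posrE ?expR_gt0 ?expR_ge1Dx // ltr_wpDr.
have : (1 + x)^-1 <= 1 - x + x ^+ 2.
  rewrite -[leLHS]mul1r ler_pdivrMr ?ltr_wpDr //.
  have -> : (1 - x + x ^+ 2) * (1 + x) = 1 + x ^+ 3 by ring.
  by rewrite lerDl exprn_ge0.
by lra.
Qed.

(** Poisson approximation: each of the at most [2 / h] factors [1 - x] differs from [expR (- x)] by
    at most [x ^+ 2], which is of order [h ^+ 2]. *)
Lemma pbelow_exp w S v :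
  `|pbelow w S v - expR (- \sum_(u | u \notin v |: S) rate w S v u)| <= 2 * cm ^+ 2 * h.
Proof.
have h0 := ltW h_gt0.
rewrite -sumrN expR_sum; apply: le_trans (prod_dist _ _) _ => [u _|u _|].
- by rewrite subr_ge0 (le_trans (rate_le _ _ _ _)) //= gerBl rate_ge0.
- by rewrite expR_ge0 /= -[leRHS]expR0 ler_expR oppr_le0 rate_ge0.
apply: le_trans (_ : h * \sum_(u | u \notin v |: S) cm ^+ 2 * h <= _); last first.
  by rewrite -mulrA; apply: sum_le_card => //; rewrite mulr_ge0 ?exprn_ge0.
rewrite mulr_sumr; apply: ler_sum => u _.
apply: le_trans (one_sub_expR (rate_ge0 _ _ _ _)) _.
have -> : h * (cm ^+ 2 * h) = (h * cm) ^+ 2 by ring.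
by rewrite ler_pXn2r ?nnegrE ?rate_ge0 ?rate_le // mulr_ge0.
Qed.

(** The total rate at a vertex of type [t], with messages computed in the full graph; unlike the
    exact rate it is common to all vertices of this type. *)
Definition field w t : R := \sum_u h * c t (tau u) * tail (j + wmsg w k set0 u).

Lemma field_ge0 w t : 0 <= field w t.
Proof. by apply: sumr_ge0 => u _; rewrite !mulr_ge0 ?tail_ge0 // ltW. Qed.

Lemma rate_field w v : `|\sum_(u | u \notin v |: set0) rate w set0 v u - field w (tau v)| <=
  h * cm + \sum_(u | u != v) h * cm * (wmsg w k set0 u != wmsg w k (v |: set0) u)%:R.
Proof.
have h0 := ltW h_gt0.
rewrite /field [X in _ - X](bigD1 v) //= opprD addrCA.
rewrite (eq_bigl (fun u => u != v)) => [|u]; last by rewrite !inE orbF.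
rewrite -sumrB; apply: le_trans (ler_normD _ _) _; apply: lerD.
  rewrite normrN ger0_norm ?mulr_ge0 ?tail_ge0 // -[leRHS]mulr1.
  by apply: ler_pM; rewrite ?mulr_ge0 ?tail_ge0 ?tail_le1 // ler_wpM2l.
apply: le_trans (ler_norm_sum _ _ _) _; apply: ler_sum => u uv.
rewrite /rate -mulrBr normrM ger0_norm; last by rewrite mulr_ge0.
have [->|_] := eqVneq (wmsg w k set0 u); first by rewrite subrr normr0 !mulr0.
rewrite mulr1 -[leRHS]mulr1; apply: ler_pM => //; first by rewrite mulr_ge0.
  by rewrite ler_wpM2l.
exact: tail_dist.
Qed.

Lemma Ex_rate_field v :
  Ex rho (fun w => `|\sum_(u | u \notin v |: set0) rate w set0 v u - field w (tau v)|) <= Cl k.+1 * h.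
Proof.
have h0 := ltW h_gt0.
apply: le_trans (Ex_le lrho (fun w => rate_field w v)) _; rewrite ExD Ex_cst // Ex_sum /=.
have -> : cm * (1 + 2 * Cl k) * h = h * cm + cm * (2 * (Cl k * h)) by ring.
rewrite lerD2l.
have -> : \sum_(u | u != v) Ex rho (fun w => h * cm *
    (wmsg w k set0 u != wmsg w k (v |: set0) u)%:R) =
    cm * (h * \sum_(u | u != v) Ex rho (fun w =>
    (wmsg w k set0 u != wmsg w k (v |: set0) u)%:R)).
  by rewrite !mulr_sumr; apply: eq_bigr => u _; rewrite ExZ; ring.
apply: ler_wpM2l => //; apply: sum_le_card => [|u uv]; first by rewrite mulr_ge0 ?Cl_ge0.
by apply: locality; rewrite ?inE // eq_sym.
Qed.

End Concentration.

(** * The deterministic limit of the message counts *)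

Variable beta : T -> R.
Hypotheses (beta_ge0 : forall t, 0 <= beta t) (h_le1 : h <= 1).

Definition type_dev : R := \sum_t `|h * #|[pred v | tau v == t]|%:R - beta t|.

Definition cnt w k t j : R := h * \sum_(v | tau v == t) (wmsg w k set0 v <= j)%N%:R.

(** The limit of [cnt]. A weight [i] exceeds [j] plus a message iff the message is at most
    [i - j.+1]. The number of such neighbours is asymptotically Poisson, and the exponential is the
    probability that there are none. *)
Fixpoint nu k t (j : nat) : R := if k is k'.+1 then
  beta t * expR (- \sum_s c t s * \sum_(i : 'I_m.+1 | (j < i)%N) om i * nu k' s (i - j.+1)%N)
  else beta t.

Lemma nu_ge0 k t j : 0 <= nu k t j.
Proof. by case: k => [|k] /=; rewrite ?mulr_ge0 ?expR_ge0. Qed.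

Fixpoint Ct k : R := if k is k'.+1 then
  (3 + 8 * Cl k'.+1) / 2 + 2 * (2 * cm ^+ 2 + Cl k'.+1 + cm * #|T|%:R * Ct k') + 1 else 1.

Lemma CtS k : Ct k.+1 =
  (3 + 8 * Cl k.+1) / 2 + 2 * (2 * cm ^+ 2 + Cl k.+1 + cm * #|T|%:R * Ct k) + 1.
Proof. by []. Qed.

Lemma Ct_ge0 k : 0 <= Ct k.
Proof.
elim: k => [|k IH]; first exact: ler01.
have C0 := Cl_ge0 k.+1; have a0 : 0 <= cm ^+ 2 by rewrite exprn_ge0.
have b0 : 0 <= cm * #|T|%:R * Ct k by rewrite !mulr_ge0.
by move: C0; rewrite /=; lra.
Qed.

Lemma type_dev_ge0 : 0 <= type_dev. Proof. exact: sumr_ge0. Qed.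

Lemma type_dev_ge t : `|h * #|[pred v | tau v == t]|%:R - beta t| <= type_dev.
Proof. by rewrite /type_dev (bigD1 t) //= lerDl sumr_ge0. Qed.

(** Double counting of pairs of a vertex and a weight turns tails of [om] into counts of small
    messages, which closes the recursion. *)
Lemma field_cnt k j w t : field k j w t =
  \sum_s c t s * \sum_(i : 'I_m.+1 | (j < i)%N) om i * cnt w k s (i - j.+1)%N.
Proof.
rewrite /field (partition_big tau predT) //=; apply: eq_bigr => s _.
under eq_bigr => u /eqP -> do rewrite -mulrA mulrCA.
rewrite -mulr_sumr; congr (_ * _); rewrite /cnt.
under [RHS]eq_bigr do rewrite mulrCA mulr_sumr.
rewrite -[LHS]mulr_sumr -[RHS]mulr_sumr; congr (_ * _); rewrite [RHS]exchange_big /=.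
apply: eq_bigr => u _; rewrite /tail.
rewrite [RHS](bigID (fun i : 'I_m.+1 => (j + wmsg w k set0 u < i)%N)) /= [X in _ = _ + X]big1; last first.
  move=> i /andP [ji]; rewrite -leqNgt => le; case: leqP => [le2|]; last by rewrite mulr0.
  by move: ji le le2; lia.
rewrite addr0; apply: eq_big => i.
  by apply/idP/andP => [lt|[]//]; split=> //; apply: leq_ltn_trans lt; apply: leq_addr.
by move=> lt; case: leqP => [_|]; rewrite ?mulr1 //; move: lt; lia.
Qed.

(** Induction on the depth: by [dif_var] a count is close to the sum of its conditional
    probabilities, these are close to exponentials of the common field, and the field is linear in
    the counts one level down. *)
Lemma conc k t j : Ex rho (fun w => `|cnt w k t j - nu k t j|) <= Ct k * (Num.sqrt h + type_dev).
Proof.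
have h0 := ltW h_gt0; have d0 := type_dev_ge0; have q0 := sqrtr_ge0 h.
elim: k t j => [|k IH] t j.
  rewrite /= mul1r (@eq_Ex _ _ _ _ _ (fun=> `|h * #|[pred v | tau v == t]|%:R - beta t|)) => [|w].
    by rewrite Ex_cst //; apply: le_trans (type_dev_ge t) _; rewrite lerDr.
  by rewrite /cnt -natr_sum; congr (`|_ * _%:R - _|); rewrite -sum1_card; apply: eq_bigr.
have C0 := Cl_ge0 k.+1.
set d := Num.sqrt h + type_dev in IH *.
set mu := \sum_s c t s * \sum_(i : 'I_m.+1 | (j < i)%N) om i * nu k s (i - j.+1)%N.
have mu0 : 0 <= mu.
  by apply: sumr_ge0 => s _; rewrite mulr_ge0 // sumr_ge0 // => i _; rewrite mulr_ge0 ?nu_ge0.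
pose rf w v := `|\sum_(u | u \notin v |: set0) rate k j w set0 v u - field k j w (tau v)|.
have pt w : `|cnt w k.+1 t j - nu k.+1 t j| <= `|h * \sum_(v | tau v == t) dif k j w set0 v| +
    (h * \sum_(v | tau v == t) (2 * cm ^+ 2 * h + rf w v + `|field k j w t - mu|) + type_dev).
  have -> : cnt w k.+1 t j - nu k.+1 t j = h * (\sum_(v | tau v == t) dif k j w set0 v) +
     (h * (\sum_(v | tau v == t) (pbelow k j w set0 v - expR (- mu))) +
      (h * #|[pred v | tau v == t]|%:R - beta t) * expR (- mu)).
    rewrite /cnt /dif !sumrB sumr_const -[expR _ *+ _]mulr_natl /below /= -/mu; ring.
  apply: le_trans (ler_normD _ _) _; rewrite lerD2l.
  apply: le_trans (ler_normD _ _) _; apply: lerD; last first.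
    rewrite normrM -[leRHS]mulr1; apply: ler_pM => //; first exact: type_dev_ge.
    by rewrite ger0_norm ?expR_ge0 // -[leRHS]expR0 ler_expR oppr_le0.
  rewrite normrM ger0_norm //; apply: ler_wpM2l => //.
  apply: le_trans (ler_norm_sum _ _ _) _; apply: ler_sum => v /eqP tv.
  have -> : pbelow k j w set0 v - expR (- mu) =
      (pbelow k j w set0 v - expR (- \sum_(u | u \notin v |: set0) rate k j w set0 v u)) +
      ((expR (- \sum_(u | u \notin v |: set0) rate k j w set0 v u) - expR (- field k j w t)) +
       (expR (- field k j w t) - expR (- mu))) by ring.
  apply: le_trans (ler_normD _ _) _; rewrite -[leRHS]addrA; apply: lerD; first exact: pbelow_exp.
  apply: le_trans (ler_normD _ _) _; apply: lerD.
    rewrite /rf tv; apply: expR_dist; last exact: field_ge0.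
    by apply: sumr_ge0 => u _; apply: rate_ge0.
  by apply: expR_dist => //; exact: field_ge0.
have Edif : Ex rho (fun w => `|h * \sum_(v | tau v == t) dif k j w set0 v|) <=
    (3 + 8 * Cl k.+1) / 2 * Num.sqrt h.
  have s0 : 0 < Num.sqrt h by rewrite sqrtr_gt0.
  apply: le_trans (Ex_abs_le lrho _ s0) _.
  have hs : h = Num.sqrt h * Num.sqrt h by rewrite -expr2 sqr_sqrtr.
  have : Ex rho (fun w => (h * \sum_(v | tau v == t) dif k j w set0 v) ^+ 2) / Num.sqrt h <=
      (2 + 8 * Cl k.+1) * Num.sqrt h.
    by rewrite ler_pdivrMr // -mulrA -hs; apply: dif_var.
  by lra.
have Efield : Ex rho (fun w => `|field k j w t - mu|) <= cm * #|T|%:R * Ct k * d.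
  apply: le_trans (Ex_le lrho (g := fun w => \sum_s cm * \sum_(i : 'I_m.+1 | (j < i)%N)
     om i * `|cnt w k s (i - j.+1)%N - nu k s (i - j.+1)%N|) _) _.
    move=> w; rewrite field_cnt /mu -sumrB; apply: le_trans (ler_norm_sum _ _ _) _.
    apply: ler_sum => s _; rewrite -mulrBr normrM ger0_norm //; apply: ler_pM => //.
    rewrite -sumrB; apply: le_trans (ler_norm_sum _ _ _) _; apply: ler_sum => i _.
    by rewrite -mulrBr normrM ger0_norm.
  rewrite Ex_sum; apply: le_trans (_ : \sum_(s : T) cm * (Ct k * d) <= _).
    apply: ler_sum => s _; rewrite ExZ Ex_sum; apply: ler_wpM2l => //.
    apply: le_trans (_ : \sum_(i : 'I_m.+1 | (j < i)%N) om i * (Ct k * d) <= _).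
      by apply: ler_sum => i _; rewrite ExZ; apply: ler_wpM2l.
    rewrite -mulr_suml -[leRHS]mul1r; apply: ler_wpM2r; last exact: tail_le1.
    by rewrite mulr_ge0 ?Ct_ge0 // addr_ge0.
  by rewrite sumr_const -[_ *+ _]mulr_natl le_eqVlt; apply/orP; left; apply/eqP; ring.
apply: le_trans (Ex_le lrho pt) _; rewrite !ExD Ex_cst // ExZ Ex_sum.
have Eh : h * \sum_(v | tau v == t) Ex rho (fun w => 2 * cm ^+ 2 * h + rf w v + `|field k j w t - mu|) <=
    2 * (2 * cm ^+ 2 * h + Cl k.+1 * h + cm * #|T|%:R * Ct k * d).
  apply: sum_le_card => [|v _].
    have dd0 : 0 <= d by rewrite addr_ge0.
    have cc0 := Ct_ge0 k; have cm2 : 0 <= cm ^+ 2 by rewrite exprn_ge0.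
    have a1 : 0 <= 2 * cm ^+ 2 * h by rewrite !mulr_ge0.
    have a2 : 0 <= Cl k.+1 * h by rewrite mulr_ge0.
    have a3 : 0 <= cm * #|T|%:R * Ct k * d by rewrite !mulr_ge0.
    by rewrite addr_ge0 // addr_ge0.
  rewrite !ExD Ex_cst //; apply: lerD => //; rewrite lerD2l; exact: Ex_rate_field.
have hq : h <= Num.sqrt h.
  have hs : h = Num.sqrt h * Num.sqrt h by rewrite -expr2 sqr_sqrtr.
  by rewrite {1}hs ler_piMr // -sqrtr1 ler_wsqrtr.
apply: le_trans (lerD Edif (lerD Eh (lexx _))) _.
have Q0 : 0 <= (3 + 8 * Cl k.+1) / 2 by rewrite divr_ge0 // addr_ge0 // mulr_ge0.
have e1 : (3 + 8 * Cl k.+1) / 2 * Num.sqrt h <= (3 + 8 * Cl k.+1) / 2 * d.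
  by apply: ler_wpM2l => //; rewrite lerDl.
have hd : h <= d by apply: le_trans hq _; rewrite lerDl.
have e2 : 2 * cm ^+ 2 * h <= 2 * cm ^+ 2 * d by apply: ler_wpM2l => //; rewrite mulr_ge0 ?exprn_ge0.
have e3 : Cl k.+1 * h <= Cl k.+1 * d by apply: ler_wpM2l.
have e4 : type_dev <= d by rewrite lerDr.
have -> : Ct k.+1 * d = (3 + 8 * Cl k.+1) / 2 * d + (2 * (2 * cm ^+ 2 * d + Cl k.+1 * d +
   cm * #|T|%:R * Ct k * d) + d) by rewrite CtS; ring.
apply: lerD => //; apply: lerD => //; apply: ler_wpM2l => //.
by rewrite lerD2r; apply: lerD.
Qed.

End RandomWeights.

Lemma leq_pos (a b : nat) : (a <= b -> (0 < a) <= (0 < b))%N.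
Proof. by case: a => // a; case: b. Qed.

(** * The matching number in terms of truncated messages *)

Section MatchingFraction.
Variables (R : realType) (V T : finType) (tau : V -> T) (c : T -> T -> R).
Variables (cm wm h : R) (Q K : nat) (om : 'I_(Q + K).+1 -> R) (rho : {set V} -> 'I_(Q + K).+1 -> R).
Hypotheses (lrho : is_law rho) (c_ge0 : forall s t, 0 <= c s t) (c_le : forall s t, c s t <= cm).
Hypotheses (cm_ge0 : 0 <= cm) (h_gt0 : 0 < h) (hV : h * #|V|%:R <= 2) (hcm : h * cm <= 1).
Hypotheses (om_ge0 : forall i, 0 <= om i) (om_le : forall i, om i <= wm).
Hypotheses (om0 : om ord0 = 0) (om1 : \sum_i om i = 1).
Hypothesis rhoE : forall u v i, u != v -> i != ord0 ->
  rho [set u; v] i = h * c (tau u) (tau v) * om i.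
Variable beta : T -> R.
Hypotheses (beta_ge0 : forall t, 0 <= beta t) (h_le1 : h <= 1).
Hypotheses (Q_gt0 : (0 < Q)%N)
  (rhoQ : forall e i, rho e i != 0 -> i != ord0 -> (Q <= i)%N).

Let supp (w : {ffun {set V} -> 'I_(Q + K).+1}) (e : {set V}) : nat := (0 < wt w e)%N.

Lemma posfrac_nu k : `|posfrac h rho k - \sum_t (beta t - nu c om beta k t 0)| <=
  type_dev tau h beta + #|T|%:R * (Ct T cm k * (Num.sqrt h + type_dev tau h beta)).
Proof.
have h0 := ltW h_gt0.
have -> : posfrac h rho k = \sum_t (h * #|[pred v | tau v == t]|%:R -
    Ex rho (fun w => cnt tau h w k t 0)).
  rewrite /posfrac (partition_big tau predT) //= mulr_sumr; apply: eq_bigr => t _.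
  rewrite /cnt ExZ -mulrBr; congr (_ * _); rewrite Ex_sum -sum1_card natr_sum -sumrB.
  apply: eq_bigr => v _; rewrite -[X in X - _](Ex_cst lrho) -ExB; apply: eq_Ex => w.
  by rewrite lt0n leqn0; case: eqP; rewrite /= ?subrr ?subr0.
rewrite -sumrB.
rewrite (eq_bigr (fun t => (h * #|[pred v | tau v == t]|%:R - beta t) -
    (Ex rho (fun w => cnt tau h w k t 0) - nu c om beta k t 0))) => [|t _]; last by ring.
rewrite sumrB; apply: le_trans (ler_normB _ _) _; apply: lerD.
  exact: ler_norm_sum.
apply: le_trans (ler_norm_sum _ _ _) _.
rewrite -[X in X%:R * _]card_ord mulr_natl card_ord -sumr_const; apply: ler_sum => t _.
rewrite -[X in _ - X](Ex_cst lrho) -ExB; apply: le_trans (Ex_abs lrho _) _.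
exact: (@conc R V T tau c cm h (Q + K) om rho).
Qed.

Definition matching_error L : R := (\sum_(i < L) Cg cm i.*2) / L%:R + 1 + #|T|%:R * Ct T cm L.*2.

(** Bounding the gains by even and odd truncations turns the two estimates of
    [max_weight_card_bounds] into [posfrac] at the depths [L.*2] and [L.*2.+1], whose gap is bounded
    by [posfrac_sandwich]. Tight edges and the spread of the weights give the terms with
    [4 * cm * wm] and [K / Q]. *)
Lemma matching_fraction L : (0 < L)%N ->
  `|h * Ex rho (fun w => (2 * max_weight (supp w) set0)%:R) -
    \sum_t (beta t - nu c om beta L.*2 t 0)| <=
  4 * cm * (Q + K)%:R / L%:R + 8 * (cm ^+ 2 * wm) + 4 * cm * wm + 4 * (K%:R / Q%:R) +
  matching_error L * (Num.sqrt h + type_dev tau h beta).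
Proof.
move=> L0; have h0 := ltW h_gt0; have d0 := type_dev_ge0 tau h beta; have q0 := sqrtr_ge0 h.
have Lr : 0 < L%:R :> R by rewrite ltr0n.
pose pos (w : {ffun {set V} -> 'I_(Q + K).+1}) := #|[set v | (0 < gain (wt w) set0 v)%N]|.
pose tig (w : {ffun {set V} -> 'I_(Q + K).+1}) := #|[set v | [exists u, [&& u != v, 0 < wt w [set v; u] &
                        wt w [set v; u] == gain (wt w) [set v] u]%N]]|.
have posE w : (pos w = \sum_v (0 < gain (wt w) set0 v))%N.
  by rewrite /pos -sum1dep_card big_mkcond.
have tigE w : (tig w = \sum_v [exists u, [&& u != v, 0 < wt w [set v; u] &
                        wt w [set v; u] == gain (wt w) [set v] u]%N])%N.
  by rewrite /tig -sum1dep_card big_mkcond.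
have bnd (w : {ffun {set V} -> 'I_(Q + K).+1}) : (forall e, rho e (w e) != 0) ->
   (pos w <= 2 * max_weight (supp w) set0)%N /\
   (Q * (2 * max_weight (supp w) set0) <= (Q + K) * (pos w + tig w))%N.
  move=> sw; apply: max_weight_card_bounds => e we; apply/andP; split.
    by apply: (rhoQ (sw e)); rewrite -val_eqE /= -lt0n.
  by rewrite -ltnS ltn_ord.
have lo : posfrac h rho L.*2 <= h * Ex rho (fun w => (2 * max_weight (supp w) set0)%:R).
  rewrite /posfrac -Ex_sum; apply: ler_wpM2l => //; apply: Ex_le_supp => // w /bnd [le _].
  rewrite -natr_sum ler_nat; apply: leq_trans le; rewrite posE; apply: leq_sum => v _.
  have := @msg_gain V (wt w) L.*2 set0 v; rewrite inE odd_double => /(_ isT).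
  exact: leq_pos.
have up : h * Ex rho (fun w => (2 * max_weight (supp w) set0)%:R) <=
    posfrac h rho L.*2.+1 + 4 * cm * wm + 4 * (K%:R / Q%:R).
  have Qr : 0 < Q%:R :> R by rewrite ltr0n.
  apply: le_trans (_ : h * Ex rho (fun w => \sum_v (0 < wmsg w L.*2.+1 set0 v)%N%:R +
     \sum_v [exists u, [&& u != v, 0 < wt w [set v; u] &
                        wt w [set v; u] == gain (wt w) [set v] u]%N]%:R +
     K%:R / Q%:R * (2 * #|V|%:R)) <= _).
    apply: ler_wpM2l => //; apply: Ex_le_supp => // w /bnd [_ le].
    have le1 : (pos w <= \sum_v (0 < wmsg w L.*2.+1 set0 v))%N.
      rewrite posE; apply: leq_sum => v _.
      have := @msg_gain V (wt w) L.*2.+1 set0 v; rewrite inE /= odd_double => /(_ isT).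
      exact: leq_pos.
    have le2 : (pos w + tig w <= 2 * #|V|)%N.
      by rewrite mul2n -addnn; apply: leq_add; apply: max_card.
    apply: le_trans (_ : (pos w + tig w)%:R + K%:R / Q%:R * (pos w + tig w)%:R <= _).
      rewrite -[X in X + _]mul1r -mulrDl -(ler_pM2l Qr) mulrA mulrDr mulr1 mulrCA divff ?gt_eqF //.
      by rewrite mulr1 -natrD -!natrM ler_nat.
    apply: lerD.
      by rewrite natrD -!natr_sum -tigE lerD2r ler_nat; exact: le1.
    by apply: ler_wpM2l; [rewrite divr_ge0|rewrite -natrM ler_nat].
  rewrite !ExD !Ex_sum Ex_cst // !mulrDr; apply: lerD; first apply: lerD => //.
    rewrite mulr_sumr; apply: le_trans (_ : \sum_(v : V) 2 * (h * cm * wm) <= _).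
      by apply: ler_sum => v _; apply: (@Ex_tight R V T tau c cm wm h (Q + K) om rho).
    have -> : 4 * cm * wm = 2 * (2 * (cm * wm)) by ring.
    have -> : \sum_(v : V) 2 * (h * cm * wm) = h * \sum_(v : V) 2 * (cm * wm).
      by rewrite mulr_sumr; apply: eq_bigr => v _; ring.
    apply: sum_le_card => //; rewrite !mulr_ge0 //; exact: le_trans (om_ge0 ord0) (om_le ord0).
  have -> : h * (K%:R / Q%:R * (2 * #|V|%:R)) = 2 * (K%:R / Q%:R) * (h * #|V|%:R) by ring.
  have -> : 4 * (K%:R / Q%:R) = 2 * (K%:R / Q%:R) * 2 :> R by ring.
  by apply: ler_wpM2l => //; rewrite mulr_ge0 // divr_ge0.
have gap : posfrac h rho L.*2.+1 - posfrac h rho L.*2 <= 4 * cm * (Q + K)%:R / L%:R +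
    8 * (cm ^+ 2 * wm) + (\sum_(i < L) Cg cm i.*2) / L%:R * h.
  rewrite -(ler_pM2l Lr); apply: le_trans (posfrac_sandwich lrho c_ge0 c_le _ _ _ _ _ _ _ _ rhoE L) _ => //.
  rewrite le_eqVlt; apply/orP; left; apply/eqP; field; exact: lt0r_neq0.
have := posfrac_nu L.*2; rewrite /matching_error.
set d := Num.sqrt h + type_dev tau h beta.
set D := \sum_t _; set dv := type_dev _ _ _ in d *.
set S := (\sum_(i < L) _) / L%:R in gap *.
have S0 : 0 <= S.
  rewrite divr_ge0 // sumr_ge0 // => i _.
  have C0 k : 0 <= Cl cm k by apply: Cl_ge0.
  have C2 k : 0 <= 8 * (cm ^+ 2 * Cl cm k) by rewrite mulr_ge0 // mulr_ge0 // exprn_ge0.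
  by rewrite /Cg addr_ge0 // addr_ge0 // mulr_ge0 ?addr_ge0 // mulr_ge0.
have hd : S * h <= S * d.
  apply: ler_wpM2l => //; apply: le_trans (_ : Num.sqrt h <= _); last by rewrite lerDl.
  have hs : h = Num.sqrt h * Num.sqrt h by rewrite -expr2 sqr_sqrtr.
  by rewrite {1}hs ler_piMr // -sqrtr1 ler_wsqrtr.
have dd : dv <= d by rewrite lerDr.
rewrite ![`|_| <= _]ler_norml => /andP [p1 p2].
by apply/andP; split; move: lo up gap p1 p2 hd dd; rewrite /d; lra.
Qed.

End MatchingFraction.

Lemma sum_ord_gt Q K : (\sum_(i < (Q + K).+1) (Q < i) = K)%N.
Proof.
elim: K => [|K IH].
  by rewrite addn0 big1 // => i _; rewrite ltnNge -ltnS ltn_ord.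
by rewrite addnS big_ord_recr IH /= ltnS leq_addr addn1.
Qed.

Lemma archi_le (R : archiRealFieldType) (x : R) : exists K : nat, (0 < K)%N /\ x <= K%:R.
Proof.
exists (Num.Def.archi_bound `|x|).+1; split => //.
apply: le_trans (ler_norm x) _; rewrite ltW //; apply: lt_trans (archi_boundP (normr_ge0 x)) _.
by rewrite ltr_nat.
Qed.

(* Random weights spread over the [K] values above [K^2] break ties without changing the order of
   magnitude of the optimum. *)
Lemma matching_fraction_limit (R : realType) (T : finType) (c : T -> T -> R) (cm : R)
    (beta : T -> R) (eps : R) : (forall s t, 0 <= c s t) -> (forall s t, c s t <= cm) ->
  0 <= cm -> (forall t, 0 <= beta t) -> 0 < eps ->
  exists D C : R, 0 <= C /\
  forall (V : finType) (tau : V -> T) (h : R) (rho : {set V} -> 'I_2 -> R),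
    is_law rho -> 0 < h -> h <= 1 -> h * cm <= 1 -> h * #|V|%:R <= 2 ->
    (forall u v, u != v -> rho [set u; v] ord_max = h * c (tau u) (tau v)) ->
  `|h * Ex rho (fun w => (2 * max_weight (wt w) set0)%:R) - D| <=
    eps + C * (Num.sqrt h + type_dev tau h beta).
Proof.
move=> c0 ccm cm0 b0 e0.
(* Both the atoms [wm] and the spread [K / Q] equal [1 / K], and their terms are to sum to at most
   [eps / 2]. The drift term grows with [Q + K], hence the depth [L] is chosen afterwards. *)
have [K [K0 Ke]] := archi_le ((8 * cm ^+ 2 + 4 * cm + 4) * 2 / eps).
pose Q := (K * K)%N.
have [L [L0 Le]] := archi_le (4 * cm * (Q + K)%:R * 2 / eps).
have Kr : 0 < K%:R :> R by rewrite ltr0n.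
have Lr : 0 < L%:R :> R by rewrite ltr0n.
pose om (i : 'I_(Q + K).+1) : R := (Q < i)%N%:R / K%:R.
have om1 : \sum_i om i = 1.
  by rewrite -mulr_suml -natr_sum sum_ord_gt divff ?gt_eqF.
have om_ge0 i : 0 <= om i by rewrite divr_ge0.
have om_le i : om i <= K%:R^-1.
  by rewrite /om; case: (Q < i)%N; rewrite ?mul1r // mul0r invr_ge0 ltW.
have om0 : om ord0 = 0 by rewrite /om ltn0 mul0r.
exists (\sum_t (beta t - nu c om beta L.*2 t 0)), (matching_error T cm L); split.
  rewrite /matching_error !addr_ge0 ?mulr_ge0 ?Ct_ge0 ?divr_ge0 ?sumr_ge0 // => i _.
  have C0 k : 0 <= Cl cm k by apply: Cl_ge0.
  have C2 k : 0 <= 8 * (cm ^+ 2 * Cl cm k) by rewrite mulr_ge0 // mulr_ge0 // exprn_ge0.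
  by rewrite /Cg addr_ge0 // addr_ge0 // mulr_ge0 ?addr_ge0 // mulr_ge0.
move=> V tau h rho lr h0 h1 hcm hV rhoE.
(* The probability of an absent edge is kept and the rest is spread according to [om]; forgetting
   the weight recovers [rho]. *)
pose rho' (e : {set V}) (i : 'I_(Q + K).+1) : R :=
  if i == ord0 then rho e ord0 else rho e ord_max * om i.
have sum2 e : rho e ord0 + rho e ord_max = 1.
  by rewrite -(lr.2 e) big_ord_recl big_ord1; congr (_ + rho e _); apply: val_inj.
have s0 e : \sum_(i | i != ord0) rho' e i = rho e ord_max.
  rewrite (eq_bigr (fun i => rho e ord_max * om i)) => [|i /negbTE]; last by rewrite /rho' => ->.
  by rewrite -mulr_sumr -[RHS]mulr1 -om1 [in RHS](bigD1 ord0) //= om0 add0r.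
have lr' : is_law rho'.
  split=> [e i|e]; first by rewrite /rho'; case: ifP => _; rewrite ?mulr_ge0 ?lr.1.
  by rewrite (bigD1 ord0) //= s0 /rho' eqxx.
pose phi (i : 'I_(Q + K).+1) : 'I_2 := if i == ord0 then ord0 else ord_max.
have -> : Ex rho (fun w => (2 * max_weight (wt w) set0)%:R) =
    Ex rho' (fun w => (2 * max_weight (fun e => (0 < wt w e : nat)%N) set0)%:R).
  rewrite -(@Ex_push R {set V} 'I_(Q + K).+1 {set V} 'I_2 rho' id phi) //.
    apply: eq_Ex => w; congr (2 * _)%N%:R; apply: max_weight_ext => e _.
    by rewrite /wt ffunE /phi lt0n -val_eqE /=; case: eqP.
  move=> e a; have [->|a0] := eqVneq a ord0.
    rewrite (big_pred1 ord0) => [|i]; first by rewrite /rho' eqxx.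
    by rewrite /phi /=; case: (i == ord0).
  have -> : a = ord_max by case: a a0 => -[|[|]] //= i _; apply: val_inj.
  rewrite -s0; apply: eq_bigl => i; by rewrite /phi; case: (i == ord0).
apply: le_trans (@matching_fraction R V T tau c cm K%:R^-1 h Q K om rho' lr' c0 ccm cm0 h0 hV hcm
  om_ge0 om_le om0 om1 _ beta b0 h1 _ _ L L0) _.
- by move=> u v i uv i0; rewrite /rho' (negbTE i0) rhoE.
- by rewrite muln_gt0 K0.
- move=> e i; rewrite /rho' => ne i0; move: ne; rewrite (negbTE i0) mulf_eq0 negb_or => /andP [_].
  by rewrite /om; case: ltnP => [/ltnW //|_]; rewrite mul0r eqxx.
rewrite lerD2r.
have KQ : K%:R / Q%:R = K%:R^-1 :> R.
  by rewrite natrM invfM mulrA divff ?mul1r // gt_eqF.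
have e1 : (8 * cm ^+ 2 + 4 * cm + 4) * K%:R^-1 <= eps / 2.
  rewrite ler_pdivrMr // [leRHS]mulrC -ler_pdivrMr ?divr_gt0 //.
  by apply: le_trans Ke; rewrite invf_div mulrA.
have e2 : 4 * cm * (Q + K)%:R / L%:R <= eps / 2.
  rewrite ler_pdivrMr // [leRHS]mulrC -ler_pdivrMr ?divr_gt0 //.
  by apply: le_trans Le; rewrite invf_div mulrA.
by rewrite KQ; lra.
Qed.

(** * The bipartite model and existence of the limit *)

Section BipartiteModel.
Variables (R : realType) (n : nat).
Local Notation V := (bool * 'I_n)%type.
Implicit Types (pr : 'I_n -> 'I_n -> R) (e : {set V}).

Definition bern (p : R) (a : 'I_2) : R := if a == ord0 then 1 - p else p.

(** Every set of vertices is a coordinate, and those that do not join the two sides are almost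
    surely absent; this makes the general graph results applicable to bipartite graphs. *)
Definition edge_law pr e : 'I_2 -> R :=
  bern (if [pick p | ends p == e] is Some p then pr p.1 p.2 else 0).

Lemma sum_bern p : \sum_a bern p a = 1.
Proof. by rewrite big_ord_recl big_ord1 /bern /= subrK. Qed.

Lemma edge_law_is_law pr : (forall i j, 0 <= pr i j <= 1) -> is_law (edge_law pr).
Proof.
move=> p01; split=> [e a|e]; last exact: sum_bern.
rewrite /edge_law /bern; case: pickP => [p _|_].
  by have /andP [? ?] := p01 p.1 p.2; case: ifP => // _; rewrite subr_ge0.
by case: ifP => // _; rewrite subr0.
Qed.

Lemma edge_law_ends pr p : edge_law pr (ends p) = bern (pr p.1 p.2).
Proof.
by rewrite /edge_law; case: pickP => [q /eqP /ends_inj -> //|/(_ p)]; rewrite eqxx.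
Qed.

Lemma ends_pair (u v : V) : (exists p, ends p = [set u; v]) -> u.1 != v.1.
Proof.
case=> -[a b] e; case: u v e => [s i] [t j] e.
have in1 (x : V) : (x \in [set (s, i); (t, j)]) = (x \in ends (a, b)) by rewrite e.
have := in1 (true, b); have := in1 (false, a).
by rewrite !in_ends !inE !xpair_eqE !eqxx; case: s {e in1}; case: t.
Qed.

Lemma edge_law_pair pr (u v : V) : edge_law pr [set u; v] =
  bern (if u.1 then (if v.1 then 0 else pr v.2 u.2) else (if v.1 then pr u.2 v.2 else 0)).
Proof.
case: u v => [s i] [t j] /=; case st : (s == t).
  rewrite /edge_law; case: pickP => [q /eqP eq|_].
    by have := @ends_pair (s, i) (t, j) (ex_intro _ q eq); rewrite /= st.
  by move: st; case: s; case: t.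
move: st; case: s; case: t => // _.
  by rewrite setUC -[[set _; _]]/(ends (j, i)) edge_law_ends.
by rewrite -[[set _; _]]/(ends (i, j)) edge_law_ends.
Qed.

Lemma edge_law_supp pr (w : {ffun {set V} -> 'I_2}) : (forall e, edge_law pr e (w e) != 0) ->
  forall e, (0 < wt w e)%N -> exists p, e = ends p.
Proof.
move=> sw e we; have := sw e; rewrite /edge_law; case: pickP => [p /eqP <-|_]; first by exists p.
by rewrite /bern -val_eqE /=; move: we; rewrite /wt lt0n => /negbTE ->; rewrite eqxx.
Qed.

Lemma wt_le1 (w : {ffun {set V} -> 'I_2}) e : (wt w e <= 1)%N.
Proof. by rewrite -ltnS ltn_ord. Qed.

Lemma edge_law_bip pr (w : {ffun {set V} -> 'I_2}) : (forall e, edge_law pr e (w e) != 0) ->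
  forall u v : V, u != v -> (0 < wt w [set u; v])%N -> u.1 != v.1.
Proof.
by move=> sw u v _ /(edge_law_supp sw) [p e]; apply: ends_pair; exists p.
Qed.

Lemma Ex_matching pr : (forall i j, 0 <= pr i j <= 1) ->
  \sum_(E : {set 'I_n * 'I_n})
    (\prod_(e : 'I_n * 'I_n) (if e \in E then pr e.1 e.2 else 1 - pr e.1 e.2)) *
    (max_matching E)%:R =
  Ex (edge_law pr) (fun w => (max_weight (wt w) set0)%:R).
Proof.
move=> p01; have lr := edge_law_is_law p01.
pose F (x : {ffun 'I_n * 'I_n -> bool}) : R := (max_matching [set p | x p])%:R.
rewrite (@eq_Ex_supp _ _ _ _ _ (fun w : {ffun {set V} -> 'I_2} => F [ffun p => (0 < w (ends p))%N])); last first.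
  move=> w sw; congr _%:R; symmetry; apply: max_matchingE; first exact: wt_le1.
    by move=> p; rewrite inE ffunE.
  exact: edge_law_supp sw.
rewrite (@Ex_push _ _ _ _ bool (edge_law pr) (@ends n) (fun a : 'I_2 => (0 < a)%N)
  (fun p b => if b then pr p.1 p.2 else 1 - pr p.1 p.2)) //; last first.
- move=> p b; rewrite edge_law_ends big_mkcond big_ord_recl big_ord1 /bern /=.
  by case: b; rewrite /= ?add0r ?addr0.
- exact: ends_inj.
rewrite /Ex (reindex (fun x : {ffun 'I_n * 'I_n -> bool} => [set p | x p])) /=.
  by apply: eq_bigr => x _; congr (_ * _); apply: eq_bigr => p _; rewrite inE.
exists (fun E : {set 'I_n * 'I_n} => [ffun p => p \in E]) => [x _|E _].
  by apply/ffunP => p; rewrite ffunE inE.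
by apply/setP => p; rewrite inE ffunE.
Qed.

Definition type_law (b : R) (i : 'I_n) : 'I_2 -> R := type_prob b.

Lemma type_law_is_law b : 0 <= b <= 1 -> is_law (type_law b).
Proof.
move=> /andP [b0 b1]; split=> [i x|i].
  by rewrite /type_law /type_prob; case: ifP => // _; rewrite subr_ge0.
by rewrite /type_law big_ord_recl big_ord1 /type_prob /= subrK.
Qed.

Definition edge_probs (C : 'M[R]_2) (tL tR : {ffun 'I_n -> 'I_2}) i j : R :=
  edge_prob n (C (tL i) (tR j)).

Lemma edge_probs01 (C : 'M[R]_2) tL tR : (forall x y, 0 <= C x y) ->
  forall i j, 0 <= edge_probs C tL tR i j <= 1.
Proof.
move=> C0 i j; rewrite /edge_probs /edge_prob le_min ler01 divr_ge0 //=.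
by rewrite ge_min lexx.
Qed.

Lemma expected_matchingE bL bR (C : 'M[R]_2) : (forall x y, 0 <= C x y) ->
  expected_matching bL bR C n =
  Ex (type_law bL) (fun tL => Ex (type_law bR) (fun tR =>
    Ex (edge_law (edge_probs C tL tR)) (fun w => (max_weight (wt w) set0)%:R))).
Proof.
move=> C0; rewrite /expected_matching /Ex; apply: eq_bigr => tL _.
rewrite mulr_sumr; apply: eq_bigr => tR _.
have := Ex_matching (edge_probs01 tL tR C0); rewrite /Ex => <-.
rewrite !mulr_sumr; apply: eq_bigr => E _.
by rewrite !mulrA.
Qed.

(** One node changes the count by at most 1, so [Ex_variance] bounds the variance by [n]. *)
Lemma Ex_type_count b x : (0 < n)%N -> 0 <= b <= 1 ->
  Ex (type_law b) (fun t : {ffun 'I_n -> 'I_2} =>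
    `|#|[pred i | t i == x]|%:R - n%:R * type_prob b x|) <= Num.sqrt n%:R.
Proof.
move=> n0 b01; have lr := type_law_is_law b01.
pose f (t : {ffun 'I_n -> 'I_2}) : R := #|[pred i | t i == x]|%:R.
have fE t : f t = \sum_i (t i == x)%:R.
  by rewrite /f -sum1_card natr_sum big_mkcond; apply: eq_bigr => i _; rewrite inE; case: (t i == x).
have Ef : Ex (type_law b) f = n%:R * type_prob b x.
  rewrite (eq_Ex _ fE) Ex_sum (eq_bigr (fun=> type_prob b x)) => [|i _].
    by rewrite sumr_const card_ord mulr_natl.
  rewrite (@Ex_coord1 _ _ _ _ i (fun a => (a == x)%:R)) // (bigD1 x) //= eqxx mulr1.
  by rewrite big1 ?addr0 // => a /negbTE ->; rewrite mulr0.
have var : Ex (type_law b) (fun t => (f t - n%:R * type_prob b x) ^+ 2) <= n%:R.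
  rewrite -Ef; apply: le_trans (Ex_variance regular lr _) _ => [t i a|].
    rewrite !fE -sumrB (bigD1 i) //= big1 ?addr0 => [|j /negbTE ji]; last first.
      by rewrite ffunE ji subrr.
    by rewrite natb_dist; case: (_ != _); rewrite ?lexx ?ler01.
  apply: le_trans (_ : \sum_(i < n) 1 <= _); last by rewrite sumr_const card_ord.
  by apply: ler_sum => i _; rewrite gerBl lr.1.
have s0 : 0 < Num.sqrt n%:R :> R by rewrite sqrtr_gt0 ltr0n.
apply: le_trans (Ex_abs_le lr _ s0) _.
have : Ex (type_law b) (fun t => (f t - n%:R * type_prob b x) ^+ 2) / Num.sqrt n%:R <= Num.sqrt n%:R.
  by rewrite ler_pdivrMr // -expr2 sqr_sqrtr.
by rewrite /f; lra.
Qed.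

End BipartiteModel.

(** * Convergence of the normalised expected matching number *)

Section Convergence.
Variable R : realType.

(** The side becomes part of the type, with rate 0 between vertices of the same side. *)
Definition side_rate (C : 'M[R]_2) (s t : bool * 'I_2) : R :=
  if s.1 then (if t.1 then 0 else C t.2 s.2) else (if t.1 then C s.2 t.2 else 0).

Definition side_prob (bL bR : R) (s : bool * 'I_2) : R :=
  type_prob (if s.1 then bR else bL) s.2.

Definition side_type n (tL tR : {ffun 'I_n -> 'I_2}) (v : bool * 'I_n) : bool * 'I_2 :=
  (v.1, (if v.1 then tR else tL) v.2).

Lemma side_type_dev n (bL bR : R) (tL tR : {ffun 'I_n -> 'I_2}) : (0 < n)%N ->
  type_dev (side_type tL tR) n%:R^-1 (side_prob bL bR) =
  n%:R^-1 * (\sum_x `|#|[pred i | tL i == x]|%:R - n%:R * type_prob bL x| +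
             \sum_x `|#|[pred i | tR i == x]|%:R - n%:R * type_prob bR x|).
Proof.
move=> n0; rewrite /type_dev.
have cE s x : #|[pred v | side_type tL tR v == (s, x)]| = #|[pred i | (if s then tR else tL) i == x]|.
  rewrite -(@card_image _ _ (fun i : 'I_n => (s, i))) => [|i j [] //]; apply: eq_card => -[t i].
  rewrite !inE /side_type xpair_eqE /=; apply/andP/imageP => [[/eqP -> e]|[j]].
    by exists i.
  by rewrite inE => e [-> ->].
have n0' : n%:R != 0 :> R by rewrite pnatr_eq0 -lt0n.
rewrite -(pair_bigA _ (fun s x => `|n%:R^-1 * #|[pred v | side_type tL tR v == (s, x)]|%:R
   - side_prob bL bR (s, x)|)) /= big_bool /= addrC mulrDr !mulr_sumr.
have e (a y : R) : `|n%:R^-1 * a - y| = n%:R^-1 * `|a - n%:R * y|.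
  by rewrite -[y in LHS](mulKf n0') -mulrBr normrM ger0_norm // invr_ge0.
by congr (_ + _); apply: eq_bigr => x _; rewrite cE e.
Qed.

(** Such a sequence is Cauchy. The centre [D] may vary with [eps], so no candidate for the limit is
    required. *)
Lemma cvg_of_window (u : R^nat) :
  (forall eps, 0 < eps -> exists D, exists N : nat, forall n, (N <= n)%N -> `|u n - D| <= eps) ->
  cvgn u.
Proof.
move=> hu; apply/cauchy_cvgP; apply: cauchy_exP => eps e0.
have e2 : 0 < eps / 2 by rewrite divr_gt0.
have [D [N hD]] := hu _ e2.
exists D; exists N => //= n Nn; rewrite -ball_normE /= distrC.
by apply: le_lt_trans (hD n Nn) _; rewrite ltr_pdivrMr // ltr_pMr // ltr1n.
Qed.

Lemma expected_matching_cvg (bL bR : R) (C : 'M[R]_2) : 0 <= bL <= 1 -> 0 <= bR <= 1 ->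
  (forall x y, 0 <= C x y) -> cvgn (fun n => expected_matching bL bR C n / n%:R).
Proof.
move=> bL01 bR01 C0; apply: cvg_of_window => eps e0.
pose cm : R := \sum_x \sum_y C x y.
have Ccm x y : C x y <= cm.
  rewrite /cm (bigD1 x) //= (bigD1 y) //= -addrA lerDl addr_ge0 // ?sumr_ge0 // => z _.
  by rewrite sumr_ge0.
have cm0 : 0 <= cm by apply: le_trans (C0 ord0 ord0) (Ccm _ _).
have rate0 s t : 0 <= side_rate C s t by rewrite /side_rate; case: s.1; case: t.1.
have ratecm s t : side_rate C s t <= cm by rewrite /side_rate; case: s.1; case: t.1.
have prob0 s : 0 <= side_prob bL bR s.
  rewrite /side_prob /type_prob; case: s.1; case: ifP => _.
  - by case/andP: bR01.
  - by rewrite subr_ge0; case/andP: bR01.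
  - by case/andP: bL01.
  - by rewrite subr_ge0; case/andP: bL01.
have [D [K [K0 hD]]] := matching_fraction_limit rate0 ratecm cm0 prob0 e0.
have [N1 [N10 hN1]] := archi_le cm.
have [N2 [N20 hN2]] := archi_le ((5 * K / eps) ^+ 2).
(* [D] approximates the number of covered vertices, two for each matching edge. [N1] makes the
   minimum with 1 in the edge probabilities inactive, and [N2] makes the error of order [Num.sqrt h]
   at most [eps]. *)
exists (D / 2), (N1 + N2)%N => n Nn.
have n0 : (0 < n)%N by apply: leq_trans Nn; rewrite addn_gt0 N10.
have nr : 0 < n%:R :> R by rewrite ltr0n.
have nr' := lt0r_neq0 nr.
have cmn : cm <= n%:R.
  by apply: le_trans hN1 _; rewrite ler_nat; apply: leq_trans Nn; apply: leq_addr.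
pose h : R := n%:R^-1.
have h0 : 0 < h by rewrite invr_gt0.
have lL := type_law_is_law n bL01; have lR := type_law_is_law n bR01.
rewrite expected_matchingE //.
pose M (tL tR : {ffun 'I_n -> 'I_2}) := Ex (edge_law (edge_probs C tL tR)) (fun w => (max_weight (wt w) set0)%:R).
have q (tL tR : {ffun 'I_n -> 'I_2}) : `|h * (2 * M tL tR) - D| <= eps + K * (Num.sqrt h + type_dev (side_type tL tR) h (side_prob bL bR)).
  have -> : 2 * M tL tR = Ex (edge_law (edge_probs C tL tR)) (fun w => (2 * max_weight (wt w) set0)%:R).
    by rewrite -ExZ; apply: eq_Ex => w; rewrite natrM.
  apply: hD => //.
  - exact/edge_law_is_law/edge_probs01.
  - by rewrite invf_le1 // ler1n.
  - by rewrite mulrC ler_pdivrMr // mul1r.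
  - by rewrite card_prod card_bool card_ord natrM mulrCA mulVf ?mulr1.
  - move=> [s i] [t j] _; rewrite edge_law_pair /side_rate /bern /side_type /= /edge_probs /edge_prob.
    have minE (x y : 'I_2) : Num.min 1 (C x y / n%:R) = h * C x y.
      rewrite (mulrC h); apply/min_idPr; rewrite ler_pdivrMr // mul1r; exact: le_trans (Ccm _ _) cmn.
    by case: s; case: t; rewrite ?mulr0 //= minE.
have -> : Ex (type_law bL) (fun tL => Ex (type_law bR) (fun tR => M tL tR)) / n%:R - D / 2 =
    2^-1 * Ex (type_law bL) (fun tL => Ex (type_law bR) (fun tR => h * (2 * M tL tR) - D)).
  under [in RHS]eq_Ex do rewrite ExB Ex_cst // ExZ ExZ.
  by rewrite ExB Ex_cst // ExZ ExZ /h; field.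
rewrite normrM ger0_norm ?invr_ge0 //.
have Edev : Ex (type_law bL) (fun tL : {ffun 'I_n -> 'I_2} => Ex (type_law bR) (fun tR : {ffun 'I_n -> 'I_2} =>
    type_dev (side_type tL tR) h (side_prob bL bR))) <= 4 * Num.sqrt h.
  have sh : h * Num.sqrt n%:R = Num.sqrt h.
    apply: (mulIf (x := Num.sqrt n%:R)); first by rewrite sqrtr_eq0 -ltNge.
    rewrite -mulrA -expr2 sqr_sqrtr ?ltW // -sqrtrM ?ltW // /h mulVf //.
    by rewrite sqrtr1.
  rewrite (@eq_Ex _ _ _ _ _ (fun tL : {ffun 'I_n -> 'I_2} => h * (\sum_x `|#|[pred i | tL i == x]|%:R - n%:R * type_prob bL x| +
     \sum_x Ex (type_law bR) (fun tR : {ffun 'I_n -> 'I_2} => `|#|[pred i | tR i == x]|%:R - n%:R * type_prob bR x|)))); last first.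
    move=> tL; rewrite (eq_Ex _ (fun tR => side_type_dev bL bR tL tR n0)).
    by rewrite ExZ ExD Ex_cst // Ex_sum.
  rewrite ExZ ExD Ex_cst // Ex_sum -/h -sh mulrCA; apply: ler_wpM2l; first exact: ltW.
  rewrite (_ : 4 * Num.sqrt n%:R = \sum_(x : 'I_2) Num.sqrt n%:R + \sum_(x : 'I_2) Num.sqrt n%:R); last first.
    by rewrite !sumr_const card_ord; ring.
  by apply: lerD; apply: ler_sum => x _; apply: Ex_type_count.
have avg : `|Ex (type_law bL) (fun tL => Ex (type_law bR) (fun tR => h * (2 * M tL tR) - D))| <=
    eps + K * (Num.sqrt h + 4 * Num.sqrt h).
  apply: le_trans (Ex_abs lL _) _.
  apply: le_trans (_ : Ex (type_law bL) (fun tL => Ex (type_law bR) (fun tR =>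
     eps + K * (Num.sqrt h + type_dev (side_type tL tR) h (side_prob bL bR)))) <= _).
    apply: Ex_le => // tL; apply: le_trans (Ex_abs lR _) _; exact: Ex_le.
  under eq_Ex do rewrite ExD Ex_cst // ExZ ExD Ex_cst //.
  rewrite ExD Ex_cst // ExZ ExD Ex_cst // lerD2l; apply: ler_wpM2l => //.
  by rewrite lerD2l.
have small : K * (Num.sqrt h + 4 * Num.sqrt h) <= eps.
  have -> : K * (Num.sqrt h + 4 * Num.sqrt h) = 5 * K * Num.sqrt h by ring.
  have K5 : 0 <= 5 * K / eps by rewrite divr_ge0 ?mulr_ge0 // ltW.
  have : 5 * K / eps <= Num.sqrt n%:R.
    rewrite -(ger0_norm K5) -sqrtr_sqr ler_wsqrtr //; apply: le_trans hN2 _.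
    by rewrite ler_nat; apply: leq_trans Nn; apply: leq_addl.
  rewrite ler_pdivrMr // => le; rewrite /h sqrtrV // ler_pdivrMr ?sqrtr_gt0 ?ltr0n //.
  by rewrite [leRHS]mulrC.
by move: avg small; lra.
Qed.

End Convergence.

(** * Adding vertices and balancing the two sides *)

Section UnweightedGraphs.
Variables (R : realType) (V : finType) (rho : {set V} -> 'I_2 -> R).
Hypothesis lrho : is_law rho.
Local Notation graph := {ffun {set V} -> 'I_2}.
Implicit Types (w : graph) (S X : {set V}) (u v : V).

Definition mu_match w S := max_weight (wt w) S.

Lemma gain01 w S v : (gain (wt w) S v <= 1)%N.
Proof. by apply: gain_le => e; rewrite -ltnS ltn_ord. Qed.

(** With weights 0 and 1, [gainE] allows a profit at [v] only through an edge to a vertex of gain 0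
    in the remaining graph; the product is the indicator that no such edge is present. *)
Lemma gain_eq0 w S v : v \notin S -> 1 - (gain (wt w) S v)%:R =
  \prod_(u | (u \notin v |: S) && (gain (wt w) (v |: S) u == 0%N)) (w [set v; u] == ord0)%:R :> R.
Proof.
move=> vS; have [g0|g0] := posnP (gain (wt w) S v).
  rewrite g0 subr0 big1 // => u /andP [uS /eqP gu].
  have : (wt w [set v; u] - gain (wt w) (v |: S) u <= gain (wt w) S v)%N.
    by rewrite [X in (_ <= X)%N]gainE //; apply: (bigop.bigmax_sup u).
  by rewrite gu subn0 g0 leqn0 => /eqP e; rewrite -val_eqE /= [nat_of_ord _]e.
have g1 : gain (wt w) S v = 1%N by apply/eqP; rewrite eqn_leq gain01.
rewrite g1 subrr; symmetry; move: g0; rewrite gainE // => g0.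
have [/existsP [u /andP [uS ltu]]|/existsPn no] :=
  boolP [exists u, (u \notin v |: S) && (gain (wt w) (v |: S) u < wt w [set v; u])%N].
  have w1 : wt w [set v; u] = 1%N.
    apply/eqP; rewrite eqn_leq; apply/andP; split; first by rewrite -ltnS ltn_ord.
    exact: leq_ltn_trans ltu.
  rewrite (bigD1 u) /=; last by rewrite uS; move: ltu; rewrite w1; case: gain.
  by rewrite -val_eqE /= [nat_of_ord _]w1 mul0r.
move: g0; rewrite ltnNge => /negP []; apply/bigmax_leqP => u uS.
by have := no u; rewrite uS /= -leqNgt leqn0 subn_eq0.
Qed.

(** The vertices of gain 0 in the graph without [v] are determined independently of the edges at
    [v], over which one may average first. *)
Lemma Ex_gain_cond S v (g : graph -> R) : v \notin S ->
  depends [set e : {set V} | v \notin e] g ->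
  Ex rho (fun w => (1 - (gain (wt w) S v)%:R) * g w) =
  Ex rho (fun w => (\prod_(u | (u \notin v |: S) && (gain (wt w) (v |: S) u == 0%N))
    rho [set v; u] ord0) * g w).
Proof.
move=> vS dg; rewrite (@Ex_merge _ _ _ _ [set e : {set V} | v \in e]) //; apply: eq_Ex => w.
have mm w' : {in [set e : {set V} | v \notin e], merge [set e : {set V} | v \in e] w' w =1 w}.
  by move=> e; rewrite inE ffunE inE => /negbTE ->.
have mE w' u : gain (wt (merge [set e : {set V} | v \in e] w' w)) (v |: S) u = gain (wt w) (v |: S) u.
  apply: gain_ext => e d; rewrite /wt mm // inE; apply: contraTN d => ve.
  by apply/pred0Pn; exists v; rewrite /= ve !inE eqxx.
rewrite (@eq_Ex _ _ _ _ _ (fun w' => (\prod_(u | (u \notin v |: S) && (gain (wt w) (v |: S) u == 0%N))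
    (w' [set v; u] == ord0)%:R) * g w)); last first.
  move=> w'; rewrite gain_eq0 // (dg _ _ (mm w')); congr (_ * _).
  by apply: eq_big => [u|u _]; rewrite ?mE // ffunE !inE ?eqxx.
rewrite ExZr; congr (_ * _).
rewrite (@Ex_prod _ _ _ rho _ (fun u => (u \notin v |: S) && (gain (wt w) (v |: S) u == 0%N))
  (fun u => [set v; u]) (fun u a => (a == ord0)%:R)) //; last first.
  move=> x y; rewrite -!topredE /= => /andP [xv _] /andP [yv _] /setP /(_ x).
  by move: xv; rewrite !inE eqxx orbT negb_or => /andP [/negbTE -> _] /esym /eqP.
apply: eq_bigr => u _; rewrite (bigD1 ord0) //= mulr1 big1 ?addr0 // => a /negbTE ->.
by rewrite mulr0.
Qed.

Lemma max_weight_le_card w S X : (mu_match w S <= mu_match w (S :|: X) + #|X|)%N.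
Proof.
have [k kX] := ubnP #|X|; elim: k X S kX => // k IH X S kX.
have [->|[x xX]] := set_0Vmem X; first by rewrite setU0 cards0 addn0.
have c1 : #|X| = #|X :\ x|.+1 by rewrite (cardsD1 x X) xX.
have := IH (X :\ x) (x |: S); rewrite -ltnS -c1 kX => /(_ isT).
have -> : (x |: S) :|: (X :\ x) = S :|: X by rewrite setUAC setD1K // setUC.
have := gainU (wt w) S x; have := gain01 w S x; rewrite /mu_match; lia.
Qed.

Lemma max_weight_upd w e a S : (mu_match (upd w e a) S <= mu_match w S + 1)%N.
Proof.
have [P mP eP] := max_weight_attained (wt (upd w e a)) S; rewrite /mu_match eP.
have [h1 h2] := matchingP _ _ _ mP.
have uE f : f \in P :\ e -> wt (upd w e a) f = wt w f.
  by rewrite !inE /wt ffunE => /andP [/negbTE ->].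
apply: leq_trans (_ : \sum_(f in P :\ e) wt w f + 1 <= _)%N.
  rewrite -(eq_bigr _ uE) addnC; have [eIP|nP] := boolP (e \in P).
    by rewrite (big_setD1 e eIP) /= leq_add2r -ltnS ltn_ord.
  have -> : P :\ e = P; last exact: leq_addl.
  by apply/setP => f; rewrite !inE; case: eqP => // ->; rewrite (negbTE nP).
rewrite leq_add2r; apply: le_max_weight; apply/matchingP; split.
  by move=> f f'; rewrite !inE => /andP [_ fP] /andP [_ fP']; apply: h1.
move=> f fP; have := h2 f; rewrite -uE //; apply; by move: fP; rewrite !inE => /andP [].
Qed.

(** A single edge changes the matching number by at most 1, so its variance is at most the expected
    number of edges. *)
Lemma matching_concentration S s : 0 < s ->
  Ex rho (fun w => `|(mu_match w S)%:R - Ex rho (fun w => (mu_match w S)%:R)|) <= (s + (\sum_e (1 - rho e ord0)) / s) / 2.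
Proof.
move=> s0; apply: le_trans (Ex_abs_le lrho _ s0) _.
rewrite ler_pM2r ?invr_gt0 // lerD2l ler_pM2r ?invr_gt0 //.
apply: (Ex_variance ord0 lrho) => w e a.
have back : upd (upd w e a) e (w e) = w.
  by apply/ffunP => f; rewrite !ffunE; case: eqP => [->|].
have le1 := max_weight_upd w e a S; have := max_weight_upd (upd w e a) e (w e) S.
rewrite back => le2; move: le1 le2; rewrite -!(ler_nat R) !natrD => le1 le2.
by rewrite ler_norml; apply/andP; split; lra.
Qed.

End UnweightedGraphs.

(** * Adding vertices with many potential neighbours *)

Section AddingVertices.
Variables (R : realType) (V : finType) (rho : {set V} -> 'I_2 -> R) (side : V -> bool).
Hypothesis lrho : is_law rho.
Local Notation graph := {ffun {set V} -> 'I_2}.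
Hypothesis bip : forall w : graph, (forall e, rho e (w e) != 0) ->
  forall u v, u != v -> (0 < wt w [set u; v])%N -> side u != side v.
Variables (q : R) (e0 : nat).
Hypotheses (q01 : 0 <= q <= 1).
Implicit Types (w : graph) (S X : {set V}) (u v : V).

Definition opposite b S := #|[set u | (side u != b) && (u \notin S)]|.

Lemma rho_le1 e a : rho e a <= 1.
Proof.
rewrite -(lrho.2 e) (bigD1 a) //= lerDl sumr_ge0 // => i _; exact: lrho.1.
Qed.

(* The vertices of one side that every maximum matching must cover are no more than its size,
   hence a new vertex with many potential neighbours increases the matching number. *)
Lemma add_one S v : v \notin S ->
  (forall u, side u != side v -> rho [set v; u] ord0 <= 1 - q) ->
  Ex rho (fun w => ((gain (wt w) S v == 0%N) &&
    (mu_match w (v |: S) < opposite (side v) S - e0)%N)%:R) <= (1 - q) ^+ e0.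
Proof.
move=> vS hq; have /andP [q0 q1] := q01.
pose g w : R := (mu_match w (v |: S) < opposite (side v) S - e0)%N%:R.
have dg : depends [set e : {set V} | v \notin e] g.
  move=> w w' ww; rewrite /g /mu_match (@max_weight_ext _ _ (wt w')) // => e d.
  rewrite /wt ww // inE; apply: contraTN d => ve.
  by apply/pred0Pn; exists v; rewrite /= ve !inE eqxx.
have -> : Ex rho (fun w => ((gain (wt w) S v == 0%N) &&
    (mu_match w (v |: S) < opposite (side v) S - e0)%N)%:R) =
    Ex rho (fun w => (1 - (gain (wt w) S v)%:R) * g w).
  apply: eq_Ex => w; rewrite /g -mulnb natrM; congr (_ * _).
  by have := gain01 w S v; case: (gain _ _ _) => [|[|]] //= _; rewrite ?subr0 ?subrr.
rewrite Ex_gain_cond // -[leRHS](Ex_cst lrho); apply: Ex_le_supp => // w sw.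
rewrite /g; case: ltnP => [lt|_]; last by rewrite mulr0 exprn_ge0 // subr_ge0.
rewrite mulr1.
apply: le_trans (_ : \prod_(u | (u \notin v |: S) && (gain (wt w) (v |: S) u == 0%N))
   (if side u != side v then 1 - q else 1) <= _).
  apply: ler_prod => u _; rewrite lrho.1 /=; case: ifP => [/hq //|_]; exact: rho_le1.
rewrite -big_mkcondr /= prodr_const -cardsE.
apply: ler_wiXn2l; rewrite ?subr_ge0 ?gerBl //.
have := card_gain_side (bip sw) (~~ side v) (v |: S); rewrite -/(mu_match w (v |: S)).
set A := [set u in _]; set B := [set u | _] => ge.
suff : (opposite (side v) S <= #|A| + #|B|)%N by lia.
apply: leq_trans (leq_card_setU _ _); apply/subset_leq_card/subsetP => u.
rewrite !inE => /andP [uv uS]; have su : side u == ~~ side v by case: (side u) uv; case: (side v).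
have euv : (u == v) = false by apply: contraNF uv => /eqP ->.
rewrite [X in X || _]unfold_in /= !inE su euv (negbTE uS) uv /= andbT.
by case: gain.
Qed.

Lemma nat_add_step (a m k cp g : nat) : (g <= 1)%N ->
  (minn (a + k.+1) cp - (g + m) <= minn (a + k) cp - m + ((g == 0) && (m < cp)))%N.
Proof. by case: g => [|[|]] //= _; case: ltnP; lia. Qed.

(** The truncated difference is the shortfall from gaining one per vertex up to the cap. When the
    vertices are added one at a time, it grows only if a vertex gains nothing below the cap, which
    [add_one] makes unlikely. *)
Lemma add_set b S X : [disjoint S & X] -> {in X, forall x, side x = b} ->
  (forall u v, side u != side v -> v \in X -> rho [set v; u] ord0 <= 1 - q) ->
  Ex rho (fun w => (minn (mu_match w (S :|: X) + #|X|) (opposite b S - e0) - mu_match w S)%N%:R)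
  <= #|X|%:R * (1 - q) ^+ e0.
Proof.
have [k kX] := ubnP #|X|; elim: k X S kX => // k IH X S kX dSX Xb hq.
have [->|[x xX]] := set_0Vmem X.
  rewrite setU0 cards0 mul0r (@eq_Ex _ _ _ _ _ (fun=> 0)) ?Ex_cst // => w.
  by rewrite addn0 (eqP (_ : _ - _ == 0)%N) // subn_eq0 geq_minl.
have xS : x \notin S by apply/negP => xS; move/pred0P: dSX => /(_ x); rewrite /= xS xX.
have cX : #|X| = #|X :\ x|.+1 by rewrite (cardsD1 x X) xX.
have SX : (x |: S) :|: (X :\ x) = S :|: X by rewrite setUAC setD1K // setUC.
have oS : opposite b (x |: S) = opposite b S.
  apply: eq_card => u; rewrite !inE negb_or; case: eqP => //= /eqP ub; rewrite -(Xb x xX) in ub.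
  by have -> : u != x by apply: contraNN ub => /eqP ->.
have IHx := IH (X :\ x) (x |: S); rewrite SX oS in IHx.
apply: le_trans (_ : Ex rho (fun w =>
   (minn (mu_match w (S :|: X) + #|X :\ x|) (opposite b S - e0) - mu_match w (x |: S))%N%:R +
   ((gain (wt w) S x == 0%N) && (mu_match w (x |: S) < opposite b S - e0)%N)%:R) <= _).
  apply: Ex_le => // w; rewrite -natrD ler_nat cX.
  rewrite [X in (_ - X <= _)%N](gainU (wt w) S x); apply: nat_add_step; exact: gain01.
rewrite ExD cX -natr1 mulrDl mul1r; apply: lerD.
  apply: IHx.
  - by rewrite -ltnS -cX.
  - apply/pred0P => u /=; rewrite !inE; apply/negP => /andP [/orP [/eqP ->|uS] /andP [ux uX]].
      by rewrite eqxx in ux.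
    by move/pred0P: dSX => /(_ u); rewrite /= uS uX.
  - by move=> u; rewrite inE => /andP [_]; apply: Xb.
  - by move=> u v uv; rewrite inE => /andP [_]; apply: hq.
by have := @add_one S x xS; rewrite (Xb x xX); apply => u ub; apply: hq => //; rewrite (Xb x xX).
Qed.

End AddingVertices.

(** * Balanced against unbalanced uniform bipartite graphs *)

Section Balance.
Variables (R : realType) (n : nat) (p : R).
Hypothesis p01 : 0 <= p <= 1.
Local Notation V := (bool * 'I_n)%type.
Local Notation graph := {ffun {set V} -> 'I_2}.
Implicit Types (w : graph) (S X : {set V}) (u v : V).

Definition unif_law : {set V} -> 'I_2 -> R := edge_law (fun _ _ => p).

Let lrho : is_law unif_law.
Proof. by apply: edge_law_is_law. Qed.

Let p0 : 0 <= p. Proof. by case/andP: p01. Qed.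
Let q0 : 0 <= 1 - p. Proof. by rewrite subr_ge0; case/andP: p01. Qed.
Let q1 : 1 - p <= 1. Proof. by rewrite gerBl. Qed.

(** Gain 0 means that some maximum matching misses the vertex. *)
Definition free b w S := [set u : V | [&& u.1 == b, u \notin S & gain (wt w) S u == 0%N]].

Definition mean_match S : R := Ex unif_law (fun w => (mu_match w S)%:R).

Lemma unif_law_pair u v : unif_law [set u; v] ord0 = if u.1 != v.1 then 1 - p else 1.
Proof.
by rewrite /unif_law edge_law_pair /bern /=; case: u.1; case: v.1; rewrite /= ?subr0.
Qed.

(** A new vertex increases the matching number iff it is joined to a free vertex of the other side,
    and the free set is independent of its edges. *)
Lemma mean_match_add S v : v \notin S ->
  mean_match S - mean_match (v |: S) =
  1 - Ex unif_law (fun w => (1 - p) ^+ #|free (~~ v.1) w (v |: S)|).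
Proof.
move=> vS; rewrite /mean_match -ExB.
have := @Ex_gain_cond R V unif_law lrho S v (fun=> 1) vS (fun _ _ _ => erefl).
rewrite /= (eq_Ex _ (fun w => mulr1 (1 - (gain (wt w) S v)%:R))) ExB Ex_cst // => e.
have -> : Ex unif_law (fun w => (mu_match w S)%:R - (mu_match w (v |: S))%:R) =
    Ex unif_law (fun w => (gain (wt w) S v)%:R).
  by apply: eq_Ex => w; rewrite /mu_match (gainU (wt w) S v) natrD addrK.
rewrite -[LHS](subKr 1) e; congr (1 - _); apply: eq_Ex => w; rewrite mulr1.
under eq_bigr do rewrite unif_law_pair.
rewrite -big_mkcondr /= prodr_const; congr (_ ^+ _); apply: eq_card => u.
rewrite !inE [LHS]unfold_in /= !inE [v.1 == _]eq_sym.
by case: u.1; case: v.1; rewrite /= ?andbT ?andbF.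
Qed.

Lemma bernoulli_decay k : (1 - p) ^+ k * (1 + p * k%:R) <= 1.
Proof.
elim: k => [|k IH]; first by rewrite expr0 mulr0 addr0 mulr1.
apply: le_trans IH; rewrite exprSr -mulrA; apply: ler_wpM2l; first exact: exprn_ge0.
have -> : (1 - p) * (1 + p * k.+1%:R) = 1 + p * k%:R - p ^+ 2 * k.+1%:R by rewrite -natr1; ring.
by rewrite gerBl mulr_ge0 // exprn_ge0.
Qed.

(** A bound linear in [k] is needed in order to take expectations; for [p] of order [1 / n] its
    slope is of order [1 / n] too. *)
Lemma one_sub_pow k : (k <= n)%N -> p * k%:R / (1 + p * n%:R) <= 1 - (1 - p) ^+ k.
Proof.
move=> kn; have pk : 0 <= p * k%:R by rewrite mulr_ge0.
have pkn : p * k%:R <= p * n%:R by rewrite ler_wpM2l // ler_nat.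
have k1 : 0 < 1 + p * k%:R by rewrite ltr_pwDl.
have n1 : 0 < 1 + p * n%:R by apply: lt_le_trans k1 _; rewrite lerD2l.
apply: le_trans (_ : p * k%:R / (1 + p * k%:R) <= _).
  by apply: ler_wpM2l => //; rewrite lef_pV2 ?posrE // lerD2l.
rewrite ler_pdivrMr // mulrBl mul1r; have := bernoulli_decay k; lra.
Qed.

(* Deleting [cutset l r] leaves [l] left and [r] right vertices. *)
Definition cutset (l r : nat) := [set v : V | ((if v.1 then r else l) <= v.2)%N].

Lemma in_cutset l r v : (v \in cutset l r) = ((if v.1 then r else l) <= v.2)%N.
Proof. by rewrite inE. Qed.

Definition flip (v : V) : V := (~~ v.1, v.2).

Lemma flipK : involutive flip. Proof. by case=> s i; rewrite /flip negbK. Qed.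

Lemma flip_cutset l : flip @: cutset l l = cutset l l.
Proof.
apply/setP => v; apply/imsetP/idP => [[u]|vS].
  by rewrite !in_cutset !if_same => ul ->.
by exists (flip v); rewrite ?flipK // in_cutset !if_same; move: vS; rewrite in_cutset if_same.
Qed.

Lemma ends_exP (e : {set V}) : reflect (exists u v : V, u.1 != v.1 /\ e = [set u; v])
  [exists q : 'I_n * 'I_n, ends q == e].
Proof.
apply: (iffP existsP) => [[q /eqP <-]|[[s i] [[t j] [st ->]]]].
  by exists (false, q.1), (true, q.2).
by case: s st; case: t => // _; [exists (j, i); rewrite setUC|exists (i, j)].
Qed.

Lemma unif_law_imset (f : V -> V) (e : {set V}) : (forall u v, ((f u).1 != (f v).1) = (u.1 != v.1)) ->
  injective f -> unif_law (f @: e) =1 unif_law e.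
Proof.
move=> fs fI a; have unifE d : unif_law d a = bern (if [exists q : 'I_n * 'I_n, ends q == d] then p else 0) a.
  rewrite /unif_law /edge_law; case: pickP => [q eq|no].
    by rewrite (_ : [exists q, _]) //; apply/existsP; exists q.
  by rewrite (_ : [exists q, _] = false) //; apply/existsP => -[q]; rewrite no.
rewrite !unifE (_ : [exists q : 'I_n * 'I_n, ends q == f @: e] = [exists q : 'I_n * 'I_n, ends q == e]) //.
have fe (d : {set V}) u v : d = [set u; v] -> f @: d = [set f u; f v] by move=> ->; rewrite imsetU1 imset_set1.
apply/ends_exP/ends_exP => -[u [v [uv ee]]]; last first.
  by exists (f u), (f v); rewrite fs (fe _ _ _ ee).
have [g fK gK] := injF_bij fI.
exists (g u), (g v); rewrite -fs !gK; split=> //.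
by apply: (imset_inj fI); rewrite ee (fe _ _ _ erefl) !gK.
Qed.

Lemma Ex_relabel (f : V -> V) (F : graph -> R) :
  (forall u v, ((f u).1 != (f v).1) = (u.1 != v.1)) -> injective f ->
  Ex unif_law (fun w => F [ffun e : {set V} => w (f @: e)]) = Ex unif_law F.
Proof.
move=> fs fI; apply: (@Ex_inj_variable R {set V} 'I_2 unif_law (fun e : {set V} => f @: e)) => //.
  exact: imset_inj.
by move=> e; apply: unif_law_imset.
Qed.

Lemma wt_relabel (f : V -> V) w : wt [ffun e : {set V} => w (f @: e)] = (fun e => wt w (f @: e)).
Proof. by apply/funext => e; rewrite /wt ffunE. Qed.

Lemma mean_match_relabel (f : V -> V) S :
  (forall u v, ((f u).1 != (f v).1) = (u.1 != v.1)) -> injective f ->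
  mean_match (f @: S) = mean_match S.
Proof.
move=> fs fI; rewrite {2}/mean_match -(Ex_relabel _ fs fI); apply: eq_Ex => w.
by rewrite /mu_match wt_relabel max_weight_imset.
Qed.

Lemma free_flip w l : #|free true [ffun e : {set V} => w (flip @: e)] (cutset l l)| =
  #|free false w (cutset l l)|.
Proof.
rewrite -(card_imset _ (inv_inj flipK)); apply: eq_card => v; apply/imsetP/idP => [[u]|].
  rewrite !inE wt_relabel gain_imset ?flip_cutset; last exact: inv_inj flipK.
  move=> /and3P [/eqP u1 uS gu] ->; rewrite /= u1 eqxx /= gu andbT.
  by rewrite !if_same in uS *.
rewrite inE => /and3P [/eqP v1 vS gv]; exists (flip v); rewrite ?flipK // inE wt_relabel.
rewrite gain_imset ?flip_cutset ?flipK /= ?v1 ?gv ?andbT //; last exact: inv_inj flipK.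
by move: vS; rewrite !in_cutset !if_same.
Qed.

Lemma isolated_mean (u : V) :
  (1 - p) ^+ n <= Ex unif_law (fun w => [forall x, (x != u) ==> (w [set u; x] == ord0)]%:R).
Proof.
rewrite (@eq_Ex _ _ _ _ _ (fun w => \prod_(x | x != u) (w [set u; x] == ord0)%:R)) => [|w]; last first.
  have [/forallP iso|/forallPn [x]] := boolP [forall x, (x != u) ==> (w [set u; x] == ord0)].
    by rewrite big1 // => x xu; have := iso x; rewrite xu /= => ->.
  by rewrite negb_imply => /andP [xu /negbTE wx]; rewrite (bigD1 x) //= wx mul0r.
rewrite (@Ex_prod _ _ _ unif_law _ (fun x => x != u) (fun x => [set u; x]) (fun x a => (a == ord0)%:R)) //; last first.
  move=> x y; rewrite -!topredE /= => xu yu /setP /(_ x).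
  by rewrite !inE eqxx orbT (negbTE xu) => /esym /eqP.
rewrite (eq_bigr (fun x : V => if u.1 != x.1 then 1 - p else 1)) => [|x xu]; last first.
  rewrite (bigD1 ord0) //= mulr1 big1 ?addr0 ?unif_law_pair // => a /negbTE ->.
  by rewrite mulr0.
rewrite -big_mkcondr /= prodr_const; apply: ler_wiXn2l => //.
rewrite -[leqRHS]card_ord -(@card_image _ _ (fun i : 'I_n => (~~ u.1, i))) => [|i j [] //].
apply/subset_leq_card/subsetP => x; rewrite -topredE /= => /andP [_ ux].
apply/imageP; exists x.2 => //; case: x ux => s i /=; by case: s; case: u.1.
Qed.

Lemma Ex_bip w : (forall e, unif_law e (w e) != 0) ->
  forall u v, u != v -> (0 < wt w [set u; v])%N -> u.1 != v.1.
Proof. exact: edge_law_bip. Qed.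

(** One power bounds [(1 - p) ^+ #|free|] from below, the other the probability of being isolated;
    the last factor is the slope in [one_sub_pow]. *)
Definition step_gain : R := (1 - p) ^+ n * ((1 - p) ^+ n * (p / (1 + p * n%:R))).

Lemma step_gain_ge0 : 0 <= step_gain.
Proof. by rewrite !mulr_ge0 ?exprn_ge0 // invr_ge0 addr_ge0 // mulr_ge0. Qed.

Lemma balance_gain l r : (l <= r)%N -> (r < n)%N ->
  step_gain * (r - l)%:R <= mean_match (cutset l.+1 r) - mean_match (cutset l r.+1).
Proof.
move=> lr rn; have ln : (l < n)%N by apply: leq_ltn_trans rn.
pose vl : V := (false, Ordinal ln); pose vr : V := (true, Ordinal rn).
have eL : vl |: cutset l.+1 r = cutset l r.
  apply/setP => -[s i]; rewrite !inE xpair_eqE; case: s => //=.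
  by rewrite -val_eqE /= [RHS]leq_eqVlt eq_sym.
have eR : vr |: cutset l r.+1 = cutset l r.
  apply/setP => -[s i]; rewrite !inE xpair_eqE; case: s => //=.
  by rewrite -val_eqE /= [RHS]leq_eqVlt eq_sym.
have := @mean_match_add (cutset l.+1 r) vl; rewrite eL in_cutset /= ltnn => /(_ isT) hL.
have := @mean_match_add (cutset l r.+1) vr; rewrite eR in_cutset /= ltnn => /(_ isT) hR.
have -> : mean_match (cutset l.+1 r) - mean_match (cutset l r.+1) =
  Ex unif_law (fun w => (1 - p) ^+ #|free false w (cutset l r)|) -
  Ex unif_law (fun w => (1 - p) ^+ #|free true w (cutset l r)|) by move: hL hR; lra.
(* These right vertices have indices from [l] up to [r]: deleted in the balanced graph, present in
   the larger one, and free there because they are isolated. *)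
pose iso w := [set u : V | [&& u.1, u \notin cutset l r, u \in cutset l l &
   [forall x, (x != u) ==> (w [set u; x] == ord0)]]].
have sub : cutset l r \subset cutset l l.
  by apply/subsetP => v; rewrite !in_cutset if_same; case: v.1 => //; apply: leq_trans.
have side_of y : y \in cutset l l -> y \notin cutset l r -> y.1 = true.
  by rewrite !in_cutset if_same; case: y.1 => // ->.
have lo : Ex unif_law (fun w => (1 - p) ^+ #|free false w (cutset l l)|) <=
    Ex unif_law (fun w => (1 - p) ^+ #|free false w (cutset l r)|).
  apply: Ex_le_supp => // w sw; apply: ler_wiXn2l => //; apply/subset_leq_card/subsetP => v.
  rewrite !inE -!in_cutset => /and3P [/eqP v1 vS gv]; rewrite v1 eqxx /=.
  have vS' : v \notin cutset l l by move: vS; rewrite !in_cutset v1.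
  rewrite vS' /=; have := gain_side (Ex_bip sw) sub vS' side_of; rewrite v1 /= (eqP gv).
  by rewrite leqn0.
have up : Ex unif_law (fun w => (1 - p) ^+ #|free true w (cutset l r)|) <=
    Ex unif_law (fun w => (1 - p) ^+ (#|free true w (cutset l l)| + #|iso w|)).
  apply: Ex_le_supp => // w sw; apply: ler_wiXn2l => //.
  have dj : free true w (cutset l l) :&: iso w = set0.
    apply/setP => v; rewrite !inE -!in_cutset; apply/negP => /andP [/and3P [_ h1 _] /and4P [_ _ h2 _]].
    by rewrite h2 in h1.
  have := cardsUI (free true w (cutset l l)) (iso w); rewrite dj cards0 addn0 => <-.
  apply/subset_leq_card/subsetP => v; rewrite !inE -!in_cutset => /orP [].
    move=> /and3P [/eqP v1 vS gv]; rewrite v1 eqxx /=.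
    have vS' : v \notin cutset l r by apply: contraNN vS; apply: (subsetP sub).
    rewrite vS' /=; have := gain_side (Ex_bip sw) sub vS side_of; rewrite v1 /= (eqP gv).
    by rewrite leqn0.
  move=> /and4P [-> vS _ /forallP hv] /=; rewrite vS /= gainE // -leqn0.
  apply/bigmax_leqP => u; rewrite in_setU1 negb_or => /andP [uv _].
  by have := hv u; rewrite uv /wt /= => /eqP ->.
(* Exchanging the two sides preserves the law of the balanced graph. *)
have sw : Ex unif_law (fun w => (1 - p) ^+ #|free true w (cutset l l)|) =
    Ex unif_law (fun w => (1 - p) ^+ #|free false w (cutset l l)|).
  rewrite -(@Ex_relabel flip) => [|u v|]; last exact: inv_inj flipK.
    by apply: eq_Ex => w; rewrite free_flip.
  by rewrite /= (inj_eq negb_inj).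
apply: le_trans (lerB lo up); rewrite -sw -ExB.
have cn b w S : (#|free b w S| <= n)%N.
  rewrite -[leqRHS]card_ord -(@card_image _ _ (fun i : 'I_n => (b, i))) => [|i j [] //].
  apply/subset_leq_card/subsetP => -[s i]; rewrite inE => /and3P [/eqP /= -> _ _].
  by apply/imageP; exists i.
have in_ w : (#|iso w| <= n)%N.
  rewrite -[leqRHS]card_ord -(@card_image _ _ (fun i : 'I_n => (true, i))) => [|i j [] //].
  apply/subset_leq_card/subsetP => -[s i]; rewrite inE /= => /and4P [-> _ _ _].
  by apply/imageP; exists i.
have pp : 0 <= p / (1 + p * n%:R) by rewrite mulr_ge0 // invr_ge0 addr_ge0 // mulr_ge0.
apply: le_trans (Ex_le lrho (f := fun w => (1 - p) ^+ n * (p / (1 + p * n%:R)) * #|iso w|%:R) _); last first.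
  move=> w; rewrite exprD -[X in X - _]mulr1 -mulrBr -mulrA.
  apply: ler_pM; [exact: exprn_ge0|exact: mulr_ge0|exact: ler_wiXn2l|].
  by rewrite mulrAC one_sub_pow.
rewrite ExZ /step_gain (_ : (1 - p) ^+ n * ((1 - p) ^+ n * _) * (r - l)%:R =
  (1 - p) ^+ n * (p / (1 + p * n%:R)) * ((r - l)%:R * (1 - p) ^+ n)); last by ring.
apply: ler_wpM2l; first by rewrite mulr_ge0 // exprn_ge0.
have isoE w : #|iso w|%:R = \sum_(u : V | [&& u.1, u \notin cutset l r & u \in cutset l l])
   [forall x, (x != u) ==> (w [set u; x] == ord0)]%:R :> R.
  rewrite -natr_sum -big_mkcondr /= sum1_card; congr _%:R; apply: eq_card => u.
  by rewrite !inE [RHS]unfold_in /= !inE -!andbA.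
rewrite (eq_Ex _ isoE) Ex_sum.
apply: le_trans (ler_sum _ (fun u _ => isolated_mean u)).
rewrite sumr_const -[_ *+ _ in leRHS]mulr_natl; apply: ler_wpM2r; first exact: exprn_ge0.
rewrite ler_nat -[leqLHS]card_ord.
have lk (k : 'I_(r - l)) : (l + k < n)%N.
  by apply: (leq_trans _ rn); rewrite ltnS ltnW // -ltn_subRL ltn_ord.
rewrite -(@card_image _ _ (fun k : 'I_(r - l) => (true, Ordinal (lk k)))); last first.
  by move=> i j [] /addnI /val_inj.
apply/subset_leq_card/subsetP => x /imageP [k _ ->].
rewrite -topredE /= !in_cutset /= leq_addr andbT -ltnNge.
by have := ltn_ord k; rewrite ltn_subRL.
Qed.

End Balance.

(** * One-sided versus two-sided allocation *)

Lemma chain_step (b j : nat) : (j < b)%N ->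
  (j.+1 * (2 * b - j.+1) = j * (2 * b - j) + (2 * b - 2 * j - 1))%N.
Proof.
move=> jb; have [d ->] : exists d, b = (j.+1 + d)%N by exists (b - j.+1)%N; rewrite subnKC.
have -> : (2 * (j.+1 + d) - j.+1 = j.+1 + 2 * d)%N by lia.
have -> : (2 * (j.+1 + d) - j = j.+2 + 2 * d)%N by lia.
have -> : (2 * (j.+1 + d) - 2 * j - 1 = 1 + 2 * d)%N by lia.
by lia.
Qed.

Lemma two_phase_min (m0 m1 m2 l r n e : nat) : (r <= n)%N ->
  (minn (m0 + (l + r)) (n - e) <= m2 +
    (minn (m1 + r) (n - e) - m2 + (minn (m0 + l) (n - r - e) - m1)))%N.
Proof. lia. Qed.

Lemma interval_lt (x b b' : nat) : (x < b -> b' <= x -> b' <= x < b' + (b - b'))%N.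
Proof. by move=> h1 h2; apply/andP; split => //; lia. Qed.

(** * Bounds for fixed node types *)

Section Quenched.
Variables (R : realType) (n : nat) (p : R).
Hypothesis p01 : 0 <= p <= 1.
Local Notation V := (bool * 'I_n)%type.
Local Notation graph := {ffun {set V} -> 'I_2}.
Implicit Types (w : graph) (S X : {set V}) (u v : V).

(** Vertices are moved one by one from the larger side to the smaller; the differences
    [2 * b - 2 * j - 1] entering [balance_gain] add up to [b * b]. *)
Lemma balance_chain b : (2 * b <= n)%N ->
  mean_match p (cutset n (n - 2 * b) n) + step_gain n p * (b * b)%:R <=
  mean_match p (cutset n (n - b) (n - b)).
Proof.
move=> bn; have g0 := step_gain_ge0 n p01.
have claim j : (j <= b)%N -> mean_match p (cutset n (n - 2 * b) n) + step_gain n p * (j * (2 * b - j))%:R <=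
    mean_match p (cutset n (n - 2 * b + j) (n - j)).
  elim: j => [|j IH] jb; first by rewrite mul0n mulr0 addr0 addn0 subn0.
  have lr : (n - 2 * b + j <= n - j.+1)%N by lia.
  have rn : (n - j.+1 < n)%N by lia.
  have := balance_gain p01 lr rn.
  rewrite addnS (_ : (n - j.+1).+1 = (n - j)%N); last by lia.
  have -> : (n - j.+1 - (n - 2 * b + j) = 2 * b - 2 * j - 1)%N by lia.
  have := IH (ltnW jb).
  have -> : (j.+1 * (2 * b - j.+1) = j * (2 * b - j) + (2 * b - 2 * j - 1))%N by apply: chain_step.
  rewrite natrD mulrDr; lra.
have e1 : (n - 2 * b + b = n - b)%N by lia.
have e2 : (2 * b - b = b)%N by rewrite mul2n -addnn addnK.
by have := claim b (leqnn b); rewrite e1 e2.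
Qed.

(** Listing the complement of [A] first sends [A] to the top indices. This reduces every deleted set
    to a [cutset], since under the uniform law only the numbers of deleted vertices matter. *)
Lemma sort_set (A : {set 'I_n}) : exists f : 'I_n -> 'I_n, injective f /\
  f @: A = [set i : 'I_n | (n - #|A| <= i)%N].
Proof.
pose s := enum (~: A) ++ enum A.
have cA : (#|~: A| = n - #|A|)%N by rewrite cardsCs setCK card_ord.
have sz : size s = n by rewrite size_cat -!cardE cA subnK // -[leqRHS]card_ord max_card.
have ms i : i \in s by rewrite mem_cat !mem_enum inE orNb.
have lt i : (index i s < n)%N by rewrite -[X in (_ < X)%N]sz index_mem.
exists (fun i => Ordinal (lt i)).
have fI : injective (fun i => Ordinal (lt i)).
  by move=> i j /(congr1 val) /= e; rewrite -(nth_index i (ms i)) e nth_index.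
split => //; apply/eqP; rewrite eqEcard; apply/andP; split.
  apply/subsetP => _ /imsetP [i iA ->]; rewrite inE /= index_cat mem_enum inE iA /=.
  by rewrite -cardE cA leq_addr.
rewrite card_imset // (_ : [set i : 'I_n | _] = ~: [set i : 'I_n | (i < n - #|A|)%N]); last first.
  by apply/setP => i; rewrite !inE -leqNgt.
rewrite cardsCs setCK card_ord leq_subCl.
have le : (n - #|A| <= n)%N by exact: leq_subr.
rewrite -[leqLHS]card_ord -(@card_image _ _ (widen_ord le)) => [|i j e]; last by apply: val_inj; case: e.
by apply/subset_leq_card/subsetP => _ /imageP [i _ ->]; rewrite inE /=.
Qed.

Definition part b S := [set i : 'I_n | (b, i) \in S].

Lemma mean_match_counts S :
  mean_match p S = mean_match p (cutset n (n - #|part false S|) (n - #|part true S|)).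
Proof.
have [f0 [i0 e0]] := sort_set (part false S); have [f1 [i1 e1]] := sort_set (part true S).
pose f (v : V) : V := (v.1, if v.1 then f1 v.2 else f0 v.2).
have fI : injective f.
  by move=> [s i] [t j] [<-]; case: s => [/i1|/i0] ->.
rewrite -(mean_match_relabel p01 S _ fI) //; congr (mean_match p _).
apply/setP => -[s i]; rewrite in_cutset /=.
have -> : ((s, i) \in f @: S) = (i \in (if s then f1 else f0) @: part s S).
  apply/imsetP/imsetP => [[[t j] vS [-> ->]]|[j]].
    by exists j; rewrite ?inE //; case: t {vS}.
  by rewrite inE => jS ->; exists (s, j) => //; case: s {jS}.
by case: s; rewrite ?e0 ?e1 inE.
Qed.

Lemma card_interval X b a k :
  (forall v, v \in X -> v.1 = b /\ (a <= v.2 < a + k)%N) -> (#|X| <= k)%N.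
Proof.
move=> hX; rewrite cardE -(size_map (fun v : V => val v.2)) -[leqRHS](size_iota a).
apply: uniq_leq_size.
  rewrite map_inj_in_uniq ?enum_uniq // => -[s i] [t j]; rewrite !mem_enum => /hX [/= -> _] /hX [/= -> _].
  by move=> /val_inj ->.
by move=> x /mapP [v]; rewrite mem_enum => /hX [_ h] ->; rewrite mem_iota.
Qed.

Lemma mean_match_lip a b a' b' :
  mean_match p (cutset n a b) <= mean_match p (cutset n a' b') + ((a - a') + (b - b'))%N%:R.
Proof.
have lr : is_law (unif_law (n := n) p) by apply: edge_law_is_law.
rewrite /mean_match -[X in _ + X](Ex_cst lr) -ExD; apply: Ex_le => // w.
rewrite -natrD ler_nat.
pose X := cutset n a' b' :\: cutset n a b.
apply: leq_trans (max_weight_le_card w _ X) _; apply: leq_add.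
  apply: max_weight_anti; apply/subsetP => v vS; rewrite !inE -!in_cutset.
  by rewrite vS andbT orbN.
rewrite (_ : X = (X :&: [set v | ~~ v.1]) :|: (X :&: [set v | v.1])); last first.
  by apply/setP => v; rewrite !inE; case: v.1; rewrite /= ?andbT ?andbF ?orbF.
apply: leq_trans (leq_card_setU _ _) _; apply: leq_add.
  apply: (@card_interval _ false a') => v; rewrite !inE; case: v.1 => /=; rewrite ?andbF // andbT.
  by rewrite -ltnNge => /andP [va av]; split => //; apply: interval_lt.
apply: (@card_interval _ true b') => v; rewrite !inE; case: v.1 => /=; rewrite ?andbF // andbT.
by rewrite -ltnNge => /andP [va av]; split => //; apply: interval_lt.
Qed.

Section Flexible.
Variables (pr : 'I_n -> 'I_n -> R) (FL FR : {set 'I_n}).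
Hypothesis pr01 : forall i j, 0 <= pr i j <= 1.
Hypothesis pr_reg : forall i j, i \notin FL -> j \notin FR -> pr i j = p.

Definition flex := [set v : V | v.2 \in (if v.1 then FR else FL)].

Let lpr : is_law (edge_law pr). Proof. exact: edge_law_is_law. Qed.
Let lunif : is_law (unif_law (n := n) p). Proof. exact: edge_law_is_law. Qed.

Lemma card_side (s : bool) (A : {set 'I_n}) : #|[set v : V | (v.1 == s) && (v.2 \in A)]| = #|A|.
Proof.
rewrite -(card_imset _ (f := fun i : 'I_n => (s, i))) => [|i j [] //]; apply: eq_card => -[t i].
rewrite inE /=; apply/andP/imsetP => [[/eqP -> iA]|[j jA [-> ->]]]; last by rewrite eqxx.
by exists i.
Qed.

(** After deletion of the flexible vertices, every remaining pair has edge probability [p] under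
    both laws. *)
Lemma Ex_flex (f : nat -> R) :
  Ex (edge_law pr) (fun w => f (mu_match w flex)) = Ex (unif_law p) (fun w => f (mu_match w flex)).
Proof.
apply: (@Ex_agree _ _ _ _ _ [set e : {set V} | [disjoint e & flex]]) => //.
  move=> e; rewrite inE => d; rewrite /unif_law /edge_law; congr bern.
  case: pickP => // -[i j] /eqP eq; rewrite pr_reg //=.
    by move/pred0P: d => /(_ (false, i)); rewrite -eq /= in_ends /= eqxx inE /= => /negbT.
  by move/pred0P: d => /(_ (true, j)); rewrite -eq /= in_ends /= eqxx inE /= => /negbT.
move=> w w' ww; congr f; apply: max_weight_ext => e d; by rewrite /wt ww // inE.
Qed.

Lemma mean_flex : mean_match p flex = mean_match p (cutset n (n - #|FL|) (n - #|FR|)).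
Proof.
have e0 : #|part false flex| = #|FL| by apply: eq_card => i; rewrite !inE.
have e1 : #|part true flex| = #|FR| by apply: eq_card => i; rewrite !inE.
by rewrite (mean_match_counts flex) e0 e1.
Qed.

Lemma card_flex : #|flex| = (#|FL| + #|FR|)%N.
Proof.
rewrite -(card_side false FL) -(card_side true FR) -cardsUI.
rewrite (_ : _ :&: _ = set0) ?cards0 ?addn0; last first.
  by apply/setP => v; rewrite !inE; case: v.1; rewrite /= ?andbF.
by apply: eq_card => v; rewrite !inE; case: v.1; rewrite /= ?orbF.
Qed.

Lemma flexible_upper : Ex (edge_law pr) (fun w => (mu_match w set0)%:R) <=
  (#|FL| + #|FR|)%:R + mean_match p (cutset n (n - #|FL|) (n - #|FR|)).
Proof.
rewrite -mean_flex /mean_match -(Ex_flex (fun k => k%:R)) -(Ex_cst lpr (_ + _)%:R) -ExD.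
apply: Ex_le => // w; rewrite -natrD ler_nat -card_flex addnC.
by have := max_weight_le_card w set0 flex; rewrite set0U.
Qed.

Lemma unif_mass : \sum_(e : {set V}) (1 - unif_law p e ord0) <= p * (n * n)%:R.
Proof.
have p0 : 0 <= p by case/andP: p01.
apply: le_trans (_ : \sum_(e in [set ends q | q : 'I_n * 'I_n]) p <= _).
  rewrite [leRHS]big_mkcond /=; apply: ler_sum => e _; rewrite /unif_law /edge_law /bern /= opprB addrCA subrr addr0.
  by case: pickP => [q /eqP <-|no]; [rewrite imset_f|case: ifP].
rewrite sumr_const card_imset; last exact: ends_inj.
by rewrite card_prod card_ord -[_ *+ _ in leLHS]mulr_natr.
Qed.

(** The flexible left vertices are added first, against the [n - #|FR|] regular right ones, then the
    flexible right vertices; the caps of the two phases combine to [n - e0]. The last subtracted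
    term pays for moving the expectation inside the minimum. *)
Lemma flexible_lower (q s : R) (e0 : nat) : 0 <= q <= 1 -> 0 < s ->
  (forall i j, i \in FL -> q <= pr i j) -> (forall i j, j \in FR -> q <= pr i j) ->
  Num.min (mean_match p (cutset n (n - #|FL|) (n - #|FR|)) + (#|FL| + #|FR|)%:R) (n - e0)%:R -
    (#|FL| + #|FR|)%:R * (1 - q) ^+ e0 - (s + p * (n * n)%:R / s) / 2 <=
  Ex (edge_law pr) (fun w => (mu_match w set0)%:R).
Proof.
move=> q01 s0 hL hR.
pose XL := [set v : V | (v.1 == false) && (v.2 \in FL)].
pose XR := [set v : V | (v.1 == true) && (v.2 \in FR)].
have XE : XR :|: XL = flex.
  by apply/setP => v; rewrite !inE; case: v.1; rewrite /= ?orbF.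
have rate_le (i j : 'I_n) u v : ends (i, j) = [set v; u] -> q <= pr i j ->
    edge_law pr [set v; u] ord0 <= 1 - q.
  by move=> <- le; rewrite edge_law_ends /bern /= lerB.
have h1 := @add_set R V (edge_law pr) fst lpr (@edge_law_bip R n pr) q e0 q01 true set0 XR.
have h2 := @add_set R V (edge_law pr) fst lpr (@edge_law_bip R n pr) q e0 q01 false XR XL.
have {}h1 : Ex (edge_law pr) (fun w => (minn (mu_match w XR + #|FR|) (n - e0) - mu_match w set0)%N%:R) <=
    #|FR|%:R * (1 - q) ^+ e0.
  have op : opposite (V := V) fst true set0 = n.
    rewrite /opposite -[RHS]card_ord -cardsT -(card_side false [set: 'I_n]); apply: eq_card => v.
    by rewrite !inE; case: v.1.
  move: h1; rewrite op set0U /XR card_side; apply.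
  - by rewrite -setI_eq0 set0I.
  - by move=> v; rewrite inE => /andP [/eqP].
  - move=> [s1 i] [s2 j] /= si; rewrite inE /= => /andP [/eqP s2E jR]; subst s2.
    case: s1 si => // _; apply: (rate_le i j); last exact: hR.
    by rewrite setUC.
have {}h2 : Ex (edge_law pr) (fun w => (minn (mu_match w flex + #|FL|) (n - #|FR| - e0) - mu_match w XR)%N%:R) <=
    #|FL|%:R * (1 - q) ^+ e0.
  have op : opposite (V := V) fst false XR = (n - #|FR|)%N.
    have cR : #|~: FR| = (n - #|FR|)%N by rewrite cardsCs setCK card_ord.
    rewrite /opposite -cR -(card_side true (~: FR)); apply: eq_card => v.
    by rewrite !inE; case: v.1.
  move: h2; rewrite op XE [#|XL|]card_side; apply.
  - rewrite -setI_eq0; apply/eqP/setP => v; rewrite !inE; by case: v.1; rewrite /= ?andbF.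
  - by move=> v; rewrite inE => /andP [/eqP].
  - move=> [s1 i] [s2 j] /= si; rewrite inE /= => /andP [/eqP s2E jL]; subst s2.
    by case: s1 si => // _; apply: (rate_le j i); last exact: hL.
pose k := (#|FL| + #|FR|)%N.
have h3 : Ex (edge_law pr) (fun w => (minn (mu_match w flex + k) (n - e0))%:R) <=
    Ex (edge_law pr) (fun w => (mu_match w set0)%:R) + k%:R * (1 - q) ^+ e0.
  rewrite natrD mulrDl [X in _ <= _ + X]addrC.
  apply: le_trans (lerD (lexx _) (lerD h1 h2)); rewrite -!ExD; apply: Ex_le => // w.
  rewrite -!natrD ler_nat /k.
  by apply: two_phase_min; rewrite -[leqRHS]card_ord max_card.
set M := mean_match p _.
have M_E : M = Ex (unif_law p) (fun w => (mu_match w flex)%:R) by rewrite /M -mean_flex.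
have h4 : Num.min (M + k%:R) (n - e0)%:R - (s + p * (n * n)%:R / s) / 2 <=
    Ex (edge_law pr) (fun w => (minn (mu_match w flex + k) (n - e0))%:R).
  rewrite (Ex_flex (fun m => (minn (m + k) (n - e0))%:R)).
  apply: le_trans (_ : Num.min (M + k%:R) (n - e0)%:R -
     Ex (unif_law p) (fun w => `|(mu_match w flex)%:R - M|) <= _).
    rewrite lerD2l lerN2 M_E; apply: le_trans (matching_concentration lunif flex s0) _.
    rewrite ler_pM2r ?invr_gt0 // lerD2l ler_pM2r ?invr_gt0 //; exact: unif_mass.
  rewrite -[X in X - _](Ex_cst lunif) -ExB; apply: Ex_le => // w.
  have := ler_norm (M - (mu_match w flex)%:R); rewrite distrC.
  have := normr_ge0 ((mu_match w flex)%:R - M); rewrite natr_min natrD le_min.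
  set d := `|_|; set x := Num.min _ _ => d0 dM.
  have a1 : x <= M + k%:R by rewrite /x ge_min lexx.
  have a2 : x <= (n - e0)%:R by rewrite /x ge_min lexx orbT.
  by apply/andP; split; move: d0 dM a1 a2; lra.
rewrite -/k; move: h3 h4; lra.
Qed.

End Flexible.
End Quenched.

(** This makes [2 - 2 * expR 1 / 3] positive. The proof uses [1 + x <= expR x] at [x = - (1 / 6)],
    since [(5 / 6) ^+ 6] just exceeds 1/3. *)
Lemma expR1_lt3 (R : realType) : expR 1 < 3 :> R.
Proof.
have e6 : 5 / 6 <= expR (- (1 / 6)) :> R by apply: le_trans (expR_ge1Dx _); lra.
have e0 : (5 / 6) ^+ 6 <= expR (- 1) :> R.
  have -> : - 1 = 6%:R * - (1 / 6) :> R by field.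
  by rewrite expRM_natl ler_pXn2r // nnegrE ?expR_ge0 //; lra.
have xy : expR 1 * expR (- 1) = 1 :> R by rewrite -expRD subrr expR0.
rewrite ltNge; apply/negP => le; have : 3 * expR (- 1) <= expR 1 * expR (- 1) :> R.
  by apply: ler_wpM2r => //; exact: expR_ge0.
by rewrite xy; lra.
Qed.

Lemma one_sub_ge_expR (R : realType) (x : R) : 0 <= x <= 1 / 2 -> expR (- (2 * x)) <= 1 - x.
Proof.
move=> /andP [x0 x1]; have e := expR_ge1Dx (2 * x); have e0 := expR_gt0 (2 * x).
rewrite expRN -[leLHS]mul1r ler_pdivrMr //.
apply: le_trans (_ : (1 - x) * (1 + 2 * x) <= _); first by nra.
by apply: ler_wpM2l => //; lra.
Qed.

Section Isolated.
Variables (R : realType) (n : nat) (p : R) (pr : 'I_n -> 'I_n -> R) (FL : {set 'I_n}).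
Hypotheses (p01 : 0 <= p <= 1) (pr01 : forall i j, 0 <= pr i j <= 1).
Hypothesis pr_reg : forall i j, i \notin FL -> pr i j = p.
Local Notation V := (bool * 'I_n)%type.

(** Deleting all non-isolated left vertices destroys every edge, so the matching number is at most
    their number; a left vertex outside [FL] is isolated with probability at least
    [(1 - p) ^+ n]. *)
Lemma isolated_upper : Ex (edge_law pr) (fun w => (mu_match w set0)%:R) <=
  n%:R - (n%:R - #|FL|%:R) * (1 - p) ^+ n.
Proof.
have lpr : is_law (edge_law pr) by apply: edge_law_is_law.
have lunif : is_law (unif_law (n := n) p) by apply: edge_law_is_law.
pose iso (w : {ffun {set V} -> 'I_2}) (i : 'I_n) :=
  [forall x : V, (x != (false, i)) ==> (w [set (false, i); x] == ord0)].
have isoE i : i \notin FL -> (1 - p) ^+ n <= Ex (edge_law pr) (fun w => (iso w i)%:R).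
  move=> iF; apply: le_trans (isolated_mean p01 (false, i)) _; rewrite le_eqVlt; apply/orP; left; apply/eqP.
  apply: (@Ex_agree _ _ _ _ _ [set e : {set V} | (false, i) \in e]) => //.
    move=> e; rewrite inE /unif_law /edge_law => ie; congr bern; case: pickP => // -[i' j] /eqP eq.
    by move: ie; rewrite -eq in_ends /= => /eqP <-; rewrite pr_reg.
  move=> w w' ww; congr (_ : bool)%:R; apply: eq_forallb => x.
  by rewrite ww // !inE eqxx.
apply: le_trans (_ : Ex (edge_law pr) (fun w => n%:R - \sum_(i | i \notin FL) (iso w i)%:R) <= _).
  apply: Ex_le_supp => // w sw; rewrite lerBrDr -natr_sum -natrD ler_nat.
  pose X := [set v : V | (v.1 == false) && (v.2 \in [set i | ~~ iso w i])].
  have M0 : mu_match w X = 0%N.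
    have [P mP eP] := max_weight_attained (wt w) X; rewrite /mu_match eP.
    rewrite big1 // => e eIP; have [h1 h2] := matchingP _ _ _ mP.
    have [_ dX we] := h2 _ eIP; have [[i j] ee] := edge_law_supp sw we.
    have ie : (false, i) \in e by rewrite ee in_ends /=.
    have : iso w i.
      apply: contraT => ni; move/pred0P: dX => /(_ (false, i)); by rewrite /= ie !inE /= ni.
    by move/forallP => /(_ (true, j)) /=; rewrite -[[set _; _]]/(ends (i, j)) -ee /wt => /eqP ->.
  have := max_weight_le_card w set0 X; rewrite set0U M0 add0n => le.
  apply: leq_trans (leq_add le (leqnn _)) _; rewrite card_side.
  rewrite -[leqRHS]card_ord -(cardsC [set i | ~~ iso w i]) leq_add2l -sum1_card.
  rewrite [leqRHS]big_mkcond [leqLHS]big_mkcond; apply: leq_sum => i _.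
  by rewrite !inE negbK; case: (i \notin FL); case: (iso w i).
rewrite ExB Ex_cst // Ex_sum lerD2l lerN2.
apply: le_trans (ler_sum _ isoE); rewrite sumr_const -[_ *+ _ in leRHS]mulr_natl.
apply: ler_wpM2r; first by rewrite exprn_ge0 // subr_ge0; case/andP: p01.
rewrite -natrB; last by rewrite -[leqRHS]card_ord max_card.
rewrite ler_nat -[X in (X - _ <= _)%N]card_ord leq_subLR -(cardsC FL) leq_add2l.
by apply/subset_leq_card/subsetP => i; rewrite inE.
Qed.
End Isolated.

Lemma sub_sub_le (n b f : nat) : (f <= n -> n - b - (n - f) <= f - b)%N.
Proof. lia. Qed.

Lemma sub_sub_le_l (n b f : nat) : (n - f - (n - b) + (n - n) <= b - f)%N.
Proof. lia. Qed.

(** * Averaging over the node types *)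

Section Models.
Variables (R : realType) (n : nat) (alpha alphaf : R).
Hypotheses (n_gt0 : (0 < n)%N) (alpha_gt0 : 0 < alpha) (alphaf_gt0 : 0 < alphaf).
Hypotheses (an : 2 * alpha <= n%:R) (afn : 2 * alphaf <= n%:R).
Local Notation p := (2 * alpha / n%:R).
Local Notation q := (alphaf / n%:R).
Local Notation C := (flexC alpha alphaf).

Let nr : 0 < n%:R :> R. Proof. by rewrite ltr0n. Qed.

Lemma flexC_ge0 x y : 0 <= C x y.
Proof.
have a0 := ltW alpha_gt0; have f0 := ltW alphaf_gt0.
by rewrite mxE; case: ifP => _; [|case: ifP => _]; rewrite ?mulr_ge0 ?addr_ge0.
Qed.

Lemma not_flexible (x : 'I_2) : x != flexible -> x = regular.
Proof. by case: x => -[|[|]] //= i _; apply: val_inj. Qed.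

Lemma flexC_regular x y : x != flexible -> y != flexible -> C x y = 2 * alpha.
Proof. by move=> /not_flexible -> /not_flexible ->; rewrite mxE eqxx. Qed.

Lemma flexC_flexible x y : (x == flexible) || (y == flexible) -> alphaf <= C x y.
Proof.
have a0 := ltW alpha_gt0; have f0 := ltW alphaf_gt0; move=> xy; rewrite mxE.
case: ifP => [/andP [/eqP ex /eqP ey]|_]; first by rewrite ex ey in xy.
by case: ifP => _; lra.
Qed.

Lemma regular_prob01 : 0 <= p <= 1.
Proof.
have a0 := ltW alpha_gt0.
by rewrite divr_ge0 ?mulr_ge0 //= ler_pdivrMr ?mul1r.
Qed.

Lemma flexible_prob01 : 0 <= q <= 1.
Proof.
have f0 := ltW alphaf_gt0; rewrite divr_ge0 //= ler_pdivrMr // mul1r.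
by apply: le_trans afn; lra.
Qed.

Definition flexset (t : {ffun 'I_n -> 'I_2}) : {set 'I_n} := [set i | t i == flexible].

Lemma edge_probs_regular tL tR i j : i \notin flexset tL -> j \notin flexset tR ->
  edge_probs C tL tR i j = p.
Proof.
rewrite !inE => ti tj; rewrite /edge_probs /edge_prob flexC_regular //.
by apply/min_idPr; case/andP: regular_prob01.
Qed.

Lemma edge_probs_flexible (tL tR : {ffun 'I_n -> 'I_2}) i j : (tL i == flexible) || (tR j == flexible) ->
  q <= edge_probs C tL tR i j.
Proof.
move=> ij; rewrite /edge_probs /edge_prob le_min; case/andP: flexible_prob01 => _ -> /=.
by rewrite ler_wpM2r ?invr_ge0 // flexC_flexible.
Qed.

Lemma natsub_le (a b : nat) : ((a - b)%N%:R : R) <= `|a%:R - b%:R|.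
Proof.
have [ab|/ltnW ba] := leqP a b; first by rewrite (eqP ab) normr_ge0.
by rewrite natrB // ler_norm.
Qed.

Lemma Ex_flexset (b : R) : 0 <= b <= 1 ->
  Ex (type_law b) (fun t : {ffun 'I_n -> 'I_2} => `|#|flexset t|%:R - n%:R * b|) <= Num.sqrt n%:R.
Proof.
move=> b01; have := Ex_type_count flexible n_gt0 b01; rewrite /type_prob eqxx.
apply: le_trans; apply: Ex_le => [|t]; first exact: type_law_is_law.
by rewrite (_ : #|flexset t| = #|[pred i | t i == flexible]|) //; apply: eq_card => i; rewrite inE.
Qed.

(** The deterministic [b] replaces both random numbers of flexible nodes at a cost of order
    [Num.sqrt n] plus its distance from the mean; [flexible_lower] is applied with
    [s = Num.sqrt n]. *)
Lemma two_sided_lower (B : R) (b e0 : nat) : 0 <= B / 2 <= 1 ->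
  Num.min (mean_match p (cutset n (n - b) (n - b)) + (2 * b)%N%:R) (n - e0)%:R -
    4 * (Num.sqrt n%:R + `|n%:R * (B / 2) - b%:R|) - 2 * n%:R * (1 - q) ^+ e0 -
    (1 + 2 * alpha) * Num.sqrt n%:R / 2 <=
  expected_matching (B / 2) (B / 2) C n.
Proof.
move=> B01; have lB := type_law_is_law n B01.
rewrite expected_matchingE; last exact: flexC_ge0.
set d := `|n%:R * (B / 2) - b%:R|; set bal := mean_match _ _; set sn := Num.sqrt n%:R.
have sn0 : 0 < sn by rewrite sqrtr_gt0.
have qn (tL tR : {ffun 'I_n -> 'I_2}) : Num.min (bal + (2 * b)%N%:R) (n - e0)%:R -
    2 * (`|#|flexset tL|%:R - n%:R * (B / 2)| + `|#|flexset tR|%:R - n%:R * (B / 2)| + 2 * d) -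
    2 * n%:R * (1 - q) ^+ e0 - (1 + 2 * alpha) * sn / 2 <=
    Ex (edge_law (edge_probs C tL tR)) (fun w => (max_weight (wt w) set0)%:R).
  have e01 := edge_probs01 tL tR flexC_ge0.
  apply: le_trans (flexible_lower (FL := flexset tL) (FR := flexset tR) regular_prob01 e01 _ e0 flexible_prob01 sn0 _ _); last first.
  - by move=> i j; rewrite inE => tj; apply: edge_probs_flexible; rewrite tj orbT.
  - by move=> i j; rewrite inE => ti; apply: edge_probs_flexible; rewrite ti.
  - by move=> i j; apply: edge_probs_regular.
  set fL := #|flexset tL|; set fR := #|flexset tR|.
  have fLn : (fL <= n)%N by rewrite -[leqRHS]card_ord max_card.
  have fRn : (fR <= n)%N by rewrite -[leqRHS]card_ord max_card.
  have lip := mean_match_lip n regular_prob01 (n - b) (n - b) (n - fL) (n - fR).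
  have dL : `|fL%:R - b%:R| <= `|fL%:R - n%:R * (B / 2)| + d :> R by apply: ler_distD.
  have dR : `|fR%:R - b%:R| <= `|fR%:R - n%:R * (B / 2)| + d :> R by apply: ler_distD.
  have lip' : ((n - b - (n - fL)) + (n - b - (n - fR)))%N%:R <= `|fL%:R - b%:R| + `|fR%:R - b%:R| :> R.
    by rewrite natrD; apply: lerD; apply: le_trans (natsub_le _ _); rewrite ler_nat sub_sub_le.
  have nL : b%:R - fL%:R <= `|fL%:R - b%:R| :> R by rewrite distrC ler_norm.
  have nR : b%:R - fR%:R <= `|fR%:R - b%:R| :> R by rewrite distrC ler_norm.
  have del : (fL + fR)%N%:R * (1 - q) ^+ e0 <= 2 * n%:R * (1 - q) ^+ e0.
    apply: ler_wpM2r; first by rewrite exprn_ge0 // subr_ge0; case/andP: flexible_prob01.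
    by rewrite -natrM ler_nat mul2n -addnn leq_add.
  have sE : (sn + p * (n * n)%:R / sn) / 2 = (1 + 2 * alpha) * sn / 2.
    have nn : n%:R = sn * sn by rewrite -expr2 sqr_sqrtr ?ltW.
    have -> : p * (n * n)%:R = 2 * alpha * (sn * sn).
      by rewrite -nn natrM; field; rewrite gt_eqF.
    by field; rewrite gt_eqF.
  rewrite sE lerD2r; apply: lerB => //.
  set x := Num.min (bal + _) _.
  have x1 : x <= bal + (2 * b)%N%:R by rewrite /x ge_min lexx.
  have x2 : x <= (n - e0)%:R by rewrite /x ge_min lexx orbT.
  have d0 : 0 <= d by rewrite normr_ge0.
  have a0 := normr_ge0 (fL%:R - n%:R * (B / 2)); have a1 := normr_ge0 (fR%:R - n%:R * (B / 2)).
  rewrite natrM in x1; rewrite -/bal in lip; rewrite le_min [(fL + fR)%N%:R]natrD.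
  by apply/andP; split; move: x1 x2 lip lip' dL dR nL nR d0 a0 a1; lra.
set f := fun t : {ffun 'I_n -> 'I_2} => `|#|flexset t|%:R - n%:R * (B / 2)|.
set K1 := Num.min _ _; set K2 := 2 * n%:R * _; set K3 := (1 + 2 * alpha) * sn / 2.
apply: le_trans (Ex_le lB (f := fun tL => K1 - 2 * (f tL + sn + 2 * d) - K2 - K3) _); last first.
  move=> tL; apply: le_trans (Ex_le lB (fun tR => qn tL tR)).
  rewrite !ExB !Ex_cst // lerD2r lerD2r lerD2l lerN2 ExZ ler_pM2l // !ExD !Ex_cst //.
  by rewrite lerD2r lerD2l; apply: Ex_flexset.
rewrite !ExB !Ex_cst // ExZ !ExD !Ex_cst //.
by have := Ex_flexset B01; rewrite -/f -/sn; lra.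
Qed.

(** The two bounds are the counterparts of the two terms of the minimum in [two_sided_lower]. *)
Lemma one_sided_upper (B : R) (b : nat) : 0 <= B <= 1 ->
  let OS := expected_matching B 0 C n in
  OS <= mean_match p (cutset n (n - b) n) + b%:R + 2 * (Num.sqrt n%:R + `|n%:R * B - b%:R|) /\
  OS <= n%:R - n%:R * (1 - B) * (1 - p) ^+ n + Num.sqrt n%:R.
Proof.
move=> B01 OS; have lB := type_law_is_law n B01.
have l0 : is_law (type_law (R := R) (n := n) 0) by apply: type_law_is_law; rewrite lexx ler01.
pose reg : {ffun 'I_n -> 'I_2} := [ffun => regular].
have FR0 : flexset reg = set0 by apply/setP => i; rewrite !inE ffunE.
have OSE : OS = Ex (type_law B) (fun tL => Ex (edge_law (edge_probs C tL reg))
    (fun w => (max_weight (wt w) set0)%:R)).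
  rewrite /OS expected_matchingE; last exact: flexC_ge0.
  apply: eq_Ex => tL; rewrite -[RHS](Ex_cst l0); apply: eq_Ex_supp => tR st.
  suff -> : tR = reg by [].
  apply/ffunP => i; rewrite ffunE; apply: not_flexible; apply: contraNN (st i) => /eqP ->.
  by rewrite /type_law /type_prob eqxx.
have e01 tL := edge_probs01 tL reg flexC_ge0.
have preg tL i j : i \notin flexset tL -> edge_probs C tL reg i j = p.
  by move=> ti; apply: edge_probs_regular; rewrite // FR0 inE.
have fn t : (#|flexset t| <= n)%N by rewrite -[leqRHS]card_ord max_card.
have cnt := Ex_flexset B01; set sn := Num.sqrt n%:R in cnt *.
split; rewrite OSE.
  apply: le_trans (Ex_le lB (g := fun tL => mean_match p (cutset n (n - b) n) + b%:R +
    2 * (`|#|flexset tL|%:R - n%:R * B| + `|n%:R * B - b%:R|)) _) _.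
    move=> tL; apply: le_trans (flexible_upper (FL := flexset tL) (FR := flexset reg) regular_prob01 (e01 tL) _) _.
      by move=> i j ti _; apply: preg.
    rewrite FR0 cards0 addn0 subn0.
    have lip := mean_match_lip n regular_prob01 (n - #|flexset tL|) n (n - b) n.
    have d1 : `|#|flexset tL|%:R - b%:R| <= `|#|flexset tL|%:R - n%:R * B| + `|n%:R * B - b%:R| by apply: ler_distD.
    have l1 : ((n - #|flexset tL| - (n - b)) + (n - n))%N%:R <= `|#|flexset tL|%:R - b%:R| :> R.
      by rewrite distrC; apply: le_trans (natsub_le _ _); rewrite ler_nat sub_sub_le_l.
    have l2 := ler_norm (#|flexset tL|%:R - b%:R : R).
    by move: lip d1 l1 l2; lra.
  by rewrite !ExD !Ex_cst // ExZ ExD Ex_cst //; move: cnt; lra.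
have /andP [p0 p1] := regular_prob01.
have pw0 : 0 <= (1 - p) ^+ n by rewrite exprn_ge0 // subr_ge0.
have pw1 : (1 - p) ^+ n <= 1 by rewrite exprn_ile1 ?subr_ge0 // gerBl.
apply: le_trans (Ex_le lB (g := fun tL => n%:R - n%:R * (1 - B) * (1 - p) ^+ n +
    `|#|flexset tL|%:R - n%:R * B|) _) _.
  move=> tL; apply: le_trans (isolated_upper (FL := flexset tL) regular_prob01 (e01 tL) _) _.
    by move=> i j ti; apply: preg.
  have l2 := ler_norm (#|flexset tL|%:R - n%:R * B).
  set F : R := #|flexset tL|%:R in l2 *; set P := _ ^+ n in pw0 pw1 *.
  have : (F - n%:R * B) * P <= `|F - n%:R * B|.
    apply: le_trans (ler_wpM2r pw0 l2) _; by rewrite ler_piMr.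
  by move=> h; rewrite -subr_ge0; move: h; rewrite -subr_ge0 => /le_trans; apply; rewrite le_eqVlt; apply/orP; left; apply/eqP; ring.
by rewrite ExD Ex_cst // lerD2l.
Qed.

End Models.

(** * Choice of the constants and conclusion *)

Lemma rounding_errors (R : realType) (sn a g : R) : 1 <= sn ->
  4 * (15 + a) * sn <= sn * g * sn ->
  (6 + (1 + 2 * a) / 2) * sn + 8 <= sn * g * sn / 4.
Proof.
have -> : 4 * (15 + a) * sn = 60 * sn + 4 * (a * sn) by ring.
have -> : (6 + (1 + 2 * a) / 2) * sn = 13 / 2 * sn + a * sn by field.
set x := sn * g * sn; set y := a * sn; lra.
Qed.

Lemma leq_sum4 (a b c d : nat) : [/\ (a <= a + b + c + d)%N, (b <= a + b + c + d)%N,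
  (c <= a + b + c + d)%N & (d <= a + b + c + d)%N].
Proof. by split; lia. Qed.

(** Up to errors, both terms of the minimum exceed the corresponding one-sided bound by [n * g]. A
    quarter of this margin is spent on the slack [e0], a quarter on failed additions, a quarter on
    fluctuations and rounding; a quarter remains. *)
Lemma two_sided_advantage (R : realType) (B alpha : R) : 0 < B -> B < 1 -> 0 < alpha ->
  exists2 g : R, 0 < g & forall alphaf, 64 / g ^+ 2 < alphaf -> exists N : nat,
  forall n, (N <= n)%N ->
    g / 4 <= expected_matching (B / 2) (B / 2) (flexC alpha alphaf) n / n%:R -
             expected_matching B 0 (flexC alpha alphaf) n / n%:R.
Proof.
move=> B0 B1 a0.
have B01 : 0 <= B / 2 <= 1 by apply/andP; split; lra.
have B01' : 0 <= B <= 1 by apply/andP; split; lra.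
pose ex := expR (- (4 * alpha)); have ex0 : 0 < ex by apply: expR_gt0.
(* Chosen so that [n * ka <= step_gain n p * b ^ 2], given [ex <= (1 - p) ^+ n], [p * n = 2 * alpha]
   and [b >= n * B / 4]. *)
pose ka := ex ^+ 2 * (2 * alpha / (1 + 2 * alpha)) * (B ^+ 2 / 16).
have a1 : 0 < 1 + 2 * alpha by lra.
have ka0 : 0 < ka by rewrite !mulr_gt0 ?exprn_gt0 ?invr_gt0.
(* The second term is a lower bound for the density of isolated regular supply nodes in the
   one-sided model. *)
pose g := Num.min ka ((1 - B) * ex).
have g0 : 0 < g by rewrite lt_min ka0 mulr_gt0 // subr_gt0.
have gka : g <= ka by rewrite ge_min lexx.
have gex : g <= (1 - B) * ex by rewrite ge_min lexx orbT.
exists g => // alphaf haf.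
have af0 : 0 < alphaf by apply: lt_trans haf; rewrite divr_gt0 ?exprn_gt0.
(* [h1] keeps [p] below 1/2 and the flexible probabilities below 1, [h2] and [h3] absorb the
   rounding of [b] and [e0], and [h4] absorbs the errors of order [Num.sqrt n]. *)
have [N1 [_ h1]] := archi_le (4 * alpha + 2 * alphaf).
have [N2 [_ h2]] := archi_le (4 / B).
have [N3 [_ h3]] := archi_le (8 / g).
have [N4 [_ h4]] := archi_le ((4 * (15 + alpha) / g) ^+ 2).
exists (N1 + N2 + N3 + N4).+1 => n Nn.
have n0 : (0 < n)%N by apply: leq_trans Nn.
have nr : 0 < n%:R :> R by rewrite ltr0n.
have nN (N : nat) : (N <= N1 + N2 + N3 + N4)%N -> N%:R <= n%:R :> R.
  by move=> le; rewrite ler_nat (leq_trans le) // ltnW.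
have [l1 l2 l3 l4] := leq_sum4 N1 N2 N3 N4.
have {}h1 : 4 * alpha + 2 * alphaf <= n%:R by apply: le_trans h1 (nN _ l1).
have {}h2 : 4 <= n%:R * B by rewrite -ler_pdivrMr //; apply: le_trans h2 (nN _ l2).
have {}h3 : 8 <= n%:R * g by rewrite -ler_pdivrMr //; apply: le_trans h3 (nN _ l3).
have {}h4 : (4 * (15 + alpha) / g) ^+ 2 <= n%:R by apply: le_trans h4 (nN _ l4).
have an : 2 * alpha <= n%:R by lra.
have afn : 2 * alphaf <= n%:R by lra.
set p := 2 * alpha / n%:R.
have P01 : 0 <= p <= 1 := regular_prob01 n0 a0 an.
set q := alphaf / n%:R.
have Q01 : 0 <= q <= 1 := flexible_prob01 n0 af0 afn.
have pn : p * n%:R = 2 * alpha by rewrite /p divfK // gt_eqF.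
have pw : ex <= (1 - p) ^+ n.
  have -> : ex = expR (- (2 * p)) ^+ n.
    by rewrite -expRM_natl /ex; congr expR; rewrite mulrN mulrCA [n%:R * p]mulrC pn; ring.
  have ph : 0 <= p <= 1 / 2.
    by case/andP: P01 => -> _ /=; rewrite /p ler_pdivrMr //; lra.
  by rewrite ler_pXn2r ?nnegrE ?expR_ge0 ?one_sub_ge_expR // subr_ge0; case/andP: P01.
set b := Num.truncn (n%:R * (B / 2)).
have B20 : 0 <= n%:R * (B / 2) by rewrite mulr_ge0 // divr_ge0 // ltW.
have /andP [b1 b2] := truncn_itv B20; rewrite -/b in b1 b2; rewrite -[b.+1%:R]natr1 in b2.
set e0 := Num.truncn (n%:R * g / 4).
have g40 : 0 <= n%:R * g / 4 by rewrite divr_ge0 // mulr_ge0 // ltW.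
have /andP [e1 e2] := truncn_itv g40; rewrite -/e0 in e1 e2; rewrite -[e0.+1%:R]natr1 in e2.
have bn : (2 * b <= n)%N.
  rewrite -(ler_nat R) natrM; have : n%:R * B <= n%:R by rewrite ler_piMr // ltW.
  by move: b1; clear; lra.
have bal := balance_chain P01 bn.
have sg : n%:R * g <= step_gain n p * (b * b)%:R.
  apply: le_trans (_ : n%:R * ka <= _); first by rewrite ler_pM2l.
  have bB : n%:R * B / 4 <= b%:R by move: b2 h2; clear; lra.
  have nB0 : 0 <= n%:R * B / 4 by rewrite divr_ge0 // mulr_ge0 // ltW.
  have bb : (n%:R * B / 4) ^+ 2 <= (b * b)%:R by rewrite natrM -expr2 ler_pXn2r ?nnegrE.
  have -> : n%:R * ka = ex * (ex * (p / (1 + p * n%:R))) * (n%:R * B / 4) ^+ 2.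
    by rewrite pn /ka /p; field; rewrite !gt_eqF.
  have p0 : 0 <= p by case/andP: P01.
  have r0 : 0 <= p / (1 + p * n%:R) by rewrite divr_ge0 // pn ltW.
  have e0' := ltW ex0.
  have er0 : 0 <= ex * (p / (1 + p * n%:R)) by rewrite mulr_ge0.
  apply: ler_pM => //; [by rewrite mulr_ge0|by rewrite exprn_ge0|].
  by apply: ler_pM => //; apply: ler_wpM2r.
have del : (1 - q) ^+ e0 <= g / 8.
  have := bernoulli_decay Q01 e0; set x := (1 - q) ^+ e0.
  have x0 : 0 <= x by rewrite exprn_ge0 // subr_ge0; case/andP: Q01.
  (* Here the threshold arises: [e0 >= n * g / 8] gives [q * e0 >= alphaf * g / 8], which exceeds
     [8 / g] once [alphaf > 64 / g ^+ 2]. *)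
  have big : 8 / g <= 1 + q * e0%:R.
    apply: le_trans (_ : q * (n%:R * g / 8) <= _); last first.
      apply: le_trans (_ : q * e0%:R <= _); last by rewrite lerDr.
      by apply: ler_wpM2l; [case/andP: Q01|move: e2 h3; clear; lra].
    have -> : q * (n%:R * g / 8) = alphaf * (g / 8) by rewrite /q; field; rewrite gt_eqF.
    have -> : 8 / g = (64 / g ^+ 2) * (g / 8) by field; rewrite gt_eqF.
    by apply: ler_wpM2r; rewrite ?ltW // divr_gt0.
  move=> le; have : x * (8 / g) <= 1 by apply: le_trans le; apply: ler_wpM2l.
  by rewrite mulrA ler_pdivrMr // mul1r => le8; rewrite ler_pdivlMr.
have TS := two_sided_lower n0 a0 af0 an afn b e0 B01.
have [OS1 OS2] := one_sided_upper n0 a0 af0 an (2 * b) B01'.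
set ts := expected_matching (B / 2) _ _ _ in TS *.
set os := expected_matching B _ _ _ in OS1 OS2 *.
rewrite -/p -/q in TS OS1 OS2.
set sn := Num.sqrt n%:R in TS OS1 OS2.
have nn : n%:R = sn * sn by rewrite -expr2 sqr_sqrtr ?ltW.
have d1 : `|n%:R * (B / 2) - b%:R| <= 1 by rewrite ler_norml; apply/andP; split; move: b1 b2; clear; lra.
have d2 : `|n%:R * B - (2 * b)%N%:R| <= 2.
  rewrite natrM; move: b1 b2; set y := b%:R; clearbody y; clear => b1 b2.
  by rewrite ler_norml; apply/andP; split; lra.
have del' : 2 * n%:R * (1 - q) ^+ e0 <= n%:R * g / 4.
  move: (ler_wpM2l (ltW nr) del); set del0 := (1 - q) ^+ e0; clearbody del0; clear.
  by lra.
have cap : n%:R * g <= n%:R * (1 - B) * (1 - p) ^+ n.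
  rewrite -mulrA ler_pM2l //; apply: le_trans gex _.
  by rewrite ler_pM2l // subr_gt0.
have e0n : n%:R - n%:R * g / 4 <= (n - e0)%N%:R.
  apply: le_trans (_ : n%:R - e0%:R <= _); first by move: e1; clear; lra.
  by rewrite lerBlDr -natrD ler_nat addnC -leq_subLR.
set P := (1 - p) ^+ n in cap OS2; set del0 := (1 - q) ^+ e0 in del' TS.
have main : os + n%:R * g / 2 - ((6 + (1 + 2 * alpha) / 2) * sn + 8) <= ts.
  apply: le_trans TS; set x := Num.min _ _.
  have : os - 2 * sn - 4 + 3 / 4 * (n%:R * g) <= x.
    rewrite /x le_min; apply/andP; split.
      by move: bal sg OS1 d2 g40; clear; lra.
    have sn0 : 0 <= sn by rewrite sqrtr_ge0.
    by move: OS2 cap e0n sn0; clearbody P; clear; lra.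
  by move: del' d1; clearbody del0; clear; lra.
have small : (6 + (1 + 2 * alpha) / 2) * sn + 8 <= n%:R * g / 4.
  have s1 : 1 <= sn by rewrite -sqrtr1 ler_wsqrtr // ler1n.
  have K0 : 0 <= 4 * (15 + alpha) / g by rewrite divr_ge0 ?mulr_ge0 ?addr_ge0 ?ltW.
  have : 4 * (15 + alpha) / g <= sn by rewrite -(ger0_norm K0) -sqrtr_sqr ler_wsqrtr.
  rewrite ler_pdivrMr // => le.
  have -> : n%:R * g / 4 = sn * g * sn / 4 by rewrite nn; ring.
  by apply: rounding_errors => //; apply: ler_wpM2r => //; rewrite sqrtr_ge0.
rewrite -mulrBl ler_pdivlMr //; by move: main small; clear; lra.
Qed.

Theorem theorem4 (R : realType) (B alpha : R)
    (hB : 2 - 2 * expR 1 / 3 <= B) (hB1 : B < 1) (halpha : 0 < alpha) :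
  exists alphaf_bar : R, 0 < alphaf_bar /\
    forall alphaf : R, alphaf_bar < alphaf ->
      eta_OS B alpha alphaf < eta_TS B alpha alphaf.
Proof.
have B0 : 0 < B by apply: lt_le_trans hB; have := expR1_lt3 R; lra.
have [g g0 hg] := two_sided_advantage B0 hB1 halpha.
have bar0 : 0 < 64 / g ^+ 2 by rewrite divr_gt0 // exprn_gt0.
exists (64 / g ^+ 2); split => // alphaf haf.
have af0 : 0 < alphaf := lt_trans bar0 haf.
have C0 := flexC_ge0 halpha af0.
have cOS : cvgn (fun n => expected_matching B 0 (flexC alpha alphaf) n / n%:R).
  by apply: expected_matching_cvg => //; apply/andP; split; lra.
have cTS : cvgn (fun n => expected_matching (B / 2) (B / 2) (flexC alpha alphaf) n / n%:R).
  by apply: expected_matching_cvg => //; apply/andP; split; lra.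
have [N hN] := hg _ haf.
(* As both sequences converge, the difference of the limits is the limit of the differences, which
   keeps the uniform gap [g / 4]. *)
rewrite -subr_gt0 /eta_TS /eta_OS /eta -limB //.
apply: lt_le_trans (_ : 0 < g / 4) _; first by rewrite divr_gt0.
apply: limr_ge; first exact: is_cvgB.
by exists N => // n /= /hN.
Qed.
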